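(* Let $p>3$ be prime. Let $a,b\in\mathbb{F}_p$ be such that $E_{a,b}:y^2=x^3+ax+b$ and $E_{-a,b}:y^2=x^3-ax+b$ are both elliptic curves over $\mathbb{F}_p$ with $j(E_{a,b})\neq 0,1728$ and $j(E_{-a,b})\neq 0, 1728$. Then $${}_{4}G_{4}\left[ \begin{array}{cccc} \frac{1}{8}, & \frac{5}{8}, & \frac{3}{8}, & \frac{7}{8} \\ \frac{1}{6}, & \frac{2}{3}, & \frac{1}{3}, & \frac{5}{6} \end{array} \Big| \; \frac{3^6 b^4}{2^4a^6} \right]_p = \frac{\varphi(b)}{p} \left( a_p(E_{a,b}) + a_p(E_{-a,b}) \right).$$
   Context: $\varphi$ is the quadratic character of $\mathbb{F}_p$, $a_p(E):=p+1-\#E(\mathbb{F}_p)$ for an elliptic curve $E/\mathbb{F}_p$, and $j(E)$ is the $j$-invariant. $\Gamma_p$ is Morita's $p$-adic gamma function on $\mathbb{Z}_p$: $\Gamma_p(n):=(-1)^n\prod_{0<j<n,\,p\nmid j}j$ for $n\in\mathbb{Z}^+$, extended continuously, with $\Gamma_p(0)=1$. $\omega:\mathbb{F}_p^*\to\mathbb{Z}_p^{\times}$ is the Teichmüller character ($\omega(x)$ is the $(p-1)$-st root of unity congruent to $x$ mod $p$), $\overline{\omega}$ its inverse, all powers (including the trivial one) extended by $0$ at $0$. For $x\in\mathbb{Q}$, $\langle x\rangle=x-\lfloor x\rfloor$. For an odd prime $p$, $\lambda\in\mathbb{F}_p$ and $a_i,b_i\in\mathbb{Q}\cap\mathbb{Z}_p$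 ($1\le i\le m$), $${}_{m}G_{m}\left[ \begin{array}{ccc} a_1, & \dots, & a_m \\ b_1, & \dots, & b_m \end{array} \Big| \; \lambda \right]_p := \frac{-1}{p-1} \sum_{j=0}^{p-2} (-1)^{jm}\, \overline{\omega}^j(\lambda) \prod_{i=1}^{m} \frac{\Gamma_p(\langle a_i -\frac{j}{p-1} \rangle)}{\Gamma_p(\langle a_i \rangle)} \frac{\Gamma_p(\langle -b_i +\frac{j}{p-1} \rangle)}{\Gamma_p(\langle -b_i \rangle)} (-p)^{-\lfloor\langle a_i \rangle -\frac{j}{p-1}\rfloor -\lfloor\langle -b_i\rangle +\frac{j}{p-1}\rfloor}.$$ *)

(* Defs.v *)
From HB Require Import structures.
From mathcomp Require Import all_boot all_order all_algebra.
From mathcomp Require Import all_classical.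
From mathcomp Require Import topology.

Set Implicit Arguments.
Unset Strict Implicit.
Unset Printing Implicit Defensive.

Import Order.TTheory GRing.Theory Num.Theory.

Local Open Scope ring_scope.
Local Open Scope classical_set_scope.

(** * The ring Z_p, as the inverse limit of the rings Z/p^n *)

(* The term of index n is the representative in [0, p^n) of the class mod p^n;
   the bound follows from coherence. *)
Record padic_int (p : nat) (p_pr : prime p) := PadicInt {
  padic_res :> nat -> nat;
  padic_resP : forall n, padic_res n = (padic_res n.+1 %% p ^ n)%N }.

Section PadicInt.
Variables (p : nat) (p_pr : prime p).
Local Notation Zp := (padic_int p_pr).
Implicit Types x y z : Zp.

HB.instance Definition _ := gen_eqMixin Zp.
HB.instance Definition _ := gen_choiceMixin Zp.

Lemma padic_eqP x y : (forall n, x n = y n) -> x = y.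
Proof.
case: x y => [u hu] [v hv] /= uv; have uvE : u = v by apply/funext.
by case: _ / uvE hv => hv; congr PadicInt; apply: Prop_irrelevance.
Qed.

Lemma padic_mod x n : (x n %% p ^ n)%N = x n.
Proof. by rewrite [x n]padic_resP modn_mod. Qed.

Lemma padic_res_le x m n : (m <= n)%N -> (x n %% p ^ m)%N = x m.
Proof.
move=> /subnKC <-; elim: (n - m)%N => [|k IH]; first by rewrite addn0 padic_mod.
by rewrite -{}[RHS]IH addnS (padic_resP x (m + k)) modn_dvdm // dvdn_exp2l ?leq_addr.
Qed.

Lemma padic_coherent (f : nat -> nat) :
    (forall n, f n.+1 = f n %[mod p ^ n]) ->
  forall n, (f n %% p ^ n = (f n.+1 %% p ^ n.+1) %% p ^ n)%N.
Proof. by move=> hf n; rewrite modn_dvdm ?dvdn_exp2l // hf. Qed.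

Definition padic_of (f : nat -> nat) (hf : forall n, f n.+1 = f n %[mod p ^ n]) :
  Zp := PadicInt p_pr (padic_coherent hf).

Let resS x n : x n.+1 = x n %[mod p ^ n].
Proof. by rewrite -padic_resP padic_mod. Qed.

Fact padic_nat_subproof k n : k = k %[mod p ^ n]. Proof. by []. Qed.
Definition padic_nat k : Zp := padic_of (padic_nat_subproof k).

Fact padic_add_subproof x y n : (x n.+1 + y n.+1 = x n + y n %[mod p ^ n])%N.
Proof. by rewrite -modnDm !resS modnDm. Qed.
Definition padic_add x y : Zp := padic_of (padic_add_subproof x y).

Fact padic_mul_subproof x y n : (x n.+1 * y n.+1 = x n * y n %[mod p ^ n])%N.
Proof. by rewrite -modnMm !resS modnMm. Qed.
Definition padic_mul x y : Zp := padic_of (padic_mul_subproof x y).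

Let p_gt0 n : (0 < p ^ n)%N. Proof. by rewrite expn_gt0 prime_gt0. Qed.

Let res_lt x n : (x n < p ^ n)%N.
Proof. by rewrite -padic_mod ltn_pmod. Qed.

Fact padic_opp_subproof x n :
  (p ^ n.+1 - x n.+1 = p ^ n - x n %[mod p ^ n])%N.
Proof.
apply/eqP; rewrite -(eqn_modDr (x n.+1)) subnK 1?ltnW // -modnDmr resS modnDmr.
by rewrite subnK 1?ltnW // expnS modnMl modnn.
Qed.
Definition padic_opp x : Zp := padic_of (padic_opp_subproof x).

Fact padic_addA : associative padic_add.
Proof. by move=> x y z; apply: padic_eqP => n /=; rewrite modnDmr modnDml addnA. Qed.
Fact padic_addC : commutative padic_add.
Proof. by move=> x y; apply: padic_eqP => n /=; rewrite addnC. Qed.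
Fact padic_add0 : left_id (padic_nat 0) padic_add.
Proof. by move=> x; apply: padic_eqP => n /=; rewrite mod0n padic_mod. Qed.
Fact padic_addN : left_inverse (padic_nat 0) padic_opp padic_add.
Proof.
by move=> x; apply: padic_eqP => n /=; rewrite modnDml subnK ?modnn ?mod0n // ltnW.
Qed.

HB.instance Definition _ :=
  GRing.isZmodule.Build Zp padic_addA padic_addC padic_add0 padic_addN.

Fact padic_mulA : associative padic_mul.
Proof. by move=> x y z; apply: padic_eqP => n /=; rewrite modnMmr modnMml mulnA. Qed.
Fact padic_mulC : commutative padic_mul.
Proof. by move=> x y; apply: padic_eqP => n /=; rewrite mulnC. Qed.
Fact padic_mul1 : left_id (padic_nat 1) padic_mul.
Proof. by move=> x; apply: padic_eqP => n /=; rewrite modnMml mul1n padic_mod. Qed.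
Fact padic_mulD : left_distributive padic_mul padic_add.
Proof.
by move=> x y z; apply: padic_eqP => n /=; rewrite modnMml modnDm mulnDl.
Qed.
Fact padic_1neq0 : padic_nat 1 != padic_nat 0.
Proof.
apply/eqP => /(congr1 (fun x : Zp => x 1%N)) /=.
by rewrite expn1 mod0n modn_small ?prime_gt1.
Qed.

HB.instance Definition _ := GRing.Zmodule_isComNzRing.Build Zp
  padic_mulA padic_mulC padic_mul1 padic_mulD padic_1neq0.

Lemma padic_natrE k n : (k%:R : Zp) n = (k %% p ^ n)%N.
Proof.
elim: k => [//|k IH]; rewrite -addn1 natrD [LHS]/= IH.
by rewrite modnDm.
Qed.

(* The inverse is chosen classically; unitality is mere invertibility. *)
Definition padic_unit : pred Zp := fun x => `[< exists y, y * x = 1 >].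
Definition padic_inv x : Zp :=
  if padic_unit x then xget 0 [set y : Zp | y * x = 1] else x.

Fact padic_mulV : {in padic_unit, left_inverse 1 padic_inv *%R}.
Proof.
move=> x ux; have ux' : padic_unit x by [].
rewrite /padic_inv ux'; case/asboolP: ux' => y yx.
by case: xgetP => [z _ //|/(_ y)]; rewrite /= yx.
Qed.
Fact padic_unitP x y : y * x = 1 -> padic_unit x.
Proof. by move=> yx; apply/asboolP; exists y. Qed.
Fact padic_inv_out : {in [predC padic_unit], padic_inv =1 id}.
Proof. by move=> x; rewrite /padic_inv inE => /negbTE; rewrite -topredE /= => ->. Qed.

HB.instance Definition _ := GRing.ComNzRing_hasMulInverse.Build Zp
  padic_mulV padic_unitP padic_inv_out.

Fact padic_idomain : GRing.integral_domain_axiom Zp.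
Proof.
move=> x y xy0; apply: contraT; rewrite negb_or => /andP[x0 y0].
have nz (z : Zp) : z != 0 -> exists n, z n != 0%N.
  move=> /eqP z0; apply: contrapT => h; apply: z0; apply: padic_eqP => n.
  rewrite /= mod0n; apply: contrapT => zn; apply: h; exists n; exact/eqP.
have [[n xn] [m ym]] := (nz _ x0, nz _ y0).
have val (z : Zp) k l : z k != 0%N -> (k <= l)%N -> (0 < z l)%N /\ (logn p (z l) < k)%N.
  move=> zk kl; have zkE := padic_res_le z kl.
  have zl0 : (0 < z l)%N by rewrite lt0n; apply: contraNneq zk => h; rewrite -zkE h mod0n.
  split=> //; rewrite ltnNge -pfactor_dvdn //.
  by rewrite /dvdn zkE.
have [xN lx] := val _ _ (n + m)%N xn (leq_addr _ _).
have [yN ly] := val _ _ (n + m)%N ym (leq_addl _ _).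
have /eqP : (x * y) (n + m)%N = 0%N by rewrite xy0 /= mod0n.
rewrite [_ (n + m)%N]/= -/(dvdn _ _) pfactor_dvdn ?muln_gt0 ?xN // lognM //.
by rewrite leqNgt -addnS leq_add // ltnW.
Qed.

HB.instance Definition _ :=
  GRing.ComUnitRing_isIntegral.Build Zp padic_idomain.

(* In particular [ratr r : Zp] is the image of r whenever p does not divide the
   denominator of r. *)
Lemma padic_unitE x : (x \is a GRing.unit) = (x 1%N != 0%N).
Proof.
apply/idP/idP => [ux|x1].
  apply/eqP => x10; have := mulVr ux => /(congr1 (fun z : Zp => z 1%N)) /=.
  by rewrite x10 muln0 mod0n expn1 modn_small ?prime_gt1.
have cop n : coprime (p ^ n) (x n).
  case: n => [|n]; first by rewrite expn0 coprime1n.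
  rewrite coprime_pexpl // prime_coprime //; apply: contra x1.
  by rewrite /dvdn; have := @padic_res_le x 1 n.+1 isT; rewrite expn1 => ->.
have ex n : exists k, (k * x n = 1 %[mod p ^ n])%N.
  have [xn0|xn0] := posnP (x n).
    have := cop n; rewrite xn0 /coprime gcdn0 => /eqP ->.
    by exists 0%N; rewrite !modn1.
  have : coprime (x n) (p ^ n) by rewrite coprime_sym.
  move=> /(coprimeP _ xn0)[[k l] /= kl]; exists k.
  have lek : (l * p ^ n <= k * x n)%N.
    by apply/ltnW; rewrite -subn_gt0 kl.
  by rewrite -(subnK lek) kl addnC modnMDl.
have [u hu] := choice ex.
have hy n : (u n.+1 = u n %[mod p ^ n])%N.
  have hu' : (u n.+1 * x n = 1 %[mod p ^ n])%N.
    rewrite -modnMmr -(padic_res_le x (leqnSn n)) modn_mod modnMmr.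
    by rewrite -[LHS](@modn_dvdm (p ^ n.+1)) ?dvdn_exp2l // hu modn_dvdm ?dvdn_exp2l.
  rewrite -[u n.+1]muln1 -modnMmr -(hu n) modnMmr mulnCA -modnMmr hu'.
  by rewrite modnMmr muln1.
apply: (@padic_unitP x (padic_of hy)); apply: padic_eqP => n /=.
by rewrite modnMml hu.
Qed.

(* The p-adic topology: the balls x + p^n Z_p form a neighbourhood basis. *)
Definition padic_ball x n : set Zp := [set y | y n = x n].
Definition padic_nbhs x : set_system Zp := filter_from setT (padic_ball x).

Fact padic_nbhs_filter x : ProperFilter (padic_nbhs x).
Proof.
apply: filter_from_proper; last by move=> n _; exists x.
apply: filter_from_filter; first by exists 0%N.
move=> m n _ _; exists (maxn m n) => // y; rewrite /padic_ball /= => yx.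
split; first by rewrite -!(padic_res_le _ (leq_maxl m n)) yx.
by rewrite -!(padic_res_le _ (leq_maxr m n)) yx.
Qed.
Fact padic_nbhs_singleton x (A : set Zp) : padic_nbhs x A -> A x.
Proof. by move=> [n _]; apply. Qed.
Fact padic_nbhs_nbhs x (A : set Zp) : padic_nbhs x A -> padic_nbhs x (padic_nbhs^~ A).
Proof.
move=> [n _ nA]; exists n => // y yx; exists n => // z zy; apply: nA.
exact: etrans zy yx.
Qed.

HB.instance Definition _ := hasNbhs.Build Zp padic_nbhs.
HB.instance Definition _ := Nbhs_isNbhsTopological.Build Zp
  padic_nbhs_filter padic_nbhs_singleton padic_nbhs_nbhs.

End PadicInt.

(** * The field Q_p *)

Notation padic p_pr := {fraction padic_int p_pr}.

Definition padic_of_int p (p_pr : prime p) (x : padic_int p_pr) : padic p_pr :=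
  FracField.tofrac x.

(** * Morita's p-adic gamma function *)

Definition is_padic_gamma p (p_pr : prime p)
    (g : padic_int p_pr -> padic_int p_pr) : Prop :=
  [/\ continuous g,
      forall n : nat, (0 < n)%N ->
        g n%:R = (-1) ^+ n * \prod_(1 <= j < n | ~~ (p %| j)%N) j%:R
    & g 0 = 1].

(* For odd p there is exactly one such function: the positive integers are dense
   in Z_p and the values on them are uniformly continuous. *)
Definition padic_gamma p (p_pr : prime p) : padic_int p_pr -> padic_int p_pr :=
  xget (fun=> 0) [set g | is_padic_gamma g].

(** * The Teichmueller character *)

(* For nonzero x, Hensel's lemma gives exactly one such z. *)
Definition teichmuller p (p_pr : prime p) (x : 'F_p) : padic_int p_pr :=
  xget 0 [set z : padic_int p_pr | z ^+ p.-1 = 1 /\ (z 1%N)%:R = x].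

Definition teichmuller_inv_pow p (p_pr : prime p) (j : nat) (x : 'F_p) :
    padic_int p_pr :=
  if x == 0 then 0 else (teichmuller p_pr x)^-1 ^+ j.

(** * The function mGm *)

Definition rat_frac (x : rat) : rat := x - (Num.floor x)%:~R.

Definition padic_gamma_rat p (p_pr : prime p) (r : rat) : padic p_pr :=
  padic_of_int (padic_gamma (ratr r : padic_int p_pr)).

Definition padic_G_factor p (p_pr : prime p) (a b t : rat) : padic p_pr :=
  let G := padic_gamma_rat p_pr in
  (G (rat_frac (a - t)) / G (rat_frac a)) *
  (G (rat_frac (- b + t)) / G (rat_frac (- b))) *
  (- p%:R) ^ (- Num.floor (rat_frac a - t) - Num.floor (rat_frac (- b) + t)).

(* Meaningful when the denominators of the parameters are prime to p. *)
Definition padic_G p (p_pr : prime p) (m : nat) (a b : m.-tuple rat)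
    (lambda : 'F_p) : padic p_pr :=
  (- 1 / p.-1%:R) *
  \sum_(0 <= j < p.-1)
    ((-1) ^+ (j * m) * padic_of_int (teichmuller_inv_pow p_pr j lambda) *
     \prod_(i < m)
       padic_G_factor p_pr (tnth a i) (tnth b i) (j%:R / p.-1%:R)).

(** * Elliptic curves y^2 = x^3 + a x + b *)

Section ShortWeierstrass.
Variable F : finFieldType.
Implicit Types a b : F.

Definition sw_disc a b : F := - 16%:R * (4%:R * a ^+ 3 + 27%:R * b ^+ 2).

(* In characteristic other than 2 this is smoothness; in characteristic 2 it is
   never satisfied, and no such equation is smooth. *)
Definition sw_elliptic a b : bool := sw_disc a b != 0.

Definition sw_j a b : F := - 1728%:R * (4%:R * a) ^+ 3 / sw_disc a b.

(* [None] is the point at infinity. *)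
Definition sw_points a b : {set option (F * F)} :=
  [set P | if P is Some (x, y) then y ^+ 2 == x ^+ 3 + a * x + b else true]%SET.

End ShortWeierstrass.

Definition frobenius_trace (p : nat) (a b : 'F_p) : int :=
  p%:Z + 1 - #|sw_points a b|%:Z.

Definition quad_char (p : nat) (x : 'F_p) : int :=
  if x == 0 then 0 else if [exists y : 'F_p, y ^+ 2 == x] then 1 else -1.

(* Main.v *)
(* Substituting x -> (b / a) x shows that phi(b) a_p(E_{a,b}) = - S(b^2 / a^3)
   with S(m) = sum_x phi(m x^3 + x + 1).  The Mellin transform of S is a product
   of Gauss sums, and the sum of the values of S at mu and - mu only involves the
   even powers of omega.  By the Gross-Koblitz formula these Mellin coefficients
   are products of values of Gamma_p, which the multiplication and reflection
   formulas turn into the summands of 4G4.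

   Gross-Koblitz over F_p is obtained by expanding the Dwork exponential
   exp (t (pi + pi^p / p)), with pi^(p-1) = - p and t^p = t, in powers of pi.
   The coefficients are traces of the weighted composition operators
   f(M) |-> h(M) f(p M + j) with h(M) = (- p)^M M! / (p M + j)!; in the basis of
   falling factorials such a trace is h(s) / (1 - p), where s is the fixed point
   of M |-> p M + j, and h interpolates to a value of 1 / Gamma_p. *)

Require Import Defs.
From mathcomp Require Import all_boot all_order all_algebra.
From mathcomp Require Import all_classical.
From mathcomp Require Import topology qpoly.
From mathcomp Require Import cyclic finfield ring lra zify.

Set Implicit Arguments.
Unset Strict Implicit.
Unset Printing Implicit Defensive.

Import Order.TTheory GRing.Theory Num.Theory.
Import Pdiv.CommonRing Pdiv.RingMonic.
Local Open Scope ring_scope.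

(** * Congruences and Teichmueller representatives *)

(** Limits in Q_p and in K[pi] are expressed as congruences between partial sums, for the
    filtrations [pint] and [pi_small], and no p-th root of unity is introduced: [theta] is defined
    outright by Fourier inversion of the Gross-Koblitz values, and its additivity is what needs a
    proof. The obstacle is that exp (t pi) diverges for a Teichmueller t, so that exp (t (pi + pi^p
    / p)) is not the formal product exp (t pi) exp (- t pi) = 1. For t in p Z_p that factorisation
    is legitimate, and this absorbs the difference between om x + om y and om (x + y). Convergence
    rests on p >= 5: division by i! costs at most i/4 powers of p, whereas the i-th finite
    difference of the weight h carries at least i/2. The constant 3^6 / 2^4 is 6^6 / (4^4 2^2), from
    the multiplication formulas for 6, 4 and 2. The 1/p of the theorem comes from the Mellin
    coefficients: reflection gives - (-p)^e = p (-p)^(e-1) for a nontrivial character, and for the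
    trivial one the point x = 0 adds p - 1 to 1. *)

Section PadicCongruence.
Variables (p : nat) (p_pr : prime p).
Local Notation Zp := (padic_int p_pr).
Implicit Types x y z : Zp.

Lemma padic_lt x n : (x n < p ^ n)%N.
Proof. by rewrite -padic_mod ltn_pmod // expn_gt0 prime_gt0. Qed.

Lemma padic_addE x y n : (x + y) n = ((x n + y n) %% p ^ n)%N.
Proof. by []. Qed.

Lemma padic_mulE x y n : (x * y) n = ((x n * y n) %% p ^ n)%N.
Proof. by []. Qed.

Lemma padic_0E n : (0 : Zp) n = 0%N.
Proof. by rewrite /= mod0n. Qed.

Lemma padic_congD n x x' y y' :
  x n = x' n -> y n = y' n -> (x + y) n = (x' + y') n.
Proof. by rewrite !padic_addE => -> ->. Qed.

Lemma padic_congM n x x' y y' :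
  x n = x' n -> y n = y' n -> (x * y) n = (x' * y') n.
Proof. by rewrite !padic_mulE => -> ->. Qed.

Lemma padic_congN n x x' : x n = x' n -> (- x) n = (- x') n.
Proof. by rewrite /= => ->. Qed.

Lemma padic_congB n x x' y y' :
  x n = x' n -> y n = y' n -> (x - y) n = (x' - y') n.
Proof. by move=> xx' yy'; apply: padic_congD => //; apply: padic_congN. Qed.

Lemma padic_congX n k x x' : x n = x' n -> (x ^+ k) n = (x' ^+ k) n.
Proof.
by move=> xx'; elim: k => // k IH; rewrite !exprS; apply: padic_congM.
Qed.

Lemma padic_cong_prod n (I : Type) (r : seq I) (P : pred I) (f g : I -> Zp) :
    (forall i, P i -> f i n = g i n) ->
  (\prod_(i <- r | P i) f i) n = (\prod_(i <- r | P i) g i) n.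
Proof.
move=> fg; apply: (big_ind2 (fun x y : Zp => x n = y n)) => // x x' y y'.
exact: padic_congM.
Qed.

Lemma padic_cong_le m n x y : (m <= n)%N -> x n = y n -> x m = y m.
Proof. by move=> mn xy; rewrite -(padic_res_le x mn) xy padic_res_le. Qed.

Lemma padic_approx x n : x n = ((x n)%:R : Zp) n.
Proof. by rewrite padic_natrE padic_mod. Qed.

Lemma padic_cong_sub0 n x y : (x - y) n = 0%N <-> x n = y n.
Proof.
split=> [xy|xy]; last first.
  by rewrite (padic_congB xy (erefl (y n))) subrr padic_0E.
have := @padic_congD n (x - y) 0 y y; rewrite padic_0E => /(_ xy erefl).
by rewrite subrK add0r.
Qed.

Lemma padic_congP n x y : x n = y n <-> exists z, x = y + p%:R ^+ n * z.
Proof.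
have dvdp z : (p%:R ^+ n * z) n = 0%N.
  by rewrite -natrX padic_mulE padic_natrE modnn mul0n mod0n.
split=> [/padic_cong_sub0 xy|[z ->]]; last first.
  by rewrite (@padic_congD n y y _ 0) ?addr0 // dvdp padic_0E.
have pn0 : (0 < p ^ n)%N by rewrite expn_gt0 prime_gt0.
set u := x - y in xy *.
(* Division by p^n drops the n lowest digits, so the residue of the quotient at k is read from that
   of [u] at k + n. *)
have hu k : ((u (k + n)%N %/ p ^ n) = (u (k.+1 + n)%N %/ p ^ n) %% p ^ k)%N.
  by rewrite modn_divl -expnD -(padic_resP u (k + n)%N).
exists (PadicInt p_pr hu); rewrite -[LHS](subrK y) -/u addrC; congr (_ + _).
apply: padic_eqP => k; rewrite -natrX padic_mulE padic_natrE /=.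
have un0 : (p ^ n %| u (k + n)%N)%N.
  by rewrite /dvdn padic_res_le ?leq_addl // xy.
rewrite modnMml mulnC divnK //; exact: esym (padic_res_le u (leq_addr n k)).
Qed.

Lemma padic_natr_eq0 k : ((k%:R : Zp) == 0) = (k == 0%N).
Proof.
apply/eqP/eqP => [k0|-> //].
have := congr1 (fun z : Zp => z k) k0; rewrite padic_natrE padic_0E modn_small //.
by rewrite ltn_expl // prime_gt1.
Qed.

Lemma padic_unit_natr k : ((k%:R : Zp) \is a GRing.unit) = ~~ (p %| k)%N.
Proof. by rewrite padic_unitE padic_natrE expn1. Qed.

Lemma padic_unit_cong x y : x 1%N = y 1%N ->
  (x \is a GRing.unit) = (y \is a GRing.unit).
Proof. by rewrite !padic_unitE => ->. Qed.

Lemma padic_congV n x y : x \is a GRing.unit -> y \is a GRing.unit ->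
  x n = y n -> x^-1 n = y^-1 n.
Proof.
move=> ux uy xy; have -> : y^-1 = x^-1 + x^-1 * y^-1 * (x - y).
  by rewrite mulrBr mulrAC mulVr // mul1r mulrVK // addrC subrK.
apply/esym/padic_cong_sub0; rewrite addrC addKr.
by move/padic_cong_sub0: xy => xy; rewrite padic_mulE xy muln0 mod0n.
Qed.

Definition padic_red x : 'F_p := (x 1%N)%:R.

Lemma Fp_natr_eq (m n : nat) : (m%:R == n%:R :> 'F_p) = (m == n %[mod p]).
Proof.
rewrite -(inj_eq val_inj) /=; apply/eqP/eqP; rewrite !val_Fp_nat //.
Qed.

Lemma Fp_natr_mod (m : nat) : (m %% p)%:R = m%:R :> 'F_p.
Proof. by apply/eqP; rewrite Fp_natr_eq modn_mod. Qed.

Lemma padic_redM x y : padic_red (x * y) = padic_red x * padic_red y.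
Proof. by rewrite /padic_red padic_mulE expn1 Fp_natr_mod natrM. Qed.

Lemma padic_redD x y : padic_red (x + y) = padic_red x + padic_red y.
Proof. by rewrite /padic_red padic_addE expn1 Fp_natr_mod natrD. Qed.

Lemma padic_red_natr k : padic_red k%:R = k%:R.
Proof. by rewrite /padic_red padic_natrE expn1 Fp_natr_mod. Qed.

Lemma padic_red_eq x y : padic_red x = padic_red y <-> x 1%N = y 1%N.
Proof.
split=> [/eqP|xy]; last by rewrite /padic_red xy.
by rewrite Fp_natr_eq // -[X in (_ == _ %[mod X])]expn1 !padic_mod => /eqP.
Qed.

End PadicCongruence.

(** * The Teichmueller character and its orthogonality relations *)

Section Teichmueller.
Variables (p : nat) (p_pr : prime p).
Local Notation Zp := (padic_int p_pr).
Local Notation red := (@padic_red p p_pr).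
Implicit Types x y : 'F_p.

Lemma Fp_nat_coprime x k : x != 0 -> coprime (x : nat) (p ^ k).
Proof.
move=> x0; apply: coprimeXr; rewrite coprime_sym prime_coprime //.
apply: contra x0 => px; rewrite -[x]natr_Zp -[0]/(0%:R) Fp_natr_eq //.
by rewrite mod0n.
Qed.

(** The powers x^(p^n) of an integer lift converge to the root: by Euler's theorem their (p-1)-st
    powers are 1 modulo p^n, which gives both coherence and the root equation. Fermat's theorem
    gives the residue. *)
Lemma teichmuller_exists x : x != 0 ->
  exists z : Zp, z ^+ p.-1 = 1 /\ red z = x.
Proof.
move=> x0; pose f n := ((x : nat) ^ (p ^ n))%N.
have euler n : (f n ^ p.-1 = 1 %[mod p ^ n])%N.
  case: n => [|n]; first by rewrite expn0 !modn1.
  have := Euler_exp_totient (Fp_nat_coprime n.+1 x0).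
  rewrite totient_pfactor // => e.
  have -> : (f n.+1 ^ p.-1 = (x ^ (p.-1 * p ^ n)) ^ p)%N.
    by rewrite /f -!expnM expnSr mulnC mulnA.
  by rewrite -modnXm e modnXm exp1n.
have fcoh n : (f n.+1 = f n %[mod p ^ n])%N.
  rewrite /f expnS mulnC expnM -/(f n) -[X in (_ ^ X)%N](prednK (prime_gt0 p_pr)).
  by rewrite expnSr -modnMml euler modnMml mul1n.
exists (padic_of p_pr fcoh); split.
  apply: padic_eqP => n; have := padic_approx (padic_of p_pr fcoh) n => e.
  rewrite (padic_congX _ e) -natrX padic_natrE (padic_natrE _ 1) /= modnXm.
  exact: euler.
rewrite /padic_red /= /f !expn1 Fp_natr_mod // natrX natr_Zp.
have := expf_card x; rewrite card_Fp //.
Qed.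

(** Extended by 0 so as to be multiplicative on all of F_p. Its power of exponent 0 is 1 even at 0,
    which is why character sums below run over x != 0. *)
Definition omega (x : 'F_p) : Zp := if x == 0 then 0 else teichmuller p_pr x.

Lemma omega0 : omega 0 = 0.
Proof. by rewrite /omega eqxx. Qed.

Lemma teichmullerP x : x != 0 ->
  teichmuller p_pr x ^+ p.-1 = 1 /\ red (teichmuller p_pr x) = x.
Proof.
move=> x0; have [z hz] := teichmuller_exists x0.
rewrite /teichmuller; case: xgetP => [y _ //|/(_ z)]; by case.
Qed.

Lemma omegaX x : x != 0 -> omega x ^+ p.-1 = 1.
Proof. by move=> x0; rewrite /omega (negbTE x0); case: (teichmullerP x0). Qed.

Lemma red_omega x : red (omega x) = x.
Proof.
have [->|x0] := eqVneq x 0; first by rewrite omega0 (@padic_red_natr _ _ 0).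
by rewrite /omega (negbTE x0); case: (teichmullerP x0).
Qed.

Lemma omega_unit x : x != 0 -> omega x \is a GRing.unit.
Proof.
move=> x0; rewrite padic_unitE; apply: contra x0 => /eqP h.
by rewrite -(red_omega x) /padic_red h.
Qed.

(** In z^(p-1) - 1 = (z - 1)(1 + z + ... + z^(p-2)) the second factor is p - 1 modulo p, hence
    nonzero. *)
Lemma root1_inj (z : Zp) : z ^+ p.-1 = 1 -> z 1%N = (1 : Zp) 1%N -> z = 1.
Proof.
move=> zq z1; apply/eqP; rewrite -subr_eq0.
have /eqP : z ^+ p.-1 - 1 = 0 by rewrite zq subrr.
rewrite subrX1 mulf_eq0 => /orP[// | /eqP h].
have : (p.-1%:R : Zp) 1%N = (0 : Zp) 1%N.
  have -> : (p.-1%:R : Zp) = \sum_(i < p.-1) 1 by rewrite sumr_const card_ord.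
  rewrite -(congr1 (fun u : Zp => u 1%N) h); apply/esym.
  apply: (big_ind2 (fun x y : Zp => x 1%N = y 1%N)).
  - by [].
  - by move=> x x' y y'; apply: padic_congD.
  - by move=> i _; rewrite (padic_congX i z1) expr1n.
rewrite padic_natrE padic_0E expn1 modn_small; last by rewrite prednK ?prime_gt0.
by have := prime_gt1 p_pr; lia.
Qed.

Lemma root_inj (z w : Zp) : z ^+ p.-1 = 1 -> w ^+ p.-1 = 1 ->
  z 1%N = w 1%N -> z = w.
Proof.
move=> zq wq zw; have p1 := prime_gt1 p_pr.
have e : w * w ^+ p.-2 = 1 by rewrite -exprS prednK // -ltnS prednK // ltnW.
have /root1_inj : (z * w ^+ p.-2) ^+ p.-1 = 1.
  by rewrite exprMn zq mul1r exprAC wq expr1n.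
rewrite (padic_congM zw (erefl _)) e => /(_ erefl) h.
by rewrite -[w]mul1r -h -mulrA [_ * w]mulrC e mulr1.
Qed.

Lemma omegaM x y : omega (x * y) = omega x * omega y.
Proof.
have [->|x0] := eqVneq x 0; first by rewrite mul0r omega0 mul0r.
have [->|y0] := eqVneq y 0; first by rewrite mulr0 omega0 mulr0.
apply: root_inj; rewrite ?omegaX ?mulf_neq0 // ?exprMn ?omegaX ?mulr1 //.
by apply/padic_red_eq; rewrite padic_redM !red_omega.
Qed.

Lemma omega1 : omega 1 = 1.
Proof.
apply: root_inj; rewrite ?omegaX ?oner_neq0 ?expr1n //.
by apply/padic_red_eq; rewrite red_omega (padic_red_natr p_pr 1).
Qed.

Lemma omegaXn x n : omega (x ^+ n) = omega x ^+ n.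
Proof.
by elim: n => [|n IH]; rewrite ?expr0 ?omega1 // !exprS omegaM IH.
Qed.

Lemma omegaV x : x != 0 -> omega x^-1 = (omega x)^-1.
Proof.
move=> x0; apply: (mulrI (omega_unit x0)).
by rewrite -omegaM divff // omega1 divrr // omega_unit.
Qed.

Lemma omegaXp x : omega x ^+ p = omega x.
Proof.
have [->|x0] := eqVneq x 0; first by rewrite omega0 expr0n gtn_eqF ?prime_gt0.
have e : p = p.-1.+1 by rewrite prednK ?prime_gt0.
by rewrite [X in _ ^+ X]e exprS omegaX // mulr1.
Qed.

Lemma omega_inj : injective omega.
Proof. by move=> x y e; rewrite -(red_omega x) e red_omega. Qed.

Lemma omega_mod x m n : x != 0 -> (m = n %[mod p.-1])%N ->
  omega x ^+ m = omega x ^+ n.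
Proof.
move=> x0 mn; rewrite (divn_eq m p.-1) (divn_eq n p.-1) mn !exprD.
by rewrite ![(_ * p.-1)%N]mulnC !exprM omegaX // !expr1n.
Qed.

(** Multiplication by omega g ^+ n, with g a generator, permutes the terms. Unless p - 1 divides n
    this factor differs from 1, and the sum vanishes. *)
Lemma sum_omega n : \sum_(x : 'F_p | x != 0) omega x ^+ n =
  if (p.-1 %| n)%N then p.-1%:R else 0.
Proof.
have cardU : #|[pred x : 'F_p | x != 0]| = p.-1.
  by have := cardC1 (0 : 'F_p); rewrite card_Fp.
case: ifPn => [dn|ndn].
  rewrite (eq_bigr (fun=> 1)) ?sumr_const ?cardU // => x x0.
  by rewrite (@omega_mod _ n 0) // mod0n; apply/eqP.
have /hasP[g _ g_prim] : has p.-1.-primitive_root [seq x <- enum 'F_p | x != 0].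
  have q0 : (0 < p.-1)%N by rewrite -ltnS prednK ?prime_gt1 ?prime_gt0.
  apply: (@has_prim_root _ p.-1) => //.
  - apply/allP => x; rewrite mem_filter => /andP[x0 _].
    by apply/unity_rootP/omega_inj; rewrite omegaXn omegaX // omega1.
  - by rewrite filter_uniq // enum_uniq.
  - by rewrite size_filter -cardU cardE /= size_filter enumT.
have g0 : g != 0.
  have q0 : (0 < p.-1)%N by rewrite -ltnS prednK ?prime_gt1 ?prime_gt0.
  by apply/eqP => g0; have := prim_expr_order g_prim;
     rewrite g0 expr0n gtn_eqF // => /eqP; rewrite eq_sym oner_eq0.
set S := \sum_(x | _) _.
have e : omega g ^+ n * S = S.
  rewrite big_distrr /= [RHS](reindex_inj (mulfI g0)) /=.
  apply: eq_big => [x|x _]; first by rewrite mulf_eq0 negb_or g0.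
  by rewrite omegaM exprMn.
have /eqP : (omega g ^+ n - 1) * S = 0 by rewrite mulrBl mul1r e subrr.
rewrite mulf_eq0 subr_eq0 => /orP[|/eqP //].
rewrite -omegaXn -omega1 (inj_eq omega_inj) -(prim_order_dvd g_prim).
by rewrite (negbTE ndn).
Qed.

Lemma sum_omega_exp (x : 'F_p) n : x != 0 ->
  \sum_(0 <= j < p.-1) omega x ^+ (n * j) = if x ^+ n == 1 then p.-1%:R else 0.
Proof.
move=> x0; rewrite big_mkord; case: eqP => [xn|/eqP xn].
  rewrite (eq_bigr (fun=> 1)) ?sumr_const ?card_ord // => i _.
  by rewrite exprM -omegaXn xn omega1 expr1n.
have /eqP : (omega x ^+ n) ^+ p.-1 - 1 = 0.
  by rewrite exprAC omegaX // expr1n subrr.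
rewrite subrX1 mulf_eq0 subr_eq0 -omegaXn -omega1 (inj_eq omega_inj).
rewrite (negbTE xn) /= => /eqP h; rewrite -{}[RHS]h; apply: eq_bigr => i _.
by rewrite omegaXn exprM.
Qed.

End Teichmueller.

(** * The p-adic gamma function *)

Section PadicGamma.
Variables (p : nat) (p_pr : prime p) (p_odd : odd p).
Local Notation Zp := (padic_int p_pr).
Implicit Types x y z : Zp.

(** The ratio Gamma_p (x + 1) / Gamma_p (x). At 0 it is -1, so that [gamma_nat], whose product
    starts at j = 0, takes the value 1 at 0 and -1 at 1. *)
Definition gamma_step x : Zp := if x \is a GRing.unit then - x else -1.

Definition gamma_nat (n : nat) : Zp := \prod_(0 <= j < n) gamma_step j%:R.

Lemma gamma_natS n : gamma_nat n.+1 = gamma_nat n * gamma_step n%:R.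
Proof. exact: big_nat_recr. Qed.

Lemma gamma_natE n : (0 < n)%N ->
  gamma_nat n = (-1) ^+ n * \prod_(1 <= j < n | ~~ (p %| j)%N) j%:R.
Proof.
case: n => // n _; elim: n => [|n IH].
  by rewrite gamma_natS big_geq // /gamma_nat big_geq // /gamma_step padic_unit_natr
    dvdn0 /= mul1r mulr1 expr1.
rewrite gamma_natS IH big_mkcond [in RHS]big_mkcond [in RHS]big_nat_recr //=.
by rewrite /gamma_step padic_unit_natr [in RHS]exprSr; case: ifP => _; ring.
Qed.

Lemma gamma_step_cong n x y : x n = y n -> gamma_step x n = gamma_step y n.
Proof.
case: n => [|n] xy.
  by have := padic_lt (gamma_step x) 0; have := padic_lt (gamma_step y) 0; lia.
rewrite /gamma_step (padic_unit_cong (padic_cong_le _ xy)) //.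
by case: ifP => // _; apply: padic_congN.
Qed.

Lemma gamma_step_unit x : gamma_step x \is a GRing.unit.
Proof. by rewrite /gamma_step; case: ifP; rewrite ?unitrN ?unitr1. Qed.

Lemma gamma_nat_unit n : gamma_nat n \is a GRing.unit.
Proof.
apply: (big_ind (fun x => x \is a GRing.unit)) => [|x y ux uy|i _].
- exact: unitr1.
- by rewrite unitrM ux uy.
- exact: gamma_step_unit.
Qed.

Lemma gamma_nat_shift m n N : (p ^ N %| m)%N ->
  gamma_nat (m + n) N = (gamma_nat m * gamma_nat n) N.
Proof.
move=> dm; elim: n => [|n IH].
  by rewrite addn0 /gamma_nat [X in _ * X]big_geq // mulr1.
rewrite addnS !gamma_natS mulrA; apply: padic_congM => //.
apply: gamma_step_cong; rewrite !padic_natrE -modnDml.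
by move/eqP: dm => ->; rewrite add0n.
Qed.

Lemma gamma_nat_p : gamma_nat p 1%N = (1 : Zp) 1%N.
Proof.
rewrite gamma_natE ?prime_gt0 // -signr_odd p_odd expr1 mulN1r.
have -> : \prod_(1 <= j < p | ~~ (p %| j)%N) (j%:R : Zp) = (p.-1)`!%:R.
  rewrite fact_prod natr_prod prednK ?prime_gt0 // big_nat_cond [RHS]big_nat_cond.
  apply: eq_bigl => j; case jr: (1 <= j < p)%N => //=.
  by case/andP: jr => j1 jp; rewrite gtnNdvd.
apply/padic_cong_sub0; have := prime_gt1 p_pr => p1.
have /dvdnP[k e] : (p %| (p.-1)`!.+1)%N by rewrite -Wilson.
have -> : - (p.-1)`!%:R - 1 = - ((k * p)%:R : Zp) by rewrite -e -natr1; ring.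
by rewrite (padic_congN (_ : _ = (0 : Zp) 1%N)) ?oppr0 ?padic_0E // padic_natrE
  expn1 modnMl.
Qed.

Lemma gamma_nat_dvd n : (p %| n)%N -> gamma_nat n 1%N = (1 : Zp) 1%N.
Proof.
move=> /dvdnP[k ->]; elim: k => [|k IH]; first by rewrite /gamma_nat big_geq.
rewrite mulSn gamma_nat_shift ?expn1 // (padic_congM gamma_nat_p IH).
by rewrite mulr1.
Qed.

(* Inversion permutes the residues prime to p, so their product is its own
   inverse. *)
Lemma gamma_nat_sqr N : (gamma_nat (p ^ N) ^+ 2) N = (1 : Zp) N.
Proof.
case: N => [|N].
  by have := padic_lt (gamma_nat (p ^ 0) ^+ 2) 0; have := padic_lt (1 : Zp) 0; lia.
set M := (p ^ N.+1)%N; have M1 : (1 < M)%N.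
  by rewrite (leq_trans (prime_gt1 p_pr)) // /M expnS leq_pmulr ?expn_gt0 ?prime_gt0.
have M0 : (0 < M)%N by exact: ltnW.
rewrite gamma_natE // exprMn sqrr_sign mul1r.
set P := (\prod_(1 <= j < M | ~~ (p %| j)) j)%N.
rewrite -natr_prod -/P -natrX !padic_natrE (padic_natrE p_pr 1) -/M.
have Pm : P%:R = \prod_(x : 'Z_M | x \is a GRing.unit) x.
  rewrite /P natr_prod.
  transitivity (\prod_(0 <= j < (Zp_trunc M).+2 | ~~ (p %| j)%N) (j%:R : 'Z_M)).
    by rewrite Zp_cast // [RHS]big_ltn_cond // dvdn0.
  rewrite big_mkord; apply: eq_big => [x|x _]; last by rewrite natr_Zp.
  by rewrite -[x in RHS]natr_Zp unitZpE // coprime_pexpl // prime_coprime.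
have /eqP : (P%:R : 'Z_M) * P%:R = 1%:R.
  have e : \prod_(x : 'Z_M | x \is a GRing.unit) x = P%:R^-1.
    rewrite Pm -prodrV // (reindex_inj invr_inj) /=.
    by apply: eq_bigl => x; rewrite unitrV.
  rewrite {2}Pm e divrr // Pm.
  apply: (big_ind (fun x : 'Z_M => x \is a GRing.unit)) => [|x y ux uy|//].
    exact: unitr1.
  by rewrite unitrM ux uy.
rewrite -natrM -(inj_eq val_inj) /= !val_Zp_nat // Zp_cast // => /eqP <-.
by rewrite mulnn.
Qed.

(** The value g at p^N squares to 1 modulo p^N and is 1 modulo p by Wilson's theorem. As p is odd, g
    + 1 is a unit and can be cancelled from g^2 - 1. *)
Lemma gamma_nat_Xp N m : (p ^ N %| m)%N -> gamma_nat m N = (1 : Zp) N.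
Proof.
suff base : gamma_nat (p ^ N) N = (1 : Zp) N.
  move=> /dvdnP[k ->]; elim: k => [|k IH]; first by rewrite /gamma_nat big_geq.
  by rewrite mulSn gamma_nat_shift // (padic_congM base IH) mulr1.
case: N => [|N].
  by have := padic_lt (gamma_nat (p ^ 0)) 0; have := padic_lt (1 : Zp) 0; lia.
have g1 : gamma_nat (p ^ N.+1) 1%N = (1 : Zp) 1%N.
  by apply: gamma_nat_dvd; rewrite expnS dvdn_mulr.
set g := gamma_nat _ in g1 *.
have ug : g + 1 \is a GRing.unit.
  rewrite (padic_unit_cong (padic_congD g1 (erefl _))) -(natrD _ 1 1).
  rewrite padic_unit_natr.
  rewrite gtnNdvd //; have := prime_gt1 p_pr.
  by rewrite leq_eqVlt => /orP[/eqP p2|//]; move: p_odd; rewrite -p2.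
apply/padic_cong_sub0; have -> : g - 1 = (g + 1)^-1 * (g ^+ 2 - 1).
  by rewrite (_ : g ^+ 2 - 1 = (g + 1) * (g - 1)) ?mulKr //; ring.
have /padic_cong_sub0 e := gamma_nat_sqr N.+1.
by rewrite padic_mulE e muln0 mod0n.
Qed.

Lemma gamma_nat_cong N m n : (m = n %[mod p ^ N])%N ->
  gamma_nat m N = gamma_nat n N.
Proof.
have red k : gamma_nat k N = gamma_nat (k %% p ^ N) N.
  rewrite [in LHS](divn_eq k (p ^ N)) gamma_nat_shift ?dvdn_mull //.
  by rewrite (padic_congM (gamma_nat_Xp (dvdn_mull _ (dvdnn _))) (erefl _)) mul1r.
by move=> mn; rewrite red mn -red.
Qed.

Fact gamma_coherent x n :
  (gamma_nat (x n.+1) n.+1 = gamma_nat (x n) n %[mod p ^ n])%N.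
Proof.
rewrite padic_res_le // padic_mod; apply: gamma_nat_cong.
by rewrite padic_res_le // padic_mod.
Qed.

Definition gamma_lim x : Zp := padic_of p_pr (gamma_coherent x).

Lemma gamma_limE N n x : x N = (n%:R : Zp) N -> gamma_lim x N = gamma_nat n N.
Proof.
move=> xn; rewrite /= padic_mod; apply: gamma_nat_cong.
by rewrite xn padic_natrE modn_mod.
Qed.

Lemma gamma_lim_is_gamma : is_padic_gamma gamma_lim.
Proof.
split.
- move=> x A [N _ NA]; exists N => // y yx; apply: NA.
  by rewrite /padic_ball /= in yx *; rewrite yx.
- move=> n n0; rewrite -gamma_natE //; apply: padic_eqP => N.
  exact: gamma_limE.
- apply: padic_eqP => N; rewrite (@gamma_limE N 0%N) //.
  by rewrite /gamma_nat big_geq.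
Qed.

Lemma is_padic_gammaE g N n x : is_padic_gamma g -> x N = (n%:R : Zp) N ->
  g x N = gamma_nat n N.
Proof.
move=> [gc gn _] xn.
have [M _ hM] : nbhs x (g @^-1` padic_ball (g x) N)%classic.
  by apply: gc; exists N.
(* Adding p^L keeps the residue of x and makes the integer positive, as the characterisation of [g]
   speaks only of n > 0. *)
pose L := maxn M N; pose k := (x L + p ^ L)%N.
have k0 : (0 < k)%N by rewrite addn_gt0 expn_gt0 (prime_gt0 p_pr) orbT.
have kL : (k%:R : Zp) L = x L by rewrite padic_natrE /k modnDr padic_mod.
have <- : g k%:R N = g x N.
  by apply: hM; rewrite /padic_ball /=; apply: padic_cong_le kL; apply: leq_maxl.
rewrite gn // -gamma_natE //; apply: gamma_nat_cong.
have := padic_cong_le (leq_maxr M N) kL.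
by rewrite padic_natrE => ->; rewrite xn padic_natrE.
Qed.

Local Notation Gamma := (@padic_gamma p p_pr).

Lemma padic_gammaE N n x : x N = (n%:R : Zp) N -> Gamma x N = gamma_nat n N.
Proof.
apply: is_padic_gammaE; rewrite /padic_gamma.
by case: xgetP => [g _ //|/(_ _ gamma_lim_is_gamma)].
Qed.

Lemma padic_gamma_nat n : Gamma n%:R = gamma_nat n.
Proof. by apply: padic_eqP => N; apply: padic_gammaE. Qed.

Lemma padic_gamma_cong N x y : x N = y N -> Gamma x N = Gamma y N.
Proof.
move=> xy; rewrite (padic_gammaE (padic_approx x N)); apply/esym/padic_gammaE.
by rewrite -xy -padic_approx.
Qed.

Lemma padic_gammaS x : Gamma (x + 1) = Gamma x * gamma_step x.
Proof.
apply: padic_eqP => N; have e := padic_approx x N.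
rewrite (padic_congM (padic_gammaE e) (gamma_step_cong e)) -gamma_natS.
by apply: padic_gammaE; rewrite -natr1; apply: padic_congD.
Qed.

Lemma padic_gamma_unit x : Gamma x \is a GRing.unit.
Proof.
rewrite (padic_unit_cong (padic_gammaE (padic_approx x 1))).
exact: gamma_nat_unit.
Qed.

Lemma padic_gamma0 : Gamma 0 = 1.
Proof. by rewrite (padic_gamma_nat 0) /gamma_nat big_geq. Qed.

Lemma padic_gamma1 : Gamma 1 = -1.
Proof.
by rewrite (padic_gamma_nat 1) gamma_natS /gamma_nat big_geq // mul1r /gamma_step
  padic_unit_natr dvdn0.
Qed.

End PadicGamma.

(** * Reflection and multiplication formulas for Gamma_p at the points k / (p - 1) *)

Section GammaProducts.
Variables (p : nat) (p_pr : prime p) (p_odd : odd p).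
Local Notation Zp := (padic_int p_pr).
Local Notation Gamma := (@padic_gamma p p_pr).
Local Notation om := (@omega p p_pr).
Local Notation red := (@padic_red p p_pr).
Implicit Types x y z u : Zp.

(** Binomial expansion modulo e^2. If p^(n+1) divides e and m = p, both correction terms are
    divisible by p^(n+2): p-th powers sharpen congruences. *)
Lemma expr_shift (R : comNzRingType) (y e : R) m :
  exists w, (y + e) ^+ m = y ^+ m + e * (m%:R * y ^+ m.-1 + e * w).
Proof.
elim: m => [|m [w IH]]; first by exists 0; rewrite !expr0; ring.
exists (y * w + m%:R * y ^+ m.-1 + e * w).
case: m IH => [|m] IH; first by rewrite exprS IH !expr0 /=; ring.
by rewrite exprS IH /= !exprS -![in RHS]natr1; ring.
Qed.

Lemma padic_cong_exp_p n x y : x n.+1 = y n.+1 -> (x ^+ p) n.+2 = (y ^+ p) n.+2.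
Proof.
move=> /padic_congP[z ->]; have [w ->] := expr_shift y (p%:R ^+ n.+1 * z) p.
apply/padic_congP; exists (z * (y ^+ p.-1 + p%:R ^+ n * z * w)).
by rewrite !exprS; ring.
Qed.

Lemma padic_exp_omega u N : u \is a GRing.unit ->
  (u ^+ (p ^ N)) N.+1 = om (red u) N.+1.
Proof.
move=> uu; elim: N => [|N IH]; first by apply/padic_red_eq; rewrite red_omega.
by rewrite expnSr exprM (padic_cong_exp_p IH) omegaXp.
Qed.

(** The number (p^N - 1) / (p - 1), written 1...1 in base p; see [repunitM]. *)
Fixpoint repunit N := if N is N'.+1 then (repunit N' + p ^ N')%N else 0%N.

Lemma repunitS N : repunit N.+1 = (1 + p * repunit N)%N.
Proof.
elim: N => [|N IH]; first by rewrite /= muln0.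
by rewrite [LHS]/= -/(repunit N.+1) {1}IH /= mulnDr expnS addnA.
Qed.

Lemma repunitM N : (p.-1 * repunit N).+1 = (p ^ N)%N.
Proof.
have p0 := prime_gt0 p_pr.
elim: N => [|N IH]; first by rewrite muln0.
by rewrite /= mulnDr -addSn IH -mulSn prednK // expnS.
Qed.

Section QuasiPeriodic.
Variables (F : Zp -> Zp) (u : Zp).
Hypothesis u_unit : u \is a GRing.unit.
Hypothesis F_cong : forall N x y, x N = y N -> F x N = F y N.
Hypothesis F_step : forall x,
  F (x + 1) * (if x \is a GRing.unit then u else 1) = F x.

(** Made for two cases: Gamma_p (x) Gamma_p (1 - x) with u = -1, and the product of the Gamma_p ((x
    + h) / m) divided by Gamma_p (x) with u = m. Each step at an x prime to p costs a factor [u],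
    and n - n / p of the integers 0, ..., n are prime to p. *)
Lemma quasi_periodic_nat n : F n.+1%:R * u ^+ (n - n %/ p) = F 0.
Proof.
elim: n => [|n IH].
  by have := F_step 0; rewrite unitr0 add0r div0n expr0.
rewrite -natr1 -IH -(F_step n.+1%:R) padic_unit_natr divnS ?prime_gt0 // -mulrA.
congr (_ * _); have : (n %/ p <= n)%N := leq_div n p.
case: (p %| n.+1)%N => /= h.
  by rewrite mul1r; congr (_ ^+ _); lia.
by rewrite -exprS; congr (_ ^+ _); lia.
Qed.

(* k/(p-1) is the limit of the integers 1 + (p-1-k)(p^N-1)/(p-1). *)
Lemma quasi_periodic k y : (k < p.-1)%N -> y * p.-1%:R = k%:R ->
  F y = F 0 * om (red u) ^+ k.
Proof.
move=> kq yk; pose k' := (p.-1 - k)%N.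
have kk : (k + k')%N = p.-1 by rewrite /k'; lia.
have u0 : red u != 0.
  apply/eqP => h; move: u_unit; have /padic_red_eq/padic_unit_cong -> : red u = red 0.
    by rewrite h (padic_red_natr p_pr 0).
  by rewrite unitr0.
suff e : F y * om (red u) ^+ k' = F 0.
  by rewrite -e -mulrA -exprD addnC kk omegaX // mulr1.
apply: padic_eqP => N; apply: (@padic_cong_le _ _ N N.+1) => //.
(* All base p digits of X equal k', so X - X / p = p^N k' positive integers up to X are prime to p;
   and u^(p^N) is the Teichmueller representative of [u] modulo p^(N+1). *)
pose X := (k' * repunit N.+1)%N.
have qX : (p.-1 * X.+1 = k + k' * p ^ N.+1)%N.
  by rewrite -repunitM mulnS mulnS /X; nia.
have qu : (p.-1%:R : Zp) \is a GRing.unit.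
  by rewrite padic_unit_natr gtnNdvd //; lia.
have yX : y N.+1 = (X.+1%:R : Zp) N.+1.
  apply/padic_congP; exists (- k'%:R / p.-1%:R); apply: (mulIr qu).
  rewrite yk mulrDl -natrM [(X.+1 * _)%N]mulnC qX mulrA mulrVK //.
  by rewrite natrD natrM natrX; ring.
have eX : (X - X %/ p = p ^ N * k')%N.
  have -> : (X %/ p = k' * repunit N)%N.
    rewrite /X repunitS mulnDr muln1 mulnCA addnC [(p * _)%N]mulnC.
    rewrite divnMDl ?prime_gt0 //.
    by rewrite divn_small ?addn0 //; lia.
  by rewrite /X /= mulnDr mulnC; lia.
rewrite -(quasi_periodic_nat X) eX exprM.
apply: padic_congM; first exact: F_cong.
by apply: padic_congX; rewrite padic_exp_omega.
Qed.

End QuasiPeriodic.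

Lemma padic_gamma_reflection k y : (k < p.-1)%N -> y * p.-1%:R = k%:R ->
  Gamma y * Gamma (1 - y) = (-1) ^+ k.+1.
Proof.
move=> kq yk; pose F x := Gamma x * Gamma (1 - x).
have Fs x : F (x + 1) * (if x \is a GRing.unit then -1 else 1) = F x.
  rewrite /F opprD addrCA subrr addr0 [1 - x]addrC !padic_gammaS //.
  by rewrite /gamma_step unitrN; case: ifP => _; ring.
have Fc N x x' : x N = x' N -> F x N = F x' N.
  move=> xx'; apply: padic_congM; apply: padic_gamma_cong => //.
  exact: padic_congB.
have uN1 : (-1 : Zp) \is a GRing.unit by rewrite unitrN unitr1.
rewrite -/(F y) (quasi_periodic uN1 Fc Fs kq yk) /F subr0.
rewrite padic_gamma0 // padic_gamma1 // mul1r exprS; congr (_ * _ ^+ _).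
apply: root_inj; last by apply/padic_red_eq; rewrite red_omega.
  rewrite omegaX //; apply/eqP => h.
  have /padic_red_eq/padic_unit_cong : red (-1 : Zp) = red 0.
    by rewrite h (padic_red_natr p_pr 0).
  by rewrite uN1 unitr0.
have /negbTE ev : ~~ odd p.-1 by rewrite -oddS prednK ?prime_gt0.
by rewrite -signr_odd ev.
Qed.

Lemma padic_gamma_multiplication m k y : (0 < m)%N -> ~~ (p %| m)%N ->
    (k < p.-1)%N -> y * p.-1%:R = k%:R ->
  \prod_(0 <= h < m) Gamma ((y + h%:R) / m%:R) =
  \prod_(0 <= h < m) Gamma (h%:R / m%:R) * om m%:R ^+ k * Gamma y.
Proof.
case: m => // m _ pm kq yk.
have um : (m.+1%:R : Zp) \is a GRing.unit by rewrite padic_unit_natr.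
pose P x := \prod_(0 <= h < m.+1) Gamma ((x + h%:R) / m.+1%:R).
pose F x := P x / Gamma x.
(* The shift replaces the factor at x / m.+1 by the one at x / m.+1 + 1 and permutes the others. *)
have Ps x : P (x + 1) = P x * gamma_step (x / m.+1%:R).
  rewrite /P big_nat_recr // [in RHS]big_nat_recl //= mulrAC addr0.
  rewrite -padic_gammaS // mulrC; congr (Gamma _ * _).
    by rewrite -addrA [1 + _]addrC natr1 mulrDl divrr.
  by apply: eq_bigr => h _; rewrite -addrA [1 + _]addrC natr1.
have Fs x : F (x + 1) * (if x \is a GRing.unit then m.+1%:R else 1) = F x.
  have ux := padic_gamma_unit p_odd x; have us := gamma_step_unit x.
  set w := if _ then _ else _.
  have key : gamma_step (x / m.+1%:R) * w = gamma_step x.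
    rewrite /w /gamma_step unitrM unitrV um andbT.
    by case: ifP => _; rewrite ?mulr1 // mulNr mulrVK.
  rewrite /F Ps padic_gammaS // invrM //.
  transitivity (P x / Gamma x * (gamma_step (x / m.+1%:R) * w / gamma_step x)).
    by set a := (Gamma x)^-1; set b := (gamma_step x)^-1; ring.
  by rewrite key divrr // mulr1.
have Fc N x x' : x N = x' N -> F x N = F x' N.
  move=> xx'; apply: padic_congM; last first.
    by apply: padic_congV; rewrite ?padic_gamma_unit //; apply: padic_gamma_cong.
  apply: padic_cong_prod => h _; apply: padic_gamma_cong => //.
  by apply: padic_congM => //; apply: padic_congD.
have := quasi_periodic um Fc Fs kq yk.
rewrite padic_red_natr /F padic_gamma0 // divr1 /P => /(canRL (divrK _)) ->.
  by congr (_ * _ * _); apply: eq_bigr => h _; rewrite add0r.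
exact: padic_gamma_unit.
Qed.

End GammaProducts.

(** * The filtration of Q_p by the p^N Z_p, and the valuation of factorials *)

Section PadicIntegral.
Variables (p : nat) (p_pr : prime p).
Local Notation Zp := (padic_int p_pr).
Local Notation K := {fraction Zp}.
Local Notation "x %:F" := (@FracField.tofrac Zp x) : ring_scope.
Implicit Types x y : K.

Definition pint N x := exists z : Zp, x = (p%:R ^+ N * z)%:F.

Lemma frac_natr n : (n%:R : Zp)%:F = n%:R.
Proof. exact: rmorph_nat. Qed.

Lemma frac_natr_eq0 n : ((n%:R : K) == 0) = (n == 0%N).
Proof. by rewrite -frac_natr tofrac_eq0 padic_natr_eq0. Qed.

Lemma frac_fact_neq0 n : (n`!%:R : K) != 0.
Proof. by rewrite frac_natr_eq0 -lt0n fact_gt0. Qed.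

Lemma frac_p_neq0 : (p%:R : K) != 0.
Proof. by rewrite frac_natr_eq0 -lt0n prime_gt0. Qed.

Lemma pint0 N : pint N 0.
Proof. by exists 0; rewrite mulr0 rmorph0. Qed.

Lemma pintD N x y : pint N x -> pint N y -> pint N (x + y).
Proof. by move=> [z ->] [w ->]; exists (z + w); rewrite mulrDr rmorphD. Qed.

Lemma pintN N x : pint N x -> pint N (- x).
Proof. by move=> [z ->]; exists (- z); rewrite mulrN rmorphN. Qed.

Lemma pintB N x y : pint N x -> pint N y -> pint N (x - y).
Proof. by move=> hx hy; apply/pintD/pintN. Qed.

Lemma pintM M N x y : pint M x -> pint N y -> pint (M + N) (x * y).
Proof.
by move=> [z ->] [w ->]; exists (z * w); rewrite -rmorphM exprD mulrACA.
Qed.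

Lemma pint_le M N x : (M <= N)%N -> pint N x -> pint M x.
Proof.
move=> /subnKC <- [z ->]; exists (p%:R ^+ (N - M) * z).
by rewrite exprD mulrA.
Qed.

Lemma pint_tofrac (z : Zp) : pint 0 z%:F.
Proof. by exists z; rewrite expr0 mul1r. Qed.

Lemma pint_natr n : pint 0 n%:R.
Proof. by rewrite -frac_natr; apply: pint_tofrac. Qed.

Lemma pintMl N x y : pint 0 x -> pint N y -> pint N (x * y).
Proof. exact: pintM. Qed.

Lemma pint_pX n : pint n (p%:R ^+ n).
Proof. by exists 1; rewrite mulr1 rmorphXn /= frac_natr. Qed.

Lemma pint_pMX n N x : pint N x -> pint (n + N) (p%:R ^+ n * x).
Proof. by move=> hx; apply: pintM => //; apply: pint_pX. Qed.

Lemma pint_pM N x : pint N x -> pint N.+1 (p%:R * x).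
Proof. by rewrite -add1n -[p%:R]expr1; apply: pint_pMX. Qed.

Lemma pint_sum N (I : Type) (r : seq I) (P : pred I) (f : I -> K) :
  (forall i, P i -> pint N (f i)) -> pint N (\sum_(i <- r | P i) f i).
Proof.
by move=> h; apply: (big_ind (pint N)) => //; [apply: pint0 | apply: pintD].
Qed.

Lemma pint_div_nat N x n : ~~ (p %| n)%N -> pint N (n%:R * x) -> pint N x.
Proof.
move=> pn [z e]; have un : (n%:R : Zp) \is a GRing.unit by rewrite padic_unit_natr.
exists (z / n%:R); have n0 : (n%:R : K) != 0.
  by rewrite frac_natr_eq0; apply: contraNneq pn => ->; rewrite dvdn0.
apply: (mulfI n0); rewrite e -frac_natr -rmorphM /= mulrCA; congr (_ * _)%:F.
by rewrite mulrC divrK.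
Qed.

Lemma pint_cong N (z w : Zp) : z N = w N <-> pint N (z%:F - w%:F).
Proof.
split=> [/padic_congP[u ->]|[u /eqP]].
  by exists u; rewrite -rmorphB addrC addKr.
rewrite -rmorphB tofrac_eq subr_eq addrC => /eqP ->.
by apply/padic_congP; exists u.
Qed.

(** Legendre's formula bounds the valuation by n / (p - 1), and p - 1 >= 4. The extra term n / p^m
    makes the bound on partial sums inductive. *)
Lemma logn_fact_le n : (4 < p)%N -> (4 * logn p n`! <= n)%N.
Proof.
move=> p4; rewrite logn_fact //.
have key m : (4 * \sum_(1 <= k < m.+1) n %/ p ^ k + n %/ p ^ m <= n)%N.
  elim: m => [|m IH]; first by rewrite big_geq // expn0 divn1.
  rewrite big_nat_recr //=; apply: leq_trans IH.
  rewrite mulnDr -addnA leq_add2l expnSr divnMA.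
  by move: (n %/ p ^ m)%N => a; have := leq_divM a p; move: (a %/ p)%N => b; nia.
by apply: leq_trans (key n); rewrite leq_addr.
Qed.

Lemma pint_inv_fact n N x : (4 < p)%N -> (n %/ 4 <= N)%N ->
  pint N (n`!%:R * x) -> pint (N - n %/ 4) x.
Proof.
move=> p4 nN [z e]; have vn := logn_fact_le n p4.
have [m pm em] := pfactor_coprime p_pr (fact_gt0 n).
have vN : (logn p n`! <= n %/ 4)%N by lia.
apply: (@pint_le _ (N - logn p n`!)); first lia.
apply: (@pint_div_nat _ _ m); first by rewrite -prime_coprime.
exists z; apply: (mulfI (expf_neq0 (logn p n`!) frac_p_neq0)).
move: e; rewrite {1}em natrM natrX -mulrA mulrCA => ->.
rewrite !rmorphM !rmorphXn /= !frac_natr mulrA -exprD subnKC //.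
by apply: leq_trans nN.
Qed.

End PadicIntegral.

(** * The coefficients of exp (T + T^p / p) *)

Section DworkExponential.
Variables (K : fieldType) (p : nat).
Hypothesis K_char0 : forall n, ((n%:R : K) == 0) = (n == 0%N).
Hypothesis p_gt0 : (0 < p)%N.

Let f0 n : (n`!%:R : K) != 0.
Proof. by rewrite K_char0 -lt0n fact_gt0. Qed.

Let p_neq0 : (p%:R : K) != 0.
Proof. by rewrite K_char0 -lt0n. Qed.

Definition dwork_term (z : K) k v : K :=
  if (p * v <= k)%N then
    z ^+ (k - p * v + v) / ((k - p * v)`!%:R * v`!%:R * p%:R ^+ v) else 0.

(* Coefficient of T^k in exp (z (T + T^p / p)). *)
Definition dwork_coef (z : K) k : K := \sum_(v < k.+1) dwork_term z k v.

Lemma dwork_coef_sum z k n : (k < p * n)%N ->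
  dwork_coef z k = \sum_(v < n) dwork_term z k v.
Proof.
have ext n1 n2 : (n1 <= n2)%N -> (k < p * n1)%N ->
    \sum_(v < n1) dwork_term z k v = \sum_(v < n2) dwork_term z k v.
  move=> n12 kn; rewrite (big_ord_widen _ (dwork_term z k) n12) big_mkcond.
  apply: eq_bigr => v _; case: ifP => // /negbT h.
  by rewrite /dwork_term ifN // -ltnNge; nia.
move=> kn; have [le|le] := leqP k.+1 n; first by apply: ext => //; nia.
by apply/esym/ext => //; exact: ltnW.
Qed.

Lemma dwork_coef_widen z k n : (k < n)%N ->
  dwork_coef z k = \sum_(v < n) dwork_term z k v.
Proof. by move=> kn; apply: dwork_coef_sum; nia. Qed.

Lemma dwork_coef0 z : dwork_coef z 0 = 1.
Proof.
by rewrite /dwork_coef big_ord1 /dwork_term muln0 /= fact0 !expr0 !mulr1 divr1.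
Qed.

Lemma natr_factS k : k.+1`!%:R = k.+1%:R * k`!%:R :> K.
Proof. by rewrite factS natrM. Qed.

(** The series E = exp (z (T + T^p / p)) satisfies E' = z (1 + T^(p-1)) E. The sums of [A] and [B]
    are the contributions of the two exponentials, obtained by writing k + 1 as (k + 1 - p v) + p
    v. *)
Lemma dwork_coef_rec z k : k.+1%:R * dwork_coef z k.+1 =
  z * (dwork_coef z k + if (p <= k.+1)%N then dwork_coef z (k.+1 - p) else 0).
Proof.
pose A v := (k.+1 - p * v)%:R * dwork_term z k.+1 v.
pose B v := (p * v)%:R * dwork_term z k.+1 v.
have -> : k.+1%:R * dwork_coef z k.+1 = \sum_(v < k.+2) A v + \sum_(v < k.+2) B v.
  rewrite -big_split big_distrr /=; apply: eq_bigr => v _.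
  rewrite /A /B -mulrDl -natrD; have [h|h] := leqP (p * v) k.+1; first by rewrite subnK.
  by rewrite /dwork_term leqNgt h !mulr0.
rewrite mulrDr; congr (_ + _).
  rewrite (@dwork_coef_widen _ k k.+2) 1?ltnW // big_distrr /=.
  apply: eq_bigr => v _; rewrite /A /dwork_term.
  have [h|h] := leqP (p * v) k; last first.
    by rewrite mulr0 (_ : k.+1 - p * v = 0)%N ?mul0r //; lia.
  rewrite leqW // subSn // addSn exprS natr_factS.
  have v0 : ((k - p * v).+1%:R : K) != 0 by rewrite K_char0.
  by move: (_.+1%:R : K) v0 => c c0; field; rewrite !f0 c0 expf_neq0.
rewrite big_ord_recl /B muln0 mul0r add0r.
case: ifP => [pk|/negbT pk]; last first.
  rewrite mulr0 big1 // => v _; rewrite /dwork_term ifN ?mulr0 // -ltnNge.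
  by rewrite -ltnNge in pk; rewrite (leq_trans pk) // leq_pmulr.
rewrite (@dwork_coef_widen _ _ k.+1); last by rewrite ltnS; lia.
rewrite big_distrr /=; apply: eq_bigr => v _; rewrite /dwork_term /bump /= add1n.
have -> : (p * v.+1 <= k.+1)%N = (p * v <= k.+1 - p)%N by rewrite mulnS; lia.
case: ifP => _; last by rewrite !mulr0.
have -> : (k.+1 - p * v.+1 = k.+1 - p - p * v)%N by rewrite mulnS subnDA.
set e := (_ - _ - _)%N; rewrite addnS exprS natr_factS [p%:R ^+ v.+1]exprS natrM.
have v0 : (v.+1%:R : K) != 0 by rewrite K_char0.
by move: (v.+1%:R : K) v0 => c c0; field; rewrite !f0 c0 p_neq0 expf_neq0.
Qed.

Lemma dwork_rec_uniq (a b : nat -> K) (z : K) : a 0%N = b 0%N ->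
    (forall k, k.+1%:R * a k.+1 =
       z * (a k + if (p <= k.+1)%N then a (k.+1 - p)%N else 0)) ->
    (forall k, k.+1%:R * b k.+1 =
       z * (b k + if (p <= k.+1)%N then b (k.+1 - p)%N else 0)) ->
  forall k, a k = b k.
Proof.
move=> ab0 ha hb k; have [n] := ubnP k; elim: n k => // n IH [//|k] kn.
have k0 : (k.+1%:R : K) != 0 by rewrite K_char0.
apply: (mulfI k0); rewrite ha hb IH //; case: ifP => // _.
by rewrite IH //; have := p_gt0; lia.
Qed.

(** Since t^p = t, the power t^(k - p v + v) in each term equals t^k. *)
Lemma dwork_coef_teich (t : K) k : t ^+ p = t ->
  dwork_coef t k = dwork_coef 1 k * t ^+ k.
Proof.
move=> tp; rewrite /dwork_coef big_distrl /=; apply: eq_bigr => v _.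
rewrite /dwork_term; case: ifP => [pv|_]; last by rewrite mul0r.
rewrite expr1n mul1r mulrC; congr (_ * _).
by rewrite exprD -{2}tp -exprM -exprD subnK.
Qed.

(* Coefficient of [M]_m in the Newton expansion of f, where
   [M]_m = M (M - 1) ... (M - m + 1). *)
Definition newton m (f : nat -> K) : K :=
  \sum_(w < m.+1) (-1) ^+ (m - w) * f w / (w`!%:R * (m - w)`!%:R).

Lemma eq_newton m f g : (forall w, (w <= m)%N -> f w = g w) ->
  newton m f = newton m g.
Proof. by move=> fg; apply: eq_bigr => w _; rewrite fg // -ltnS. Qed.

Lemma newtonD m f g : newton m (fun w => f w + g w) = newton m f + newton m g.
Proof.
by rewrite -big_split; apply: eq_bigr => w _; rewrite mulrDr mulrDl.
Qed.

Lemma newtonZ m c f : newton m (fun w => c * f w) = c * newton m f.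
Proof.
by rewrite big_distrr; apply: eq_bigr => w _; rewrite mulrCA -!mulrA.
Qed.

Lemma newton_sum m (I : Type) (r : seq I) (P : pred I) (F : I -> nat -> K) :
  newton m (fun w => \sum_(i <- r | P i) F i w) = \sum_(i <- r | P i) newton m (F i).
Proof.
rewrite exchange_big; apply: eq_bigr => w _.
by rewrite big_distrr /= big_distrl.
Qed.

Lemma newtonB m f g : newton m (fun w => f w - g w) = newton m f - newton m g.
Proof.
rewrite newtonD -[- newton m g]mulN1r -newtonZ; congr (_ + _).
by apply: eq_newton => w _; rewrite mulN1r.
Qed.

(** Dual to M [M]_m = [M]_{m+1} + m [M]_m. *)
Lemma newton_mulX m f :
  newton m.+1 (fun w => w%:R * f w) = newton m f + m.+1%:R * newton m.+1 f.
Proof.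
have -> : newton m f = - \sum_(w < m.+2) ((m.+1 - w)%:R * ((-1) ^+ (m.+1 - w) * f w /
    (w`!%:R * (m.+1 - w)`!%:R))).
  rewrite big_ord_recr /= subnn mul0r addr0 -sumrN; apply: eq_bigr => w _.
  have wm : (w <= m)%N by rewrite -ltnS.
  rewrite subSn // exprS natr_factS.
  have v0 : ((m - w).+1%:R : K) != 0 by rewrite K_char0.
  by move: (_.+1%:R : K) v0 => c c0; field; rewrite !f0 c0.
rewrite addrC big_distrr -sumrB /=; apply: eq_bigr => w _.
by rewrite -mulrBl -natrB ?leq_subr // subKn -1?ltnS // -!mulrA mulrCA !mulrA.
Qed.

Lemma newton0_mulX f : newton 0 (fun w => w%:R * f w) = 0.
Proof. by rewrite /newton big_ord1 mul0r mulr0 mul0r. Qed.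

Lemma inv_fact_bin m i : (i <= m)%N ->
  (i`!%:R * (m - i)`!%:R)^-1 = 'C(m, i)%:R / m`!%:R :> K.
Proof.
move=> im; rewrite -(bin_fact im) !natrM.
have b0 : ('C(m, i)%:R : K) != 0 by rewrite K_char0 -lt0n bin_gt0.
by field; rewrite !f0 b0.
Qed.

Lemma newton1 m : newton m (fun=> 1) = (m == 0%N)%:R.
Proof.
have -> : newton m (fun=> 1) = (1 + -1) ^+ m / m`!%:R.
  rewrite exprDn big_distrl /= [RHS](reindex_inj rev_ord_inj) /=.
  apply: eq_bigr => w _; have wm : (w <= m)%N by rewrite -ltnS.
  rewrite subSS mulr1 inv_fact_bin // subKn // expr1n mul1r bin_sub //.
  by rewrite mulrA mulr_natr.
by rewrite subrr expr0n; case: m => [|m]; rewrite ?mul0r // fact0 divr1.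
Qed.

Lemma newton_shift m f :
  newton m (fun w => f w.+1) = newton m f + m.+1%:R * newton m.+1 f.
Proof.
rewrite -newton_mulX /newton [in RHS]big_ord_recl mul0r mulr0 mul0r add0r.
apply: eq_bigr => w _; rewrite lift0 subSS natr_factS.
have v0 : (w.+1%:R : K) != 0 by rewrite K_char0.
by move: (_.+1%:R : K) v0 => c c0; field; rewrite !f0 c0.
Qed.

Lemma newton_expansion f M n : (M < n)%N ->
  f M = \sum_(i < n) newton i f * (M ^_ i)%:R.
Proof.
elim: M n f => [|M IH] [//|n] f Mn.
  rewrite big_ord_recl big1 => [|i _]; last by rewrite lift0 ffact0n mulr0.
  by rewrite addr0 ffactn0 mulr1 /newton big_ord1 !mul1r fact0 divr1.
rewrite -[f M.+1]/((fun w => f w.+1) M) (IH n.+1) //; last exact: ltnW.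
rewrite (eq_bigr (fun i : 'I_n.+1 => newton i f * (M ^_ i)%:R +
    newton i.+1 f * (i.+1 * M ^_ i)%:R)); last first.
  by move=> i _; rewrite newton_shift natrM; ring.
rewrite big_split /= [X in _ + X]big_ord_recr /= ffact_small // muln0 mulr0 addr0.
rewrite big_ord_recl [RHS]big_ord_recl -addrA; congr (_ + _).
rewrite -big_split /=; apply: eq_bigr => i _; rewrite /bump /= add1n -mulrDr -natrD.
congr (_ * _%:R); rewrite ffactSS ffactnSr.
have [iM|Mi] := leqP i M; first by move: (M ^_ i)%N => c; nia.
by rewrite ffact_small // muln0 mul0n muln0.
Qed.

Lemma natr_ffactS n m :
  ((n ^_ m.+1)%:R : K) = (n ^_ m)%:R * (n%:R - m%:R).
Proof.
rewrite ffactnSr natrM; have [mn|nm] := leqP m n; first by rewrite natrB.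
by rewrite ffact_small // !mul0r.
Qed.

(** With C f(M) = g(M) f(p M + j), the operator f |-> (p M + j - M) g(M) f(p M + j) is the
    commutator of C with multiplication by M, so its trace ought to vanish. Truncating the trace at
    n leaves the boundary term on the right. *)
Lemma newton_telescope j n g :
  \sum_(m < n.+1) newton m (fun w =>
      ((p * w + j) ^_ m)%:R * (((p * w + j)%:R - w%:R) * g w)) =
  newton n (fun w => ((p * w + j) ^_ n.+1)%:R * g w).
Proof.
have step m : newton m.+1 (fun w =>
      ((p * w + j) ^_ m.+1)%:R * (((p * w + j)%:R - w%:R) * g w)) =
    newton m.+1 (fun w => ((p * w + j) ^_ m.+2)%:R * g w)
    - newton m (fun w => ((p * w + j) ^_ m.+1)%:R * g w).
  pose h w := ((p * w + j) ^_ m.+1)%:R * g w.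
  have -> : newton m h = newton m.+1 (fun w => w%:R * h w)
      - newton m.+1 (fun w => m.+1%:R * h w) by rewrite newton_mulX newtonZ addrK.
  rewrite opprB addrA -newtonD -newtonB; apply: eq_newton => w _.
  by rewrite /h [in RHS]natr_ffactS; ring.
elim: n => [|n IH]; last by rewrite big_ord_recr /= IH step addrC subrK.
rewrite big_ord1 -[RHS]subr0 -(newton0_mulX g) -newtonB.
by apply: eq_newton => w _; rewrite ffactn0 ffactn1; ring.
Qed.

Lemma newton_mulphi j l m f :
  newton m.+1 (fun w => ((p * w + j)%:R - l%:R) * f w) =
  p%:R * newton m f + ((p * m.+1 + j)%:R - l%:R) * newton m.+1 f.
Proof.
transitivity (newton m.+1 (fun w => p%:R * (w%:R * f w) + (j%:R - l%:R) * f w)).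
  by apply: eq_newton => w _; rewrite natrD natrM; ring.
by rewrite newtonD !newtonZ newton_mulX natrD natrM; ring.
Qed.

(** As a polynomial in M, [p M + j]_l has degree l and leading coefficient p^l. *)
Lemma newton_ffact j l m : (l <= m)%N ->
  newton m (fun w => ((p * w + j) ^_ l)%:R) = if m == l then p%:R ^+ l else 0.
Proof.
elim: l m => [|l IH] [//|m] lm.
- rewrite /= expr0; apply: etrans (newton1 0).
  by apply: eq_newton => w _; rewrite ffactn0.
- by apply: etrans (newton1 m.+1); apply: eq_newton => w _; rewrite ffactn0.
rewrite (eq_newton (g := fun w => ((p * w + j)%:R - l%:R) * ((p * w + j) ^_ l)%:R)).
  have lm1 : (l <= m.+1)%N by rewrite ltnW.
  rewrite newton_mulphi !IH // [m.+1 == l]gtn_eqF // mulr0 addr0 eqSS.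
  by case: eqP => _; rewrite ?mulr0 // exprS.
by move=> w _; rewrite natr_ffactS mulrC.
Qed.

(** Term by term: [p w + j]_l / (p w + j)! is 1 / (p w + j - l)!, the w! cancels that of [newton],
    and v = m - w is the index in [dwork_coef]. With l = m these are the diagonal entries of the
    composition operator, with l = 0 the Newton coefficients of its weight. *)
Lemma newton_dwork j l m : (j < p)%N -> (l <= p * m + j)%N ->
  newton m (fun w => ((p * w + j) ^_ l)%:R *
     ((- p%:R) ^+ w * w`!%:R / (p * w + j)`!%:R)) =
  (- p%:R) ^+ m * dwork_coef 1 (p * m + j - l).
Proof.
move=> jp lm; rewrite (@dwork_coef_sum _ _ m.+1); last by rewrite mulnS; lia.
rewrite big_distrr /= [RHS](reindex_inj rev_ord_inj) /=.
apply: eq_bigr => w _; have wm : (w <= m)%N by rewrite -ltnS.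
rewrite subSS /dwork_term expr1n.
have -> : (p * (m - w) <= p * m + j - l)%N = (l <= p * w + j)%N by nia.
have [lw|lw] := leqP l (p * w + j); last first.
  by rewrite ffact_small // mul0r !mulr0 mul0r.
have -> : (p * m + j - l - p * (m - w) = p * w + j - l)%N by nia.
rewrite -(ffact_fact lw) natrM.
have -> : (- p%:R) ^+ m = (-1) ^+ (m - w) * p%:R ^+ (m - w) * (- p%:R) ^+ w :> K.
  by rewrite -exprMn mulN1r -exprD subnK.
have v0 : (((p * w + j) ^_ l)%:R : K) != 0 by rewrite K_char0 -lt0n ffact_gt0.
by move: (((p * w + j) ^_ l)%:R : K) v0 => c c0; field; rewrite !f0 c0 expf_neq0.
Qed.

(* i-th finite difference at 0 of M |-> (-p)^M M! / (p M + r)!, see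
   newton_dwork. *)
Definition dwork_diff r i : K :=
  i`!%:R * ((- p%:R) ^+ i * dwork_coef 1 (p * i + r)).

(** With [dwork_diff_rec0], this is the recursion of [dwork_coef] followed along k = p i + r: r runs
    up to p - 1, then i increases. At i = 0 the factor i removes the term at [i.-1]. *)
Lemma dwork_diff_recS r i : (r.+1 < p)%N ->
  (p * i + r.+1)%:R * dwork_diff r.+1 i =
  dwork_diff r i - p%:R * (i%:R * dwork_diff r.+1 i.-1).
Proof.
move=> rp; rewrite /dwork_diff mulrCA [_ * (_ * dwork_coef _ _)]mulrCA addnS.
rewrite dwork_coef_rec mul1r; case: i => [|i].
  by rewrite muln0 add0n leqNgt rp addr0 mul0r mulr0 subr0.
rewrite ifT; last by rewrite mulnS; lia.
have -> : ((p * i.+1 + r).+1 - p = p * i + r.+1)%N by rewrite mulnS; lia.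
by rewrite natr_factS exprS /= addnS; ring.
Qed.

Lemma dwork_diff_rec0 i :
  dwork_diff 0 i.+1 = - (dwork_diff p.-1 i + dwork_diff 0 i).
Proof.
have e := dwork_coef_rec 1 (p * i + p.-1).
have pe : ((p * i + p.-1).+1 = p * i.+1 + 0)%N by rewrite mulnS; lia.
rewrite pe addn0 mul1r ifT in e; last by rewrite mulnS; lia.
have {}e : (p%:R * i.+1%:R) * dwork_coef 1 (p * i.+1) =
    dwork_coef 1 (p * i + p.-1) + dwork_coef 1 (p * i).
  by rewrite -natrM e; congr (_ + dwork_coef _ _); rewrite mulnS; lia.
by rewrite /dwork_diff !addn0 -!mulrDr -e natr_factS exprS; ring.
Qed.

Definition ffact_at (s : K) i : K := \prod_(0 <= l < i) (s - l%:R).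

(* The quotient ([M]_i - [s]_i) / (M - s). *)
Fixpoint ffact_quot (s : K) i (w : nat) : K :=
  if i is i'.+1 then (w%:R - i'%:R) * ffact_quot s i' w + ffact_at s i' else 0.

Lemma ffact_quotP s i w :
  (w ^_ i)%:R = ffact_at s i + (w%:R - s) * ffact_quot s i w.
Proof.
elim: i => [|i IH]; first by rewrite /ffact_at big_geq // mulr0 addr0.
by rewrite natr_ffactS IH /ffact_at big_nat_recr //= -/(ffact_at s i); ring.
Qed.

(* The trace of the weighted composition operator f(M) |-> h(M) f(pM + j) is
   h(s) / (1 - p), where s is the fixed point of M |-> pM + j. *)
Lemma trace_ffact j s i n : s * (p%:R - 1) = - j%:R ->
  (1 - p%:R) * \sum_(m < n.+1) newton m (fun w =>
     ((p * w + j) ^_ m)%:R * (w ^_ i)%:R) =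
  ffact_at s i * (1 - p%:R ^+ n.+1) -
  newton n (fun w => ((p * w + j) ^_ n.+1)%:R * ffact_quot s i w).
Proof.
move=> sj; rewrite -newton_telescope.
(* The powers p^m are the diagonal entries of f(M) |-> f(p M + j), the case of weight 1. *)
have -> : 1 - p%:R ^+ n.+1 =
    (1 - p%:R) * \sum_(m < n.+1) newton m (fun w => ((p * w + j) ^_ m)%:R) :> K.
  rewrite -opprB subrX1 -mulNr opprB; congr (_ * _).
  by apply: eq_bigr => m _; rewrite newton_ffact // eqxx.
rewrite !big_distrr /= -sumrB; apply: eq_bigr => m _.
rewrite -!newtonZ -newtonB; apply: eq_newton => w _.
have e : (p * w + j)%:R - w%:R = (p%:R - 1) * (w%:R - s) :> K.
  by rewrite mulrBr [(p%:R - 1) * s]mulrC sj natrD natrM; ring.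
by rewrite e (ffact_quotP s i w); ring.
Qed.

(** Sums [trace_ffact] against the Newton coefficients of the weight [H]. Only the values of [H] at
    w <= n enter, and there the expansion cut after i = n is exact. *)
Lemma trace_dwork j s n : (j < p)%N -> s * (p%:R - 1) = - j%:R ->
  (1 - p%:R) * \sum_(m < n.+1) (- p%:R) ^+ m * dwork_coef 1 (p * m + j - m) =
  \sum_(i < n.+1) (- p%:R) ^+ i * dwork_coef 1 (p * i + j) *
    (ffact_at s i * (1 - p%:R ^+ n.+1) -
     newton n (fun w => ((p * w + j) ^_ n.+1)%:R * ffact_quot s i w)).
Proof.
move=> jp sj; pose H w : K := (- p%:R) ^+ w * w`!%:R / (p * w + j)`!%:R.
have HN i : newton i H = (- p%:R) ^+ i * dwork_coef 1 (p * i + j).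
  rewrite -[(p * i + j)%N]subn0 -newton_dwork //.
  by apply: eq_newton => w _; rewrite ffactn0 mul1r.
transitivity ((1 - p%:R) * \sum_(m < n.+1) \sum_(i < n.+1) newton i H *
    newton m (fun w => ((p * w + j) ^_ m)%:R * (w ^_ i)%:R)).
  congr (_ * _); apply: eq_bigr => m _.
  rewrite -newton_dwork //; last by nia.
  rewrite (eq_bigr (fun i : 'I_n.+1 => newton m (fun w =>
      newton i H * (((p * w + j) ^_ m)%:R * (w ^_ i)%:R)))); last first.
    by move=> i _; rewrite newtonZ.
  rewrite -newton_sum; apply: eq_newton => w wm.
  rewrite -/(H w) (newton_expansion H (n := n.+1)); last first.
    by rewrite ltnS (leq_trans wm) // -ltnS.
  by rewrite big_distrr; apply: eq_bigr => i _; rewrite mulrCA.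
rewrite exchange_big big_distrr; apply: eq_bigr => i _ /=.
by rewrite -trace_ffact // -HN -big_distrr /= mulrCA.
Qed.

End DworkExponential.

(** * Divisibility of the Dwork coefficients by powers of p *)

Section DworkEstimates.
Variables (p : nat) (p_pr : prime p) (p_gt4 : (4 < p)%N).
Local Notation Zp := (padic_int p_pr).
Local Notation K := {fraction Zp}.
Local Notation "x %:F" := (@FracField.tofrac Zp x) : ring_scope.
Local Notation pint := (@pint p p_pr).
Local Notation char0 := (frac_natr_eq0 p_pr).
Local Notation p0 := (prime_gt0 p_pr).
Local Notation dc := (@dwork_coef K p).
Local Notation dd := (@dwork_diff K p).

Lemma pint_prod_block i :
  pint 1 ((\prod_(1 <= l < p) (p * i + l)%N)%:R + 1).
Proof.
have -> : (\prod_(1 <= l < p) (p * i + l)%N)%:R + 1 =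
    (\prod_(1 <= l < p) (p * i + l)%N)%:R%:F - (-1)%:F :> K.
  by rewrite rmorphN rmorph1 opprK rmorph_nat.
apply/pint_cong; rewrite natr_prod.
have -> : (-1 : Zp) 1%N = ((p.-1)`!%:R : Zp) 1%N.
  apply/esym/padic_cong_sub0; rewrite opprK natr1 padic_natrE expn1.
  by apply/eqP; rewrite -/(dvdn _ _) -Wilson // prime_gt1.
rewrite fact_prod natr_prod prednK //; last exact: p0.
by apply: padic_cong_prod => l _; rewrite !padic_natrE expn1 mulnC modnMDl.
Qed.

(** Up to p times terms of index i - 1, [dd 0 i] is [dd p.-1 i] times the product of the p i + l for
    0 < l < p, which is -1 modulo p by Wilson's theorem. The sum that yields the next difference in
    [dwork_diff_rec0] therefore nearly cancels, and one power of p is gained for every two steps in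
    i. *)
Lemma dwork_diff_step i :
    (forall r, (r < p)%N -> pint (uphalf i.-1) (i%:R * dd r i.-1)) ->
    pint (uphalf i) (dd 0 i) ->
  (forall r, (r < p)%N -> pint (uphalf i) (dd r i)) /\
  pint (uphalf i.+1) (dd p.-1 i + dd 0 i).
Proof.
move=> h1 h0; have p1 : (1 < p)%N by lia.
have nd r : (0 < r < p)%N -> ~~ (p %| p * i + r)%N.
  by case/andP => r0 rp; rewrite dvdn_addr ?dvdn_mulr // gtnNdvd.
have h1' r : (r < p)%N -> pint (uphalf i.+1) (p%:R * (i%:R * dd r i.-1)).
  case: i h1 {h0 nd} => [|i] h1 rp; first by rewrite mul0r mulr0; apply: pint0.
  by have := pint_pM (h1 _ rp).
have bnd r : (r < p)%N -> pint (uphalf i) (dd r i).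
  elim: r => [//|r IH] rp; apply: (@pint_div_nat _ _ _ _ (p * i + r.+1)); first exact: nd.
  rewrite dwork_diff_recS ?p0 //; last exact: char0.
  apply: pintB; first by apply: IH; exact: ltnW.
  by apply: pint_le (h1' _ rp); rewrite leq_uphalf_double; lia.
split=> //.
have key r : (r < p)%N -> pint (uphalf i.+1)
    ((\prod_(1 <= l < r.+1) (p * i + l)%N)%:R * dd r i - dd 0 i).
  elim: r => [|r IH] rp; first by rewrite big_geq // mul1r subrr; apply: pint0.
  rewrite big_nat_recr //= natrM -mulrA dwork_diff_recS ?p0 //; last exact: char0.
  rewrite mulrBr addrAC; apply: pintB; first by apply: IH; exact: ltnW.
  by apply: pintMl; [apply: pint_natr | apply: h1'].
have pp : (p.-1 < p)%N by lia.
have := key _ pp; rewrite prednK ?p0 // => k1.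
have k2 := pintM (pint_prod_block i) (bnd _ pp).
have -> : dd p.-1 i + dd 0 i =
   ((\prod_(1 <= l < p) (p * i + l)%N)%:R + 1) * dd p.-1 i -
   ((\prod_(1 <= l < p) (p * i + l)%N)%:R * dd p.-1 i - dd 0 i).
  by rewrite mulrDl mul1r opprB [RHS]addrC addrA subrK addrC.
apply: pintB => //; apply: pint_le k2; lia.
Qed.

Lemma pint_dwork_diff i :
  (forall r, (r < p)%N -> pint (uphalf i) (dd r i)) /\
  pint (uphalf i.+1) (dd p.-1 i + dd 0 i).
Proof.
elim: i => [|i [IH1 IH2]]; apply: dwork_diff_step.
- by move=> r _; rewrite mul0r; apply: pint0.
- rewrite /dwork_diff muln0 addn0 dwork_coef0.
  by rewrite fact0 expr0 !mulr1; apply: (pint_natr _ 1).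
- by move=> r rp /=; apply: pintMl; [apply: pint_natr | apply: IH1].
- by rewrite dwork_diff_rec0 ?p0 //; [apply: pintN | exact: char0].
Qed.

(** Of the i / 2 powers of p in the finite difference, division by i! takes away at most i / 4. *)
Lemma pint_dwork_coef i r : (r < p)%N ->
  pint (i %/ 4) ((- p%:R) ^+ i * dc 1 (p * i + r)).
Proof.
move=> rp; have [/(_ r rp) h _] := pint_dwork_diff i.
by apply: pint_le (pint_inv_fact p_gt4 _ h); lia.
Qed.

End DworkEstimates.

(** * The Gross-Koblitz formula *)

Section GrossKoblitz.
Variables (p : nat) (p_pr : prime p) (p_gt4 : (4 < p)%N).
Local Notation Zp := (padic_int p_pr).
Local Notation K := {fraction Zp}.
Local Notation "x %:F" := (@FracField.tofrac Zp x) : ring_scope.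
Local Notation pint := (@pint p p_pr).
Local Notation char0 := (frac_natr_eq0 p_pr).
Local Notation p0 := (prime_gt0 p_pr).
Local Notation dc := (@dwork_coef K p).
Local Notation newton := (@newton K).
Local Notation Gamma := (@padic_gamma p p_pr).

(** The decay that controls the boundary term of [trace_ffact]. The subtraction is truncated: for m
    <= e only integrality is required. *)
Definition newton_small e (f : nat -> K) := forall m, pint (m - e) (newton m f).

Lemma newton0 f : newton 0 f = f 0%N.
Proof. by rewrite /newton big_ord1 /= subnn fact0 expr0 mul1r mulr1 divr1. Qed.

(** The coefficient of lower index in [newton_mulphi] lacks one power of p, but it carries a factor
    p because M is scaled by p in p M + j. *)
Lemma newton_small_mulphi e j l f : newton_small e f ->
  newton_small e (fun w => ((p * w + j)%:R - l%:R) * f w).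
Proof.
have hc m : pint 0 (m%:R - l%:R) by apply: pintB; apply: pint_natr.
move=> h [|m].
  by rewrite newton0 -(newton0 f); apply: pintMl.
rewrite newton_mulphi; last exact: char0.
apply: pintD.
  by apply: pint_le (pint_pM (h m)); lia.
exact: pintMl.
Qed.

Lemma newton_small_ffact e j l f : newton_small e f ->
  newton_small e (fun w => ((p * w + j) ^_ l)%:R * f w).
Proof.
move=> h; elim: l => [|l IH] m.
  by rewrite (eq_newton (g := f)) // => w _; rewrite ffactn0 mul1r.
rewrite (eq_newton (g := fun w => ((p * w + j)%:R - l%:R) *
   (((p * w + j) ^_ l)%:R * f w))); first exact: newton_small_mulphi.
by move=> w _; rewrite natr_ffactS -mulrA mulrCA.
Qed.

Definition zffact (s : Zp) i : Zp := \prod_(0 <= l < i) (s - l%:R).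

Lemma ffact_at_tofrac (s : Zp) i : ffact_at s%:F i = (zffact s i)%:F.
Proof.
by rewrite rmorph_prod; apply: eq_bigr => l _; rewrite rmorphB /= rmorph_nat.
Qed.

Lemma zffact_natr n i : zffact n%:R i = (n ^_ i)%:R.
Proof.
elim: i => [|i IH]; first by rewrite /zffact big_geq.
rewrite /zffact big_nat_recr //= -/(zffact _ _) IH ffactnSr natrM.
have [mn|nm] := leqP i n; first by rewrite natrB.
by rewrite ffact_small // !mul0r.
Qed.

Lemma newton_small_quot (s : Zp) i : newton_small i (ffact_quot s%:F i).
Proof.
elim: i => [|i IH] m.
  by rewrite /newton big1 => [|w _]; [apply: pint0 | rewrite mulr0 mul0r].
rewrite /= newtonD; apply: pintD; last first.
  rewrite (eq_newton (g := fun w => (ffact_at s%:F i) * 1));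
    last by move=> w _; rewrite mulr1.
  rewrite (newtonZ m _ (fun=> 1)) newton1; last exact: char0.
  case: m => [|m]; last by rewrite mulr0; apply: pint0.
  by rewrite mulr1 ffact_at_tofrac; apply: pint_tofrac.
rewrite (eq_newton (g := fun w => w%:R * ffact_quot s%:F i w - i%:R * ffact_quot s%:F i w));
  last by move=> w _; rewrite mulrBl.
rewrite newtonB newtonZ; apply: pintB; last first.
  by apply: pintMl; [apply: pint_natr | apply: pint_le (IH m); lia].
case: m => [|m]; first by rewrite newton0_mulX; apply: pint0.
rewrite newton_mulX; last exact: char0.
apply: pintD; first by rewrite subSS.
by apply: pintMl; [apply: pint_natr | apply: pint_le (IH m.+1); lia].
Qed.

Lemma p_odd : odd p.
Proof. by case: (even_prime p_pr) => // p2; move: p_gt4; rewrite p2. Qed.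

(** Among the factors of n!, those prime to p make up [gamma_nat] and the multiples of p make up
    p^(n/p) (n/p)!. *)
Lemma gamma_nat_fact n :
  gamma_nat p_pr n.+1 * p%:R ^+ (n %/ p) * (n %/ p)`!%:R = (-1) ^+ n.+1 * n`!%:R.
Proof.
elim: n => [|n IH].
  rewrite div0n expr0 fact0 gamma_natS /gamma_nat big_geq //.
  by rewrite /gamma_step padic_unit_natr dvdn0 /= mul1r !mulr1.
rewrite gamma_natS divnS ?p0 // factS natrM exprS.
rewrite (_ : _ * _ * (_ * n`!%:R) = - n.+1%:R * ((-1) ^+ n.+1 * n`!%:R)); last by ring.
rewrite -{}IH.
have -> : gamma_step (n.+1%:R : Zp) = if (p %| n.+1)%N then -1 else - n.+1%:R.
  by rewrite /gamma_step padic_unit_natr; case: (p %| n.+1)%N.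
move: (gamma_nat p_pr n.+1) => G.
have [pn|_] := ifPn (p %| n.+1)%N; last first.
  by rewrite add0n; move: (n.+1%:R : Zp) => c; ring.
have -> : n.+1%:R = (n %/ p).+1%:R * p%:R :> Zp.
  by rewrite -natrM -[in LHS](divnK pn) divnS ?p0 // pn.
by rewrite add1n exprS factS natrM; move: ((n %/ p).+1%:R : Zp) => c; ring.
Qed.

(** This is [gamma_nat_fact] at p M + j, whose quotient by p is M since j < p. The powers of p
    cancel and, p being odd, the sign does not depend on M, so the weight extends continuously to
    Z_p. *)
Lemma dwork_value j M : (j < p)%N ->
  (- p%:R) ^+ M * M`!%:R / (p * M + j)`!%:R =
  ((-1) ^+ j.+1 / gamma_nat p_pr (p * M + j).+1)%:F.
Proof.
move=> jp; have e := gamma_nat_fact (p * M + j).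
rewrite mulnC divnMDl ?p0 // (divn_small jp) addn0 [(M * p)%N]mulnC in e.
have ug := gamma_nat_unit p_pr (p * M + j).+1.
apply/(canLR (mulfK (frac_fact_neq0 _ _))).
have -> : (- p%:R) ^+ M * M`!%:R = ((- p%:R) ^+ M * M`!%:R : Zp)%:F :> K.
  by rewrite rmorphM rmorphXn rmorphN /= !rmorph_nat.
rewrite -(rmorph_nat (@FracField.tofrac Zp) _`!) -rmorphM /=; congr _%:F.
apply: (mulrI ug); rewrite [_ / gamma_nat _ _]mulrC [RHS]mulrA.
rewrite [X in _ = X * _]mulrA divrr // mul1r.
have sM : (-1) ^+ j.+1 = (-1) ^+ M * (-1) ^+ (p * M + j).+1 :> Zp.
  rewrite -exprD -signr_odd -[in RHS]signr_odd; congr (_ ^+ nat_of_bool _).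
  by rewrite addnS oddS [in RHS]oddS !oddD oddM p_odd /= addbA addbb.
by rewrite sM -mulrA -e exprNn; ring.
Qed.

Theorem gross_koblitz_limit j (s : Zp) n : (j < p)%N -> s * p.-1%:R = - j%:R ->
  pint (n %/ 4) ((1 - p%:R) *
     \sum_(m < n.+1) (- p%:R) ^+ m * dc 1 (p * m + j - m) -
   ((-1) ^+ j.+1 / Gamma (1 + s))%:F).
Proof.
move=> jp sj.
have sjF : s%:F * (p%:R - 1) = - j%:R.
  have -> : p%:R - 1 = p.-1%:R :> K by rewrite -(natrB _ p0) subn1.
  by rewrite -(rmorph_nat (@FracField.tofrac Zp)) -rmorphM sj rmorphN rmorph_nat.
rewrite (trace_dwork char0 p0 n jp sjF).
pose x i := (- p%:R) ^+ i * dc 1 (p * i + j).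
have xi i : pint (i %/ 4) (x i) by apply: pint_dwork_coef.
(* The weight is given at natural numbers only, so s is replaced by the natural number M congruent
   to it modulo p^(n+1). There [dwork_value] involves Gamma_p (p M + j + 1), and p s + j + 1 = 1 +
   s. *)
set M := s n.+1; pose H w : K := (- p%:R) ^+ w * w`!%:R / (p * w + j)`!%:R.
have HN i : newton i H = x i.
  rewrite /x -[(p * i + j)%N]subn0 -newton_dwork //; [|exact: char0|exact: p0].
  by apply: eq_newton => w _; rewrite ffactn0 mul1r.
have Mlt : (M < n.+1 + M.+1)%N by lia.
have HM : H M = \sum_(i < n.+1 + M.+1) x i * (M ^_ i)%:R.
  rewrite (newton_expansion char0 p0 H Mlt).
  by apply: eq_bigr => i _; rewrite HN.
have gM : pint n.+1 (H M - ((-1) ^+ j.+1 / Gamma (1 + s))%:F).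
  rewrite /H dwork_value //; apply/pint_cong; apply: padic_congM => //.
  have ug := gamma_nat_unit p_pr; have uG := padic_gamma_unit p_odd (1 + s).
  apply: padic_congV => //; apply/esym/(padic_gammaE p_odd).
  have -> : 1 + s = p%:R * s + j%:R + 1.
    rewrite -[j%:R]opprK -sj addrC; congr (_ + _).
    have -> : (p%:R : Zp) = p.-1%:R + 1 by rewrite natr1 prednK ?p0.
    by ring.
  rewrite -[(p * M + j).+1]addn1 !natrD natrM; apply: padic_congD => //.
  apply: padic_congD => //; apply: padic_congM => //; exact: padic_approx.
set A := \sum_(i < n.+1) _; set B := _%:F in gM *.
have -> : A - B = (A - H M) + (H M - B) by rewrite addrA subrK.
rewrite {}/A.
apply: pintD; last by apply: pint_le gM; lia.
(* The errors are the Newton terms beyond n and, for i <= n, the difference between [s]_i and [M]_i,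
   the term with p^(n+1), and the boundary term, of order at least i/4 + (n - i). *)
rewrite HM big_split_ord /= opprD addrA -sumrB; apply: pintB; last first.
  apply: pint_sum => i _; rewrite mulrC; apply: pintMl; first exact: pint_natr.
  by apply: pint_le (xi _); apply: leq_div2r; rewrite leqW // leq_addr.
apply: pint_sum => i _; rewrite -mulrBr ffact_at_tofrac.
have i_n : (i <= n)%N by rewrite -ltnS.
have aux (R : comNzRingType) (a b c e : R) :
  a * (1 - b) - e - c = (a - c) - (a * b + e) by ring.
rewrite aux mulrBr; apply: pintB.
  apply: (@pint_le _ _ _ (i %/ 4 + n.+1)); first by lia.
  apply: pintM; first exact: xi.
  rewrite -(rmorph_nat (@FracField.tofrac Zp)) -zffact_natr; apply/pint_cong.
  apply: padic_cong_prod => l _; apply: padic_congB => //; exact: padic_approx.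
rewrite mulrDr; apply: pintD.
  apply: (@pint_le _ _ _ (0 + (0 + n.+1))); first by lia.
  apply: pintM; first by apply: pint_le (xi i).
  apply: pintM; [exact: pint_tofrac | exact: pint_pX].
apply: (@pint_le _ _ _ (i %/ 4 + (n - i))); first by lia.
apply: pintM; first exact: xi.
apply: newton_small_ffact; exact: newton_small_quot.
Qed.

End GrossKoblitz.

(** * Additive characters and Gauss sums *)

Section Convolution.
Variable R : comNzRingType.
Implicit Types a b : nat -> R.

Definition conv a b k : R := \sum_(i < k.+1) a (k - i)%N * b i.

Lemma convC a b k : conv a b k = conv b a k.
Proof.
rewrite /conv (reindex_inj rev_ord_inj); apply: eq_bigr => i _ /=.
by rewrite subSS subKn -1?ltnS // mulrC.
Qed.

End Convolution.

Section DworkAdditivity.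
Variables (K : fieldType) (p : nat).
Hypothesis K_char0 : forall n, ((n%:R : K) == 0) = (n == 0%N).
Hypothesis p_gt0 : (0 < p)%N.
Local Notation dc := (@dwork_coef K p).

Let half z (b : nat -> K) k :
  \sum_(i < k.+2) (k.+1 - i)%:R * dc z (k.+1 - i)%N * b i =
  z * (conv (dc z) b k +
       if (p <= k.+1)%N then conv (dc z) b (k.+1 - p) else 0).
Proof.
rewrite big_ord_recr /= subnn !mul0r addr0.
rewrite (eq_bigr (fun i : 'I_k.+1 => z * (dc z (k - i)%N * b i +
    (if (p <= (k - i).+1)%N then dc z ((k - i).+1 - p)%N * b i else 0)))); last first.
  move=> i _; have ik : (i <= k)%N by rewrite -ltnS.
  rewrite subSn // dwork_coef_rec // -mulrA mulrDl.
  by case: ifP => _; rewrite ?mul0r.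
rewrite -big_distrr big_split /=; congr (_ * (_ + _)).
rewrite -big_mkcond /=; case: ifPn => [pk|npk]; last first.
  by rewrite big1 // => i ki; move: npk; rewrite (leq_trans ki) // ltnS leq_subr.
have kpk : ((k.+1 - p).+1 <= k.+1)%N by lia.
rewrite /conv (big_ord_widen_cond _ xpredT
  (fun i => dc z (k.+1 - p - i)%N * b i) kpk).
apply: eq_big => [i|i pi]; first by rewrite /=; have := ltn_ord i; lia.
by congr (dc z _ * _); have := ltn_ord i; lia.
Qed.

(** By Leibniz' rule the product satisfies the recursion with parameter z + w, which determines it;
    [half] treats the derivative of one factor. *)
Lemma dwork_coefD z w k : conv (dc z) (dc w) k = dc (z + w) k.
Proof.
apply: (dwork_rec_uniq K_char0 p_gt0 (z := z + w)); last first.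
- by move=> l; apply: dwork_coef_rec.
- move=> l; rewrite mulrDl -half.
  have -> : w * (conv (dc z) (dc w) l +
      (if (p <= l.+1)%N then conv (dc z) (dc w) (l.+1 - p) else 0)) =
      \sum_(i < l.+2) (l.+1 - i)%:R * dc w (l.+1 - i)%N * dc z i.
    by rewrite half; congr (_ * (_ + _)); rewrite convC.
  rewrite [X in _ + X](reindex_inj rev_ord_inj) /= -big_split big_distrr /=.
  apply: eq_bigr => i _; have il : (i <= l.+1)%N by rewrite -ltnS.
  have -> : l.+1%:R = (l.+1 - i)%:R + i%:R :> K by rewrite -natrD subnK.
  by rewrite subSS subKn //; ring.
- by rewrite /conv big_ord1 !dwork_coef0 mulr1.
Qed.

End DworkAdditivity.

(** * Convergent sums in a filtered ring *)

Section FilteredSums.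
Variables (R : comNzRingType) (small : nat -> R -> Prop).
Hypothesis small0 : forall N, small N 0.
Hypothesis smallD : forall N x y, small N x -> small N y -> small N (x + y).
Hypothesis smallN : forall N x, small N x -> small N (- x).
Hypothesis smallM : forall N x y, small 0 x -> small N y -> small N (x * y).
Implicit Types a b : nat -> R.

Lemma smallB N x y : small N x -> small N y -> small N (x - y).
Proof. by move=> hx hy; apply/smallD/smallN. Qed.

Lemma small_sum N (I : Type) (r : seq I) (P : pred I) (f : I -> R) :
  (forall i, P i -> small N (f i)) -> small N (\sum_(i <- r | P i) f i).
Proof. by move=> h; apply: (big_ind (small N)) => //; apply: smallD. Qed.

Definition null_seq a :=
  (forall k, small 0 (a k)) /\
  forall N, exists n0, forall k, (n0 <= k)%N -> small N (a k).

Definition sums_to a x :=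
  forall N, exists n0, forall n, (n0 <= n)%N -> small N (x - \sum_(k < n) a k).

(** The coefficients of A(T) B(T^c). The case c = p arises from rewriting pi^p as - p pi. *)
Definition wconv c a b k : R :=
  \sum_(v < k.+1 | (c * v <= k)%N) a (k - c * v)%N * b v.

Lemma sum_wconv c a b n : (0 < c)%N ->
  \sum_(k < n) wconv c a b k = \sum_(v < n) \sum_(u < n - c * v) a u * b v.
Proof.
move=> c0; elim: n => [|n IH]; first by rewrite !big_ord0.
rewrite big_ord_recr /= {}IH /wconv [in RHS](bigID (fun v : 'I_n.+1 => (c * v <= n)%N)) /=.
rewrite [X in _ = _ + X]big1 ?addr0; last first.
  move=> v; rewrite -ltnNge => nv; rewrite (_ : n.+1 - c * v = 0)%N ?big_ord0 //; lia.
rewrite [in RHS](eq_bigr (fun v : 'I_n.+1 => \sum_(u < n - c * v) a u * b v +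
    a (n - c * v)%N * b v)); last first.
  by move=> v cv; rewrite subSn // big_ord_recr.
rewrite big_split /=; congr (_ + _).
rewrite [in RHS]big_mkcond big_ord_recr /=.
have -> : (n - c * n = 0)%N by nia.
rewrite big_ord0 if_same addr0; apply: eq_bigr => v _.
case: ifPn => //; rewrite -ltnNge => nv.
by rewrite (_ : n - c * v = 0)%N ?big_ord0 //; lia.
Qed.

Lemma wconv_partial c a b N : (0 < c)%N -> null_seq a -> null_seq b ->
  exists n0, forall n, (n0 <= n)%N ->
  small N ((\sum_(k < n) a k) * (\sum_(k < n) b k) - \sum_(k < n) wconv c a b k).
Proof.
move=> c0 [a0 aN] [b0 bN]; have [na ha] := aN N; have [nb hb] := bN N.
exists (na + c * nb)%N => n hn; rewrite sum_wconv // mulrC big_distrl /= -sumrB.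
apply: small_sum => v _; rewrite big_distrr /=.
rewrite (eq_bigr (fun u : 'I_n => a u * b v)); last by move=> u _; rewrite mulrC.
rewrite (big_ord_widen _ (fun u => a u * b v) (leq_subr (c * v) n)) /=.
rewrite [X in X - _](bigID (fun u : 'I_n => (u < n - c * v)%N)) /= addrAC subrr add0r.
apply: small_sum => u; rewrite -leqNgt => uv.
have [nv|vn] := leqP nb v; first by apply: smallM => //; apply: hb.
by rewrite mulrC; apply: smallM => //; apply: ha; nia.
Qed.

Lemma sums_to_null a x : (forall k, small 0 (a k)) -> sums_to a x -> null_seq a.
Proof.
move=> a0 ax; split=> // N; have [n0 h] := ax N; exists n0 => k kn.
have -> : a k = (x - \sum_(i < k) a i) - (x - \sum_(i < k.+1) a i).
  by rewrite big_ord_recr /=; ring.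
by apply: smallB; apply: h => //; apply: leqW.
Qed.

Lemma sums_to_conv a b x y : null_seq a -> null_seq b -> small 0 x -> small 0 y ->
  sums_to a x -> sums_to b y -> sums_to (wconv 1 a b) (x * y).
Proof.
move=> na nb x0 y0 ax by_ N; have [n1 h1] := wconv_partial N (ltn0Sn 0) na nb.
have [n2 h2] := ax N; have [n3 h3] := by_ N.
exists (n1 + n2 + n3)%N => n hn.
have {}h1 := h1 n _; have {}h2 := h2 n _; have {}h3 := h3 n _.
set A := \sum_(k < n) a k in h1 h2; set B := \sum_(k < n) b k in h1 h3.
have A0 : small 0 A by apply: small_sum => i _; case: na.
have -> : x * y - \sum_(k < n) wconv 1 a b k =
  y * (x - A) + A * (y - B) + (A * B - \sum_(k < n) wconv 1 a b k) by ring.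
apply: smallD; [apply: smallD; apply: smallM => //|].
- by apply: h2; lia.
- by apply: h3; lia.
- by apply: h1; lia.
Qed.

(** At T = 1 the product A(T) B(T^c) does not depend on c: both groupings agree with the product of
    the partial sums up to small terms. *)
Lemma sums_to_wconv c a b x : (0 < c)%N -> null_seq a -> null_seq b ->
  sums_to (wconv 1 a b) x -> sums_to (wconv c a b) x.
Proof.
move=> c0 na nb s N; have [n1 h1] := wconv_partial N (ltn0Sn 0) na nb.
have [n2 h2] := wconv_partial N c0 na nb; have [n3 h3] := s N.
exists (n1 + n2 + n3)%N => n hn.
set S1 := \sum_(k < n) wconv 1 a b k; set Sc := \sum_(k < n) wconv c a b k.
pose AB := (\sum_(k < n) a k) * (\sum_(k < n) b k).
have -> : x - Sc = (x - S1) + ((AB - Sc) - (AB - S1)) by ring.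
by apply: smallD; [apply: h3; lia | apply: smallB; [apply: h2|apply: h1]; lia].
Qed.

Lemma eq_sums_to a b x : a =1 b -> sums_to a x -> sums_to b x.
Proof.
move=> ab s N; have [n0 h] := s N; exists n0 => n hn.
by rewrite -(eq_bigr _ (fun i _ => ab (val i))); apply: h.
Qed.

Lemma sums_to_uniq a x y : (forall z, (forall N, small N z) -> z = 0) ->
  sums_to a x -> sums_to a y -> x = y.
Proof.
move=> sep ax ay; apply/eqP; rewrite -subr_eq0; apply/eqP/sep => N.
have [n1 h1] := ax N; have [n2 h2] := ay N; pose n := (n1 + n2)%N.
rewrite (_ : x - y = (x - \sum_(k < n) a k) - (y - \sum_(k < n) a k)); last by ring.
by apply: smallB; [apply: h1 | apply: h2]; rewrite /n; lia.
Qed.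

Lemma sums_to_subseq c a x : (0 < c)%N -> null_seq a ->
    (forall N, exists n0, forall n, (n0 <= n)%N -> small N (x - \sum_(k < c * n) a k)) ->
  sums_to a x.
Proof.
move=> c0 [_ aN] s N; have [n1 h1] := aN N; have [n2 h2] := s N.
exists (c * (n1 + n2).+1)%N => n hn; pose m := (n %/ c)%N.
have mn : (c * m <= n)%N by rewrite mulnC leq_divM.
have hm : (n1 + n2 < m)%N by rewrite leq_divRL // mulnC.
have -> : x - \sum_(k < n) a k = (x - \sum_(k < c * m) a k) -
    \sum_(c * m <= k < n) a k.
  rewrite -!(big_mkord xpredT a) (big_cat_nat (leq0n _) mn) /=; ring.
apply: smallB; first by apply: h2; lia.
rewrite big_nat_cond; apply: small_sum => k /andP[/andP[hk _] _]; apply: h1; nia.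
Qed.

End FilteredSums.

Lemma exp_term_split (F : fieldType) (c P A B : F) u v :
  A != 0 -> B != 0 -> P != 0 ->
  c ^+ (u + v) / (A * B * P ^+ v) * (- P) ^+ v = c ^+ u / A * ((- c) ^+ v / B).
Proof.
move=> A0 B0 P0; rewrite exprD [(- P) ^+ v]exprNn [(- c) ^+ v]exprNn.
by field; rewrite A0 B0 expf_neq0.
Qed.

Lemma sum_residues (V : nmodType) q n (F : nat -> V) :
  \sum_(k < q * n) F k = \sum_(j < q) \sum_(m < n) F (q * m + j)%N.
Proof.
rewrite exchange_big; elim: n => [|n IH] /=; first by rewrite muln0 !big_ord0.
rewrite mulnS addnC big_split_ord /= IH big_ord_recr /=.
by congr (_ + _); apply: eq_bigr.
Qed.

(** * The additive character [theta], its Gauss sums, and the Mellin transform of the cubic sum *)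

Section AdditiveCharacter.
Variables (p : nat) (p_pr : prime p) (p_gt4 : (4 < p)%N).
Local Notation Zp := (padic_int p_pr).
Local Notation K := {fraction Zp}.
Local Notation "x %:F" := (@FracField.tofrac Zp x) : ring_scope.
Local Notation pint := (@pint p p_pr).
Local Notation char0 := (frac_natr_eq0 p_pr).
Local Notation p0 := (prime_gt0 p_pr).
Local Notation dc := (@dwork_coef K p).
Local Notation Gamma := (@padic_gamma p p_pr).
Local Notation om := (@omega p p_pr).

(* L is K[pi] with pi^(p-1) = -p, filtered by the p^N Z_p[pi]; only coordinates
   are needed, so that L is never shown to be a field. *)
Variables (L : comAlgType K) (pi : L) (coord : nat -> L -> K).

Definition pi_eval (P : {poly Zp}) : L :=
  horner_alg pi (map_poly (@FracField.tofrac Zp) P).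

Definition pi_small N (x : L) := exists P, x = (p%:R ^+ N : K) *: pi_eval P.

Hypothesis pi_q : pi ^+ p.-1 = - p%:R.
Hypothesis coord_small : forall N x k, pi_small N x -> pint N (coord k x).
Hypothesis coord_inj : forall x, (forall k, coord k x = 0) -> x = 0.
Hypothesis coord_pi : forall k c, (k < p.-1)%N -> coord k (c *: pi ^+ k) = c.

Lemma pi_small0 N : pi_small N 0.
Proof. by exists 0; rewrite /pi_eval !rmorph0 scaler0. Qed.

Lemma pi_smallD N x y : pi_small N x -> pi_small N y -> pi_small N (x + y).
Proof.
by move=> [P ->] [Q ->]; exists (P + Q); rewrite /pi_eval !rmorphD scalerDr.
Qed.

Lemma pi_smallN N x : pi_small N x -> pi_small N (- x).
Proof. by move=> [P ->]; exists (- P); rewrite /pi_eval !rmorphN scalerN. Qed.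

Lemma pi_smallMM M N x y : pi_small M x -> pi_small N y -> pi_small (M + N) (x * y).
Proof.
move=> [P ->] [Q ->]; exists (P * Q).
by rewrite /pi_eval !rmorphM /= -scalerAl -scalerAr scalerA -exprD.
Qed.

Lemma pi_smallM N x y : pi_small 0 x -> pi_small N y -> pi_small N (x * y).
Proof. exact: pi_smallMM. Qed.

Lemma pi_smallZ M N c x : pint M c -> pi_small N x -> pi_small (M + N) (c *: x).
Proof.
move=> [z ->] [P ->]; exists (z%:P * P).
rewrite /pi_eval !rmorphM /= map_polyC /= horner_algC.
rewrite rmorphXn /= rmorph_nat -scalerAl mul1r !scalerA exprD; congr (_ *: _).
by rewrite mulrAC.
Qed.

Lemma pi_smallX k : pi_small 0 (pi ^+ k).
Proof.
by exists 'X^k; rewrite /pi_eval map_polyXn rmorphXn /= horner_algX scale1r.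
Qed.

Lemma pi_small_le M N x : (M <= N)%N -> pi_small N x -> pi_small M x.
Proof.
move=> MN; rewrite -(subnKC MN) => -[P ->].
rewrite exprD -scalerA; have P0 : pi_small 0 (pi_eval P).
  by exists P; rewrite scale1r.
have := pi_smallZ (pint_le (leq0n _) (pint_pX p_pr (N - M))) P0.
by move/(pi_smallZ (pint_pX p_pr M)); rewrite !addn0.
Qed.

Lemma pi_sep x : (forall N, pi_small N x) -> x = 0.
Proof.
move=> h; apply: coord_inj => k.
have e N := coord_small k (h N).
have [z ez] := e 0%N.
suff z0 : z = 0 by rewrite ez z0 mulr0 rmorph0.
apply: padic_eqP => N; apply/pint_cong.
by have := e N; rewrite ez mul1r rmorph0 subr0.
Qed.

Local Notation sums_to := (@sums_to L pi_small).
Local Notation null_seq := (@null_seq L pi_small).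

Definition dwork_seq (z : K) k : L := dc z k *: pi ^+ k.

Lemma pi_exprD u v : pi ^+ (u + p.-1 * v) = (- p%:R : K) ^+ v *: pi ^+ u.
Proof.
have e : pi ^+ p.-1 = (- p%:R : K) *: 1 by rewrite pi_q scaleNr scaler_nat.
by rewrite exprD exprM e exprZn expr1n -scalerAr mulr1.
Qed.

Lemma small_pi_term M c k i : (p.-1 * i <= k)%N ->
  pint M ((- p%:R) ^+ i * c) -> pi_small M (c *: pi ^+ k).
Proof.
move=> ik h; rewrite -(subnK ik) pi_exprD scalerA [c * _]mulrC -[M]addn0.
by apply: pi_smallZ => //; apply: pi_smallX.
Qed.

Lemma null_dwork_seq (t : Zp) : t ^+ p = t -> null_seq (dwork_seq t%:F).
Proof.
move=> tp.
have small k : pi_small (k %/ p %/ 4) (dwork_seq t%:F k).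
  rewrite /dwork_seq dwork_coef_teich; last by rewrite -rmorphXn tp.
  apply: (@small_pi_term _ _ _ (k %/ p)).
    by apply: leq_trans (leq_divM k p); rewrite mulnC leq_mul2l leq_pred orbT.
  rewrite mulrA [in dc _ _](divn_eq k p) [(_ * p)%N]mulnC.
  have h := pint_dwork_coef p_pr p_gt4 (k %/ p) (ltn_pmod k p0).
  rewrite -rmorphXn -[X in pint X _]addn0; apply: pintM => //; exact: pint_tofrac.
split=> [k|N]; first exact: pi_small_le (small k).
exists (4 * p * N)%N => k hk; apply: pi_small_le (small k).
by rewrite -divnMA leq_divRL ?muln_gt0 ?p0 //; nia.
Qed.

Definition exp_seq (c : K) u : L := (c ^+ u / u`!%:R) *: pi ^+ u.

Lemma null_exp_seq (z : Zp) : null_seq (exp_seq (p%:R * z)%:F).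
Proof.
have small u : pi_small (u - u %/ 4) (exp_seq (p%:R * z)%:F u).
  apply: (@small_pi_term _ _ _ 0); first by rewrite muln0.
  rewrite mul1r; apply: (pint_inv_fact p_gt4); first exact: leq_div.
  rewrite mulrCA divff ?frac_fact_neq0 // mulr1.
  by exists (z ^+ u); rewrite -exprMn rmorphXn.
split=> [u|N]; first exact: pi_small_le (small u).
by exists (2 * N)%N => u hu; apply: pi_small_le (small u); lia.
Qed.

Lemma wconv1E (a b : nat -> K) k :
  wconv 1 (fun u => a u *: pi ^+ u) (fun u => b u *: pi ^+ u) k =
  conv a b k *: pi ^+ k.
Proof.
rewrite /wconv /conv scaler_suml; apply: eq_big => [i|i _].
  by rewrite mul1n -ltnS ltn_ord.
rewrite mul1n -scalerAl -scalerAr scalerA -exprD subnK //.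
by rewrite -ltnS.
Qed.

Lemma sums_to_delta (a : nat -> L) x : a 0%N = x -> (forall k, a k.+1 = 0) ->
  sums_to a x.
Proof.
move=> a0 aS N; exists 1%N => [[//|n] _].
rewrite big_ord_recl a0 big1 => [|i _]; last exact: aS.
by rewrite addr0 subrr; apply: pi_small0.
Qed.

(** Since pi^p / p = - pi, the exponent c (pi + pi^p / p) formally splits into c pi and - c pi. *)
Lemma dwork_seqE c k : dwork_seq c k = wconv p (exp_seq c) (exp_seq (- c)) k.
Proof.
rewrite /wconv /dwork_seq /dwork_coef scaler_suml [RHS]big_mkcond.
apply: eq_bigr => v _; rewrite /dwork_term; case: ifP => pv; last by rewrite scale0r.
rewrite -scalerAl -scalerAr scalerA -exprD.
rewrite -(@exp_term_split _ c p%:R) ?frac_fact_neq0 ?frac_p_neq0 //.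
rewrite -[RHS]scalerA -pi_exprD; congr (_ *: (pi ^+ _)).
by have := p0; nia.
Qed.

(** For c in p Z_p the series of exp (c pi) and exp (- c pi) both converge, so the splitting of
    [dwork_seqE] may be summed and gives exp 0 = 1. *)
Lemma sums_to_dwork_pz (z : Zp) :
  null_seq (dwork_seq (p%:R * z)%:F) /\ sums_to (dwork_seq (p%:R * z)%:F) 1.
Proof.
set c := (p%:R * z)%:F.
have nE : null_seq (exp_seq c) by exact: null_exp_seq.
have nE' : null_seq (exp_seq (- c)).
  by rewrite /c -rmorphN -mulrN; exact: null_exp_seq.
have h : sums_to (wconv 1 (exp_seq c) (exp_seq (- c))) 1.
  apply: sums_to_delta => [|k]; rewrite wconv1E.
    by rewrite /conv big_ord1 subnn !expr0 fact0 !divr1 mulr1 scale1r.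
  have -> : conv (fun u => c ^+ u / u`!%:R) (fun u => (- c) ^+ u / u`!%:R) k.+1 =
      (c - c) ^+ k.+1 / k.+1`!%:R.
    rewrite exprDn big_distrl; apply: eq_bigr => i _ /=.
    have ik : (i <= k.+1)%N by rewrite -ltnS.
    rewrite mulrACA -invfM mulrC [(k.+1 - i)`!%:R * _]mulrC (inv_fact_bin char0 ik).
    by rewrite mulrC mulrA -[X in _ = X / _]mulr_natr.
  by rewrite subrr expr0n mul0r scale0r.
have s1 : sums_to (dwork_seq c) 1.
  apply: eq_sums_to (fun k => esym (dwork_seqE c k)) _.
  exact: (sums_to_wconv pi_small0 pi_smallD pi_smallN pi_smallM p0 nE nE' h).
split=> //; apply: (sums_to_null pi_smallD pi_smallN _ s1) => k.
rewrite dwork_seqE; apply: (small_sum pi_small0 pi_smallD) => v _.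
by apply: pi_smallM; [case: nE | case: nE'].
Qed.

Local Notation q := p.-1.

Lemma padic_q_unit : (q%:R : Zp) \is a GRing.unit.
Proof. by rewrite padic_unit_natr gtnNdvd //; lia. Qed.

(** By [gauss_sumE], the Gauss sum of the character omega^(-j) is this times pi^j. Reflection turns
    it into - Gamma_p (j / (p - 1)), the usual form of Gross-Koblitz. *)
Definition gauss_coef j : Zp := (-1) ^+ j / Gamma (1 - j%:R / q%:R).

Lemma gauss_coef_limit j n : (j < p)%N ->
  pint (n %/ 4) ((gauss_coef j / q%:R)%:F -
     \sum_(m < n.+1) (- p%:R) ^+ m * dc 1 (p * m + j - m)).
Proof.
move=> jp.
have sj : - (j%:R / q%:R) * q%:R = - j%:R :> Zp by rewrite mulNr divrK // padic_q_unit.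
have h := gross_koblitz_limit p_gt4 n jp sj.
apply: (@pint_div_nat _ _ _ _ q); first by rewrite gtnNdvd //; lia.
have q1 : q%:R = - (1 - p%:R) :> K by rewrite opprB -(natrB _ p0) subn1.
have e : q%:R * (gauss_coef j / q%:R)%:F =
    - ((-1) ^+ j.+1 / Gamma (1 - j%:R / q%:R))%:F :> K.
  rewrite -(rmorph_nat (@FracField.tofrac Zp)) -rmorphM -rmorphN; congr _%:F.
  by rewrite mulrC divrK ?padic_q_unit // exprS mulN1r mulNr opprK.
by rewrite mulrBr e q1 mulNr opprK addrC.
Qed.

(* The value at T = pi of exp (t (T + T^p / p)) with t = om x, in which the terms
   of degree j modulo p - 1 are summed by gross_koblitz_limit. *)
Definition theta (x : 'F_p) : L :=
  if x == 0 then 1 else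
  \sum_(j < q) ((gauss_coef j / q%:R) * om x ^+ j)%:F *: pi ^+ j.

Lemma theta_sums x : sums_to (dwork_seq (om x)%:F) (theta x).
Proof.
have q0 : (0 < q)%N by lia.
rewrite /theta; have [->|x0] := eqVneq x 0.
  have d k : dc 0 k = dc 1 k * 0 ^+ k.
    by apply: dwork_coef_teich; rewrite expr0n gtn_eqF ?p0.
  apply: sums_to_delta => [|k]; rewrite /dwork_seq omega0 rmorph0 d.
    by rewrite dwork_coef0 !expr0 mulr1 scale1r.
  by rewrite expr0n mulr0 scale0r.
have tF : (om x)%:F ^+ p = (om x)%:F by rewrite -rmorphXn omegaXp.
apply: (sums_to_subseq pi_small0 pi_smallD pi_smallN q0).
  exact: null_dwork_seq (omegaXp _ x).
move=> N; exists (4 * N).+1%N => -[//|n] hn; rewrite sum_residues -sumrB.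
apply: (small_sum pi_small0 pi_smallD) => j _.
have jp : (j < p)%N by have := ltn_ord j; lia.
(* The index q m + j is p m + j - m; moreover pi^(q m) = (-p)^m and (om x)^(q m) = 1. *)
have -> : \sum_(m < n.+1) dwork_seq (om x)%:F (q * m + j) =
   ((\sum_(m < n.+1) (- p%:R) ^+ m * dc 1 (p * m + j - m)) * (om x ^+ j)%:F) *: pi ^+ j.
  rewrite big_distrl scaler_suml; apply: eq_bigr => m _ /=.
  rewrite /dwork_seq dwork_coef_teich // addnC pi_exprD scalerA; congr (_ *: _).
  rewrite mulrC -mulrA; congr (_ * (dc 1 _ * _)); first by nia.
  by rewrite -rmorphXn exprD exprM omegaX // expr1n mulr1.
rewrite rmorphM -scalerBl -mulrBl -[N]addn0; apply: pi_smallZ; last exact: pi_smallX.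
rewrite -[N]addn0; apply: pintM; last exact: pint_tofrac.
by apply: pint_le (gauss_coef_limit n jp); lia.
Qed.

Lemma theta_small x : pi_small 0 (theta x).
Proof.
rewrite /theta; case: ifP => _; first by rewrite -(expr0 pi); apply: pi_smallX.
apply: (small_sum pi_small0 pi_smallD) => j _; rewrite -[0%N]/(0 + 0)%N.
by apply: pi_smallZ; [apply: pint_tofrac | apply: pi_smallX].
Qed.

Lemma theta0 : theta 0 = 1.
Proof. by rewrite /theta eqxx. Qed.

(* Both sides are sums of dwork_seq (om x + om y), since
   om x + om y = om (x + y) + p z. *)
Lemma thetaD x y : theta (x + y) = theta x * theta y.
Proof.
have [z ez] : exists z, om x + om y = om (x + y) + p%:R * z.
  apply/(@padic_congP _ _ 1); apply/padic_red_eq.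
  by rewrite padic_redD !red_omega.
have nd u := null_dwork_seq (omegaXp p_pr u).
have conv_seq (a b : K) k : wconv 1 (dwork_seq a) (dwork_seq b) k = dwork_seq (a + b) k.
  by rewrite wconv1E dwork_coefD ?p0 //; exact: char0.
have one_small : pi_small 0 1 by rewrite -(expr0 pi); apply: pi_smallX.
have [nz sz] := sums_to_dwork_pz z.
apply: (sums_to_uniq pi_smallD pi_smallN pi_sep (a := dwork_seq (om x + om y)%:F)).
  rewrite ez rmorphD /= -[theta (x + y)]mulr1.
  apply: eq_sums_to (conv_seq _ _) _.
  exact: (sums_to_conv pi_small0 pi_smallD pi_smallM (nd _) nz
    (theta_small _) one_small (theta_sums _) sz).
rewrite rmorphD /=; apply: eq_sums_to (conv_seq _ _) _.
exact: (sums_to_conv pi_small0 pi_smallD pi_smallM (nd _) (nd _)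
  (theta_small _) (theta_small _) (theta_sums _) (theta_sums _)).
Qed.

Definition pi_int (z : Zp) : L := (z%:F)%:A.

Lemma pi_intM z w : pi_int (z * w) = pi_int z * pi_int w.
Proof. by rewrite /pi_int rmorphM /= -scalerAl mul1r scalerA. Qed.

Lemma pi_intD z w : pi_int (z + w) = pi_int z + pi_int w.
Proof. by rewrite /pi_int rmorphD scalerDl. Qed.

Lemma pi_int0 : pi_int 0 = 0.
Proof. by rewrite /pi_int rmorph0 scale0r. Qed.

Lemma pi_int_sum (I : Type) (r : seq I) (P : pred I) (f : I -> Zp) :
  pi_int (\sum_(i <- r | P i) f i) = \sum_(i <- r | P i) pi_int (f i).
Proof. exact: (big_morph _ pi_intD pi_int0). Qed.

Lemma pi_int_scale z x : z%:F *: x = pi_int z * x.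
Proof. by rewrite /pi_int -scalerAl mul1r. Qed.

Definition gauss_sum n : L := \sum_(x : 'F_p | x != 0) pi_int (om x ^+ n) * theta x.

Lemma gauss_sumE n k : (k < q)%N -> (q %| n + k)%N ->
  gauss_sum n = (gauss_coef k)%:F *: pi ^+ k.
Proof.
move=> kq nk; rewrite /gauss_sum.
rewrite (eq_bigr (fun x : 'F_p => \sum_(j < q)
   pi_int (om x ^+ (n + j) * (gauss_coef j / q%:R)) * pi ^+ j)); last first.
  move=> x x0; rewrite /theta (negbTE x0) big_distrr; apply: eq_bigr => j _ /=.
  rewrite pi_int_scale mulrA -pi_intM; congr (pi_int _ * _).
  by move: (gauss_coef j / q%:R) => c; rewrite exprD; ring.
rewrite exchange_big (bigD1 (Ordinal kq)) //= [X in _ + X]big1 ?addr0.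
  rewrite -big_distrl -pi_int_sum -big_distrl sum_omega nk /=.
  by rewrite [q%:R * _]mulrC divrK ?padic_q_unit // pi_int_scale.
move=> j jk; rewrite -big_distrl -pi_int_sum -big_distrl sum_omega ifN.
  by rewrite /= mul0r pi_int0 mul0r.
apply: contra jk => nj; rewrite -val_eqE /=; apply/eqP.
have jq := ltn_ord j.
have : (n + j == n + k %[mod q])%N by move: nj nk => /eqP -> /eqP ->.
by rewrite eqn_modDl !modn_small // => /eqP.
Qed.

Lemma gauss_sum_twist n n' c : c != 0 -> (q %| n + n')%N ->
  \sum_(x : 'F_p | x != 0) pi_int (om x ^+ n) * theta (c * x) =
  pi_int (om c ^+ n') * gauss_sum n.
Proof.
move=> c0 nn; rewrite /gauss_sum big_distrr [RHS](reindex_inj (mulfI c0)) /=.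
apply: eq_big => [x|x x0]; first by rewrite mulf_eq0 negb_or c0.
rewrite mulrA -pi_intM omegaM exprMn mulrA -exprD addnC.
by rewrite (@omega_mod _ _ c _ 0) ?expr0 ?mul1r // mod0n; apply/eqP.
Qed.

Variable k0 : nat.
Hypothesis k0E : (k0 + k0 = q)%N.

Let phi (u : 'F_p) : Zp := om u ^+ k0.

(** Expresses the quadratic character through additive ones. At u = 0 both sides vanish, because
    [phi] is a nontrivial character. *)
Lemma gauss_sum_phi u :
  gauss_sum k0 * pi_int (phi u) =
  \sum_(z : 'F_p | z != 0) pi_int (phi z) * theta (u * z).
Proof.
have [->|u0] := eqVneq u 0; last by rewrite (gauss_sum_twist (n' := k0)) ?k0E // mulrC.
rewrite /phi omega0 expr0n gtn_eqF; last by lia.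
rewrite pi_int0 mulr0 (eq_bigr (fun z => pi_int (om z ^+ k0))); last first.
  by move=> z _; rewrite mul0r theta0 mulr1.
by rewrite -pi_int_sum sum_omega gtnNdvd ?pi_int0 //; lia.
Qed.

Definition cubic_sum (m : 'F_p) : Zp := \sum_(x : 'F_p) phi (m * x ^+ 3 + x + 1).

Definition cubic_mellin n : Zp := \sum_(m : 'F_p | m != 0) om m ^+ n * cubic_sum m.

(** Here [n'] stands for - n. After [gauss_sum_phi], the sums over m, over x and over z, taken in
    this order, are twisted Gauss sums when x != 0. The point x = 0 gives the last term, which
    survives only for the trivial character. *)
Lemma cubic_mellin_gauss n n' : (q %| n + n')%N ->
  gauss_sum k0 * pi_int (cubic_mellin n) =
  gauss_sum n * gauss_sum (3 * n') * gauss_sum (k0 + n' + 3 * n) +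
  (if (q %| n)%N then pi_int q%:R else 0) * gauss_sum k0.
Proof.
move=> nn.
pose B m x z := pi_int (om m ^+ n) * (pi_int (phi z) * theta ((m * x ^+ 3 + x + 1) * z)).
transitivity (\sum_(x : 'F_p) \sum_(z : 'F_p | z != 0) \sum_(m : 'F_p | m != 0) B m x z).
  rewrite pi_int_sum big_distrr /=.
  rewrite (eq_bigr (fun m => \sum_(x : 'F_p) \sum_(z : 'F_p | z != 0) B m x z)).
    by rewrite exchange_big; apply: eq_bigr => x _; rewrite exchange_big.
  move=> m m0; rewrite pi_intM mulrCA pi_int_sum !big_distrr /=.
  by apply: eq_bigr => x _; rewrite gauss_sum_phi big_distrr.
have BE x z : \sum_(m : 'F_p | m != 0) B m x z = pi_int (phi z) * theta (z * x) * theta z *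
    \sum_(m : 'F_p | m != 0) pi_int (om m ^+ n) * theta (z * x ^+ 3 * m).
  rewrite big_distrr; apply: eq_bigr => m _ /=.
  rewrite /B !mulrDl mul1r !thetaD [m * _ * z]mulrC [m * x ^+ 3]mulrC mulrA [x * z]mulrC.
  by rewrite -[z * x ^+ 3 * m]mulrA; ring.
rewrite (bigD1 0) //= addrC; congr (_ + _); last first.
  rewrite big_distrr; apply: eq_bigr => z z0 /=; rewrite BE mulr0 theta0 mulr1 mulrC.
  rewrite (eq_bigr (fun m => pi_int (om m ^+ n))) => [|m _]; last first.
    by rewrite expr0n mulr0 mul0r theta0 mulr1.
  by rewrite -pi_int_sum sum_omega; case: ifP => _; rewrite ?pi_int0.
rewrite exchange_big.
rewrite {3}/gauss_sum [RHS]big_distrr; apply: eq_bigr => z z0 /=.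
have n3 : (q %| 3 * n' + 3 * n)%N by rewrite -mulnDr addnC dvdn_mull.
rewrite (eq_bigr (fun x => gauss_sum n * pi_int (phi z * om z ^+ n') * theta z *
    (pi_int (om x ^+ (3 * n')) * theta (z * x)))); last first.
  move=> x x0; rewrite BE (gauss_sum_twist _ nn) ?mulf_neq0 ?expf_neq0 //.
  rewrite omegaM exprMn omegaXn -exprM !pi_intM; ring.
rewrite -big_distrr /= (gauss_sum_twist z0 n3) !exprD /phi !pi_intM; ring.
Qed.

(** Every Gauss sum is a multiple of a power of pi, and k1 + k2 + k3 = k0 + q e makes both sides of
    [cubic_mellin_gauss] multiples of pi^k0, whose coefficients are compared. *)
Lemma cubic_mellin_coord n n' k1 k2 k3 e : (q %| n + n')%N ->
    (k1 < q)%N -> (k2 < q)%N -> (k3 < q)%N ->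
    (q %| n + k1)%N -> (q %| 3 * n' + k2)%N -> (q %| k0 + n' + 3 * n + k3)%N ->
    (k1 + k2 + k3 = k0 + q * e)%N ->
  gauss_coef k0 * cubic_mellin n =
  gauss_coef k1 * gauss_coef k2 * gauss_coef k3 * (- p%:R) ^+ e +
  (if (q %| n)%N then q%:R else 0) * gauss_coef k0.
Proof.
move=> nn k1q k2q k3q h1 h2 h3 ee.
have k0q : (k0 < q)%N by lia.
have h0 : (q %| k0 + k0)%N by rewrite k0E.
have := cubic_mellin_gauss nn.
rewrite (gauss_sumE k0q h0) (gauss_sumE k1q h1) (gauss_sumE k2q h2) (gauss_sumE k3q h3).
have mulZ a b i j : (a *: pi ^+ i) * (b *: pi ^+ j) = (a * b) *: pi ^+ (i + j).
  by rewrite -scalerAl -scalerAr scalerA exprD.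
rewrite [_ * pi_int _]mulrC -pi_int_scale scalerA !mulZ ee pi_exprD scalerA.
have -> : (if (q %| n)%N then pi_int q%:R else 0) = pi_int (if (q %| n)%N then q%:R else 0).
  by case: ifP => _; rewrite ?pi_int0.
rewrite -pi_int_scale scalerA -scalerDl => /(congr1 (coord k0)).
rewrite !coord_pi // => h; apply/eqP; rewrite -tofrac_eq; apply/eqP.
have pe : ((- p%:R) ^+ e : Zp)%:F = (- p%:R) ^+ e.
  by rewrite rmorphXn rmorphN /= frac_natr.
by rewrite rmorphM mulrC /= {}h rmorphD !rmorphM /= pe.
Qed.

End AdditiveCharacter.

(** * The quotient ring F[X] / (X^m + c) and its coordinates *)

Section Ramified.
Variables (F : fieldType) (m : nat) (c : F).
Hypothesis m_gt0 : (0 < m)%N.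

Definition ram_poly (R : nzRingType) (a : R) : {poly R} := 'X^m + a%:P.

Lemma ram_poly_monic (R : nzRingType) (a : R) : ram_poly a \is monic.
Proof. by apply: monicXnaddC. Qed.

Lemma size_ram_poly (R : nzRingType) (a : R) : size (ram_poly a) = m.+1.
Proof. exact: size_XnaddC. Qed.

Local Notation h := (ram_poly c).
Local Notation L := {poly %/ h}.

Lemma mk_monic_ram : mk_monic h = h.
Proof. by rewrite /mk_monic size_ram_poly ltnS m_gt0 ram_poly_monic. Qed.

Lemma in_qpoly_ram (P : {poly F}) : (size P <= m)%N -> in_qpoly h P = P :> {poly F}.
Proof. by move=> sP; rewrite in_qpoly_small // mk_monic_ram size_ram_poly. Qed.

Lemma in_qpoly_self : in_qpoly h h = 0.
Proof. by apply: val_inj; rewrite /= mk_monic_ram rmodpp // ram_poly_monic. Qed.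

Lemma ram_root : ('qX : L) ^+ m = (- c)%:A.
Proof.
have : in_qpoly h ('X^m + c%:P) = 0 by exact: in_qpoly_self.
rewrite rmorphD rmorphXn /= -alg_polyC linearZ /= rmorph1 => /eqP.
by rewrite addr_eq0 => /eqP ->; rewrite scaleNr.
Qed.

Lemma horner_alg_ram (P : {poly F}) : horner_alg ('qX : L) P = in_qpoly h P.
Proof.
elim/poly_ind: P => [|P a IH]; first by rewrite !rmorph0.
rewrite !rmorphD !rmorphM /= IH horner_algX horner_algC; congr (_ + _).
by rewrite -alg_polyC linearZ /= rmorph1.
Qed.

Lemma ram_coord_monom k (a : F) : (k < m)%N -> (a *: ('qX : L) ^+ k : {poly F})`_k = a.
Proof.
move=> km; have -> : a *: ('qX : L) ^+ k = in_qpoly h (a *: 'X^k).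
  by rewrite linearZ rmorphXn.
rewrite in_qpoly_ram; first by rewrite coefZ coefXn eqxx mulr1.
by rewrite (leq_trans (size_scale_leq _ _)) // size_polyXn.
Qed.

End Ramified.

Section CubicMellin.
Variables (p : nat) (p_pr : prime p) (p_gt4 : (4 < p)%N).
Local Notation Zp := (padic_int p_pr).
Local Notation K := {fraction Zp}.
Local Notation q := p.-1.
Local Notation L := {poly %/ (ram_poly q (p%:R : K))}.
Local Notation gauss_coef := (@gauss_coef p p_pr).

(** Since X^(p-1) + p is monic with coefficients in Z_p, the reduction of an integral polynomial can
    be computed over Z_p, and its coordinates are integral. *)
Lemma ram_coord_small N (x : L) k : pi_small ('qX : L) N x ->
  pint N ((x : {poly K})`_k).
Proof.
have q0 : (0 < q)%N by lia.
move=> [P ->]; rewrite coefZ mulrC; apply: pintMl; last exact: pint_pX.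
pose h := ram_poly q (p%:R : Zp).
have hm : h \is monic by exact: ram_poly_monic.
have hF : map_poly (@FracField.tofrac Zp) h = ram_poly q (p%:R : K).
  by rewrite /h /ram_poly rmorphD /= map_polyXn map_polyC /= frac_natr.
have e : map_poly (@FracField.tofrac Zp) P = map_poly (@FracField.tofrac Zp) (rdivp P h) *
    ram_poly q (p%:R : K) + map_poly (@FracField.tofrac Zp) (rmodp P h).
  by rewrite [in LHS](rdivp_eq hm P) rmorphD rmorphM /= hF.
rewrite /pi_eval horner_alg_ram // e in_qpolyD in_qpolyM in_qpoly_self //.
rewrite mulr0 add0r -[\val _]/(polyn _) in_qpoly_ram //.
  by rewrite coef_map; apply: pint_tofrac.
apply: leq_trans (size_poly _ _) _.
by rewrite -ltnS -(size_ram_poly q0 (p%:R : Zp)) ltn_rmodp monic_neq0.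
Qed.

Theorem cubic_mellin_value k0 n n' k1 k2 k3 e : (k0 + k0 = q)%N ->
    (q %| n + n')%N -> (k1 < q)%N -> (k2 < q)%N -> (k3 < q)%N ->
    (q %| n + k1)%N -> (q %| 3 * n' + k2)%N -> (q %| k0 + n' + 3 * n + k3)%N ->
    (k1 + k2 + k3 = k0 + q * e)%N ->
  gauss_coef k0 * cubic_mellin p_pr k0 n =
  gauss_coef k1 * gauss_coef k2 * gauss_coef k3 * (- p%:R) ^+ e +
  (if (q %| n)%N then q%:R else 0) * gauss_coef k0.
Proof.
have q0 : (0 < q)%N by lia.
have pi_q : ('qX : L) ^+ q = - p%:R by rewrite ram_root // scaleNr scaler_nat.
have coord_inj (x : L) : (forall k, (x : {poly K})`_k = 0) -> x = 0.
  by move=> x0; apply: val_inj; apply/polyP => k; rewrite x0 coef0.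
have coord_pi k c : (k < q)%N -> (c *: ('qX : L) ^+ k : {poly K})`_k = c.
  exact: ram_coord_monom.
move=> h1 h2 h3 h4 h5 h6 h7 h8 h9.
exact (cubic_mellin_coord p_gt4 pi_q ram_coord_small coord_inj coord_pi
  h1 h2 h3 h4 h5 h6 h7 h8 h9).
Qed.

End CubicMellin.

(** * Point counts *)

Section PointCount.
Variables (p : nat) (p_pr : prime p) (p_gt4 : (4 < p)%N).
Local Notation Zp := (padic_int p_pr).
Local Notation q := p.-1.
Local Notation om := (@omega p p_pr).
Variable k0 : nat.
Hypothesis k0E : (k0 + k0 = q)%N.
Local Notation phi u := (om u ^+ k0).

Lemma phi0 : phi 0 = 0.
Proof. by rewrite omega0 expr0n gtn_eqF //; lia. Qed.

Lemma phi_sqr u : u != 0 -> phi u * phi u = 1.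
Proof. by move=> u0; rewrite -exprD k0E omegaX. Qed.

Lemma phiM u v : phi (u * v) = phi u * phi v.
Proof. by rewrite omegaM exprMn. Qed.

Lemma Fp_natr_neq0 n : (0 < n < p)%N -> (n%:R : 'F_p) != 0.
Proof.
case/andP => n0 np; rewrite -[0]/(0%:R) Fp_natr_eq // mod0n modn_small //.
by rewrite -lt0n.
Qed.

(** Counting by orthogonality leaves only the powers omega^j with p - 1 dividing 2 j, that is j = 0
    and j = k0. *)
Lemma card_sqrt (v : 'F_p) :
  (#|[set y : 'F_p | y ^+ 2 == v]|%:R : Zp) = 1 + phi v.
Proof.
have [->|v0] := eqVneq v 0.
  rewrite phi0 addr0 (_ : [set y | _]%SET = [set 0]%SET) ?cards1 //.
  by apply/setP => y; rewrite !inE sqrf_eq0.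
have q0 : (q%:R : Zp) != 0 by rewrite padic_natr_eq0; lia.
apply: (mulfI q0).
have -> : q%:R * (#|[set y : 'F_p | y ^+ 2 == v]|%:R : Zp) =
    \sum_(y : 'F_p | y != 0) \sum_(0 <= j < q) om (y ^+ 2 / v) ^+ (1 * j).
  rewrite -sum1_card natr_sum big_distrr /=.
  rewrite (eq_bigl (fun y : 'F_p => (y != 0) && (y ^+ 2 == v))); last first.
    move=> y; rewrite inE; have [->|//] := eqVneq y 0.
    by rewrite expr0n eq_sym; apply/negbTE.
  rewrite big_mkcondr /=; apply: eq_bigr => y y0.
  rewrite sum_omega_exp ?mulf_neq0 ?expf_neq0 ?invr_neq0 // expr1 mulr1.
  by rewrite (can2_eq (divfK v0) (mulfK v0)) mul1r.
rewrite exchange_big /= big_mkord.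
rewrite (eq_bigr (fun j : 'I_q => om v^-1 ^+ j *
    (if (q %| 2 * j)%N then q%:R else 0))); last first.
  move=> j _; rewrite -sum_omega big_distrr; apply: eq_bigr => y _ /=.
  by rewrite mul1n omegaM exprMn omegaXn -exprM mulrC.
have q0' : (0 < q)%N by lia.
have k0q : (k0 < q)%N by lia.
rewrite (bigD1 (Ordinal q0')) //= (bigD1 (Ordinal k0q)) /=; last first.
  by rewrite -val_eqE /=; lia.
rewrite big1 ?addr0 => [|j /andP[]]; last first.
  rewrite -!val_eqE /= => j0 jk; rewrite ifN ?mulr0 //.
  have jq := ltn_ord j; apply/negP => /dvdnP[[|[|c]]]; [lia | lia | nia].
rewrite muln0 dvdn0 expr0 mul1r ifT; last by rewrite mul2n -addnn k0E.
rewrite mulrDr mulr1 mulrC; congr (_ + _ * _).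
apply: (mulIr (unitrX k0 (omega_unit p_pr v0))).
by rewrite phi_sqr // -exprMn -omegaM mulVf // omega1 expr1n.
Qed.

Lemma quad_charE (v : 'F_p) : (quad_char v)%:~R = phi v :> Zp.
Proof.
rewrite /quad_char; case: eqVneq => [->|v0]; first by rewrite phi0.
have /eqP : (phi v - 1) * (phi v + 1) = 0.
  by rewrite mulrDr mulr1 mulrBl phi_sqr // mul1r; ring.
rewrite mulf_eq0 subr_eq0 addr_eq0; have e := card_sqrt v.
have n20 : (2%:R : Zp) != 0 by rewrite padic_natr_eq0.
case: existsP => [[y yv]|ny] /orP[/eqP h|/eqP h]; rewrite h //.
  move: e; rewrite h subrr => /eqP; rewrite padic_natr_eq0 cards_eq0.
  by move=> /eqP/setP/(_ y); rewrite !inE yv.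
move: e; rewrite h (_ : [set y | _]%SET = finset.set0); last first.
  by apply/setP => y; rewrite !inE; apply/negP => yv; apply: ny; exists y.
by rewrite cards0 -(natrD _ 1 1) => /esym/eqP; rewrite (negbTE n20).
Qed.

Lemma frobenius_traceE (a b : 'F_p) :
  (frobenius_trace a b)%:~R = - \sum_(x : 'F_p) phi (x ^+ 3 + a * x + b) :> Zp.
Proof.
pose T := [set z : 'F_p * 'F_p | z.2 ^+ 2 == z.1 ^+ 3 + a * z.1 + b]%SET.
have cS : #|sw_points a b| = #|T|.+1.
  have -> : sw_points a b = (None |: [set Some z | z in T])%SET.
    apply/setP => -[[x y]|]; rewrite !inE //=.
    by rewrite mem_imset ?inE // => z w [].
  rewrite cardsU1 card_imset => [|z w []//].
  by rewrite (_ : None \notin _) //; apply/imsetP => -[].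
have cT : (#|T|%:R : Zp) = \sum_(x : 'F_p) (1 + phi (x ^+ 3 + a * x + b)).
  rewrite -sum1_card natr_sum.
  under [in RHS]eq_bigr do rewrite -card_sqrt -sum1_card natr_sum.
  rewrite pair_big_dep /=; apply: eq_bigl => -[x y]; by rewrite !inE.
have c1 : (\sum_(x : 'F_p) 1 : Zp) = p%:R by rewrite sumr_const card_Fp.
rewrite big_split /= c1 in cT.
rewrite /frobenius_trace cS rmorphB rmorphD /= mulr1z -!pmulrn.
by rewrite -[#|T|.+1]addn1 natrD cT; ring.
Qed.

Lemma trace_cubic_sum (a b : 'F_p) : a != 0 -> b != 0 ->
  (quad_char b)%:~R * (frobenius_trace a b)%:~R =
  - cubic_sum p_pr k0 (b ^+ 2 / a ^+ 3).
Proof.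
move=> a0 b0; rewrite quad_charE frobenius_traceE mulrN big_distrr; congr (- _).
have ba : b / a != 0 by rewrite mulf_neq0 ?invr_neq0.
rewrite (reindex_inj (mulfI ba)); apply: eq_bigr => x _ /=.
have -> : (b / a * x) ^+ 3 + a * (b / a * x) + b =
    b * (b ^+ 2 / a ^+ 3 * x ^+ 3 + x + 1) by field.
by rewrite phiM mulrA phi_sqr // mul1r.
Qed.

(** Summation over the even powers of omega detects v^2 = m^2, that is v = m or v = - m. *)
Lemma mellin_even (F : 'F_p -> Zp) (m : 'F_p) : m != 0 ->
  \sum_(0 <= j < q) om (m ^+ 2)^-1 ^+ j * \sum_(v : 'F_p | v != 0) om v ^+ (2 * j) * F v =
  q%:R * (F m + F (- m)).
Proof.
move=> m0; transitivity (\sum_(v : 'F_p | v != 0) \sum_(0 <= j < q)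
    om (v / m) ^+ (2 * j) * F v).
  rewrite exchange_big; apply: eq_bigr => j _; rewrite big_distrr.
  apply: eq_bigr => v _ /=; rewrite mulrA; congr (_ * _).
  rewrite [v / m]mulrC omegaM exprMn -exprVn; congr (_ * _).
  by rewrite omegaXn -exprM.
rewrite (eq_bigr (fun v => (if (v / m) ^+ 2 == 1 then q%:R else 0) * F v)); last first.
  move=> v v0; rewrite -big_distrl /= sum_omega_exp // mulf_neq0 ?invr_neq0 //.
have mm : - m != m.
  rewrite eq_sym -subr_eq0 opprK -mulr2n -mulr_natl mulf_neq0 //.
  by apply: Fp_natr_neq0; lia.
have sq v : ((v / m) ^+ 2 == 1) = (v == m) || (v == - m).
  rewrite sqrf_eq1; congr (_ || _); rewrite (can2_eq (divfK m0) (mulfK m0)) ?mul1r //.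
  by rewrite mulN1r.
rewrite (bigD1 m) //= (bigD1 (- m)) /=; last by rewrite oppr_eq0 m0.
rewrite !sq !eqxx orbT /= big1 ?addr0; first by rewrite mulrDr.
move=> v /andP[/andP[_ vm] vm']; rewrite sq (negbTE vm) (negbTE vm') mul0r //.
Qed.

End PointCount.

(** * Comparison with the hypergeometric function *)

Section RatFrac.
Implicit Types x y : rat.

Lemma floorD1 x : Num.floor (x + 1) = Num.floor x + 1.
Proof. by rewrite -[1]/(1%:~R) floorDrz ?intr_int // intrKfloor. Qed.

Lemma rat_fracD1 x : rat_frac (x + 1) = rat_frac x.
Proof. by rewrite /rat_frac floorD1 rmorphD /=; lra. Qed.

Lemma rat_frac_id x : 0 <= x < 1 -> rat_frac x = x.
Proof. by move=> x01; rewrite /rat_frac (floor_def (m := 0)) ?subr0 // add0r. Qed.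

Lemma rat_frac_bounds x : 0 <= rat_frac x < 1.
Proof.
rewrite /rat_frac; have := floor_le x; have := lt_succ_floor x.
by rewrite rmorphD /=; lra.
Qed.

Lemma periodic_int (V : Type) (F : rat -> V) : (forall x, F (x + 1) = F x) ->
  forall x, F x = F (rat_frac x).
Proof.
move=> F1 x; have Fn (n : nat) y : F (y + n%:R) = F y.
  by elim: n y => [|n IH] y; rewrite ?addr0 // -natr1 addrA F1.
rewrite /rat_frac; case: (Num.floor x) => n; first by rewrite -[in RHS](Fn n) subrK.
by rewrite NegzE rmorphN opprK; rewrite -[in LHS](Fn n.+1).
Qed.

Lemma frac_shift_bounds m h y : (h < m.+1)%N ->
  0 <= (rat_frac y + h%:R) / m.+1%:R < 1.
Proof.
move=> hm; have /andP[y0 y1] := rat_frac_bounds y.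
have h0 : 0 <= h%:R :> rat by rewrite ler0n.
have h1 : h%:R + 1 <= m.+1%:R :> rat by rewrite natr1 ler_nat.
apply/andP; split; first by rewrite divr_ge0 ?ler0n //; lra.
by rewrite ltr_pdivrMr ?ltr0n // mul1r; lra.
Qed.

(** Both sides are invariant under y |-> y + 1, which permutes the factors on the left cyclically;
    for 0 <= y < 1 the arguments already lie in [0, 1). *)
Lemma prod_frac_shift (R : comPzSemiRingType) (f : rat -> R) m y : (0 < m)%N ->
  \prod_(0 <= h < m) f (rat_frac ((y + h%:R) / m%:R)) =
  \prod_(0 <= h < m) f ((rat_frac y + h%:R) / m%:R).
Proof.
case: m => // m _.
have m0 : (m.+1%:R : rat) != 0 by rewrite pnatr_eq0.
pose F y := \prod_(0 <= h < m.+1) f (rat_frac ((y + h%:R) / m.+1%:R)).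
have F1 z : F (z + 1) = F z.
  rewrite /F big_nat_recr // [RHS]big_nat_recl //= mulrC addr0; congr (_ * _).
    by rewrite -addrA [1 + _]addrC natr1 mulrDl divff // rat_fracD1.
  by apply: eq_bigr => h _; rewrite -addrA [1 + _]addrC natr1.
rewrite -/(F y) (periodic_int F1) /F; apply: eq_big_nat => h /andP[_ hm].
by rewrite rat_frac_id //; apply: frac_shift_bounds.
Qed.

(** Hermite's identity, by the same reduction to 0 <= y < 1, where all the floors vanish. *)
Lemma sum_floor_shift m y : (0 < m)%N ->
  \sum_(0 <= h < m) Num.floor ((y + h%:R) / m%:R) = Num.floor y.
Proof.
case: m => // m _.
have m0 : (m.+1%:R : rat) != 0 by rewrite pnatr_eq0.
pose F y := \sum_(0 <= h < m.+1) Num.floor ((y + h%:R) / m.+1%:R) - Num.floor y.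
have F1 z : F (z + 1) = F z.
  rewrite /F floorD1 big_nat_recr // [in RHS]big_nat_recl //= addr0.
  have -> : (z + 1 + m%:R) / m.+1%:R = z / m.+1%:R + 1.
    by rewrite -addrA [1 + _]addrC natr1 mulrDl divff.
  rewrite floorD1 (eq_bigr (fun h => Num.floor ((z + h.+1%:R) / m.+1%:R))); first by ring.
  by move=> h _; rewrite -addrA [1 + _]addrC natr1.
apply/eqP; rewrite -subr_eq0 -/(F y) (periodic_int F1) /F.
have fl0 (z : rat) : 0 <= z < 1 -> Num.floor z = 0.
  by move=> z01; apply: floor_def; rewrite add0r.
rewrite (fl0 _ (rat_frac_bounds y)) subr0 big_nat big1 // => h /andP[_ hm].
by apply: fl0; apply: frac_shift_bounds.
Qed.

End RatFrac.

Section PadicRat.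
Variables (p : nat) (p_pr : prime p).
Local Notation Zp := (padic_int p_pr).

(** Needed because [ratr] is computed from the reduced fraction, while the arguments of Gamma_p
    occur as n / d not in lowest terms. *)
Lemma padic_ratrE (r : rat) (x : Zp) (n : int) (d : nat) : ~~ (p %| d)%N ->
  r * d%:R = n%:~R -> x * d%:R = n%:~R -> ratr r = x.
Proof.
move=> pd rd xd.
have d0 : (d%:R : Zp) != 0.
  by rewrite padic_natr_eq0; apply: contraNneq pd => ->; rewrite dvdn0.
have e : (numq r * d%:Z = n * denq r)%R.
  apply: (intr_inj (R := rat)); rewrite !rmorphM /= -rd numqE; ring.
have dd : (`|denq r| %| d)%N.
  have : (denq r %| numq r * d%:Z)%Z by rewrite e dvdz_mull.
  by rewrite Gauss_dvdzr // coprimezE coprime_sym; exact: coprime_num_den.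
have ud : ((denq r)%:~R : Zp) \is a GRing.unit.
  rewrite -absz_denq -pmulrn padic_unit_natr; apply: contra pd => pr.
  exact: dvdn_trans pr dd.
rewrite /ratr; apply: (mulIr ud); rewrite mulrVK //; apply: (mulIf d0).
rewrite mulrAC xd pmulrn -!rmorphM /=; congr _%:~R; exact: e.
Qed.

End PadicRat.

Lemma prod_ratio_expz (F : fieldType) n (x x' y y' : 'I_n -> F) (z : 'I_n -> int) (u : F) :
  u != 0 ->
  \prod_(i < n) (x i / x' i * (y i / y' i) * u ^ z i) =
  (\prod_(i < n) x i * \prod_(i < n) y i) /
  (\prod_(i < n) x' i * \prod_(i < n) y' i) * u ^ (\sum_(i < n) z i).
Proof.
move=> u0; rewrite !big_split /= !prodfV invfM.
rewrite (big_morph (fun z => u ^ z) (fun a b => expfzDr a b u0) (expr0z u)).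
by rewrite mulrACA.
Qed.

(** * The parameters of 4G4 as complete sets of quarters and sixths *)

Local Notation at_ := [tuple 1 / 8%:R; 5%:R / 8%:R; 3%:R / 8%:R; 7%:R / 8%:R :> rat].
Local Notation bt_ := [tuple 1 / 6%:R; 2%:R / 3%:R; 1 / 3%:R; 5%:R / 6%:R :> rat].

(** The upper parameters are (1/2 + h) / 4 with h = 0, 2, 1, 3 in the order of the tuple. *)
Lemma prod_upper (R : comPzSemiRingType) (f : rat -> R) (s : rat) :
  \prod_(i < 4) f (rat_frac (tnth at_ i - s)) =
  \prod_(0 <= h < 4) f (rat_frac ((1 / 2%:R - 4%:R * s + h%:R) / 4%:R)).
Proof.
rewrite !big_ord_recr big_ord0 !big_nat_recr //= big_geq // !mul1r !(tnth_nth 0) /=.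
rewrite -!mulrA; congr (f (rat_frac _) * _); first by field.
rewrite mulrCA; congr (f (rat_frac _) * (f (rat_frac _) * f (rat_frac _))); by field.
Qed.

(** Modulo 1, the numbers - b + s are s + h / 6 with h = 5, 2, 4, 1. The missing h = 0 and h = 3 are
    the two arguments of the product for 2. *)
Lemma prod_lower (R : comNzRingType) (f : rat -> R) (s : rat) :
  \prod_(i < 4) f (rat_frac (- tnth bt_ i + s)) *
  \prod_(0 <= h < 2) f (rat_frac ((2%:R * s + h%:R) / 2%:R)) =
  \prod_(0 <= h < 6) f (rat_frac ((6%:R * s + h%:R) / 6%:R)).
Proof.
pose g (h : nat) := f (rat_frac ((6%:R * s + h%:R) / 6%:R)).
have gE (x : rat) h : x + 1 = (6%:R * s + h%:R) / 6%:R -> f (rat_frac x) = g h.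
  by move=> e; rewrite /g -e rat_fracD1.
rewrite !big_ord_recr big_ord0 !big_nat_recr //= !big_geq // !mul1r !(tnth_nth 0) /=.
rewrite -/(g 0%N) -/(g 1%N) -/(g 2%N) -/(g 3%N) -/(g 4%N) -/(g 5%N).
rewrite (gE _ 5%N) ?(gE (- (2%:R / 3%:R) + s) 2%N) ?(gE (- (1 / 3%:R) + s) 4%N)
  ?(gE (- (5%:R / 6%:R) + s) 1%N); last first.
- by field.
- by field.
- by field.
- by field.
have -> : f (rat_frac ((2%:R * s + 0%:R) / 2%:R)) = g 0%N.
  by congr (f (rat_frac _)); field.
have -> : f (rat_frac ((2%:R * s + 1%:R) / 2%:R)) = g 3%N.
  by congr (f (rat_frac _)); field.
by ring.
Qed.

Lemma floor_pair (a b s x y : rat) : 0 <= a < 1 -> 0 < b <= 1 ->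
    a - s = x -> 1 - b + s = y ->
  - Num.floor (rat_frac a - s) - Num.floor (rat_frac (- b) + s) =
  - Num.floor x - Num.floor y.
Proof.
move=> a01 b01 <- <-; rewrite (rat_frac_id a01) -(rat_fracD1 (- b)) rat_frac_id.
  by rewrite [- b + 1]addrC.
by lra.
Qed.

(** Hermite's identity for 4, 6 and 2, with the parameters grouped as in [prod_upper] and
    [prod_lower]. *)
Lemma sum_floors (s : rat) :
  \sum_(i < 4) (- Num.floor (rat_frac (tnth at_ i) - s)
                - Num.floor (rat_frac (- tnth bt_ i) + s)) =
  - Num.floor (1 / 2%:R - 4%:R * s) - Num.floor (6%:R * s) + Num.floor (2%:R * s).
Proof.
pose A h := Num.floor ((1 / 2%:R - 4%:R * s + h%:R) / 4%:R).
pose B h := Num.floor ((6%:R * s + h%:R) / 6%:R).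
pose C h := Num.floor ((2%:R * s + h%:R) / 2%:R).
have SA : Num.floor (1 / 2%:R - 4%:R * s) = \sum_(0 <= h < 4) A h.
  by rewrite sum_floor_shift.
have SB : Num.floor (6%:R * s) = \sum_(0 <= h < 6) B h by rewrite sum_floor_shift.
have SC : Num.floor (2%:R * s) = \sum_(0 <= h < 2) C h by rewrite sum_floor_shift.
have C0 : C 0%N = B 0%N by congr (Num.floor _); field.
have C1 : C 1%N = B 3%N by congr (Num.floor _); field.
pose P a b := - Num.floor (rat_frac a - s) - Num.floor (rat_frac (- b) + s).
transitivity ((- A 0%N - B 5%N) + (- A 2%N - B 2%N) +
              (- A 1%N - B 4%N) + (- A 3%N - B 1%N)).
  rewrite !big_ord_recr big_ord0 /= add0r !(tnth_nth 0) /=.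
  have e1 : P (1 / 8%:R) (1 / 6%:R) = - A 0%N - B 5%N.
    by rewrite /P; apply: floor_pair; [lra|lra|field|field].
  have e2 : P (5%:R / 8%:R) (2%:R / 3%:R) = - A 2%N - B 2%N.
    by rewrite /P; apply: floor_pair; [lra|lra|field|field].
  have e3 : P (3%:R / 8%:R) (1 / 3%:R) = - A 1%N - B 4%N.
    by rewrite /P; apply: floor_pair; [lra|lra|field|field].
  have e4 : P (7%:R / 8%:R) (5%:R / 6%:R) = - A 3%N - B 1%N.
    by rewrite /P; apply: floor_pair; [lra|lra|field|field].
  by rewrite -e1 -e2 -e3 -e4.
rewrite SA SB SC; move: A B C {SA SB SC} C0 C1 => A B C C0 C1.
by rewrite !big_nat_recr //= !big_geq // C0 C1; ring.
Qed.

(** * Identification of the summands of 4G4 with the Mellin coefficients *)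

Section Assembly.
Variables (p : nat) (p_pr : prime p) (p_gt4 : (4 < p)%N).
Local Notation Zp := (padic_int p_pr).
Local Notation K := {fraction Zp}.
Local Notation "x %:F" := (@FracField.tofrac Zp x) : ring_scope.
Local Notation q := p.-1.
Local Notation om := (@omega p p_pr).
Local Notation Gamma := (@padic_gamma p p_pr).
Local Notation gauss_coef := (@gauss_coef p p_pr).
Variable k0 : nat.
Hypothesis k0E : (k0 + k0 = q)%N.

Local Notation GQ k := (Gamma (k%:R / q%:R)).

Let q_unit : (q%:R : Zp) \is a GRing.unit.
Proof. exact: padic_q_unit. Qed.

Let G_unit x : Gamma x \is a GRing.unit.
Proof. exact: padic_gamma_unit (p_odd p_pr p_gt4) x. Qed.

Lemma gauss_coefE k : (k < q)%N -> gauss_coef k = - GQ k.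
Proof.
move=> kq; have yk : (k%:R / q%:R : Zp) * q%:R = k%:R by rewrite divrK.
have := padic_gamma_reflection (p_odd p_pr p_gt4) kq yk; rewrite exprS mulN1r => e.
apply: (mulIr (G_unit (1 - k%:R / q%:R))).
by rewrite /gauss_coef divrK // mulNr e opprK.
Qed.

(** The three Gauss sums have exponents k1 = - n, k2 = 3 n and k3 = k0 - 2 n modulo p - 1.
    Reflection moves the value at k1 to [kk], with sign -1 because [kk] is even. For the trivial
    character the term from x = 0 adds p - 1 to 1, whence p. *)
Lemma mellin_gamma n kk k2 k3 e : (k2 < q)%N -> (k3 < q)%N -> (kk < q)%N ->
    (n = kk %[mod q])%N -> (3 * n = k2 %[mod q])%N -> (2 * n + k3 = k0 %[mod q])%N ->
    ~~ odd kk ->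
    (k2 + k3 + (if kk == 0 then 0 else q) = k0 + kk + q * e)%N ->
  cubic_mellin p_pr k0 n * GQ k0 * GQ kk =
  GQ k2 * GQ k3 * ((if kk == 0%N then p%:R else -1) * (- p%:R) ^+ e).
Proof.
move=> k2q k3q kkq nk nk2 nk3 okk ee.
have q0 : (0 < q)%N by clear -p_gt4; lia.
have k0q : (k0 < q)%N by clear -p_gt4 k0E; lia.
pose n' := (q.-1 * n)%N; pose k1 := if kk == 0%N then 0%N else (q - kk)%N.
have nn : (n + n' = q * n)%N by rewrite /n' -mulSn prednK.
have h0 : (q %| n + n')%N by rewrite nn dvdn_mulr.
have k1q : (k1 < q)%N by rewrite /k1; case: eqP; clear -q0 kkq; lia.
have k1e : (q %| kk + k1)%N.
  by rewrite /k1; case: eqP => [->|_]; rewrite ?dvdn0 // subnKC // ltnW.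
have h1 : (q %| n + k1)%N by rewrite /dvdn -modnDml nk modnDml.
have h2 : (q %| 3 * n' + k2)%N.
  rewrite /dvdn -modnDmr -nk2 modnDmr -mulnDr addnC nn mulnCA; exact: dvdn_mulr.
have h3 : (q %| k0 + n' + 3 * n + k3)%N.
  have -> : (k0 + n' + 3 * n + k3 = k0 + q * n + (2 * n + k3))%N.
    by rewrite -nn; clear; lia.
  by rewrite /dvdn -modnDmr nk3 modnDmr addnAC k0E -mulnS mulnC modnMl.
have dn : (q %| n)%N = (kk == 0%N).
  by rewrite /dvdn nk modn_small.
have ek : (k1 + k2 + k3 = k0 + q * e)%N.
  move: ee; rewrite /k1; move: (q * e)%N => qe; case: eqP => [->|_]; clear -kkq; lia.
have := cubic_mellin_value p_pr p_gt4 k0E h0 k1q k2q k3q h1 h2 h3 ek.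
rewrite !gauss_coefE // dn /k1; case: eqP ee => [kk0|kk0] ee.
  have k20 : k2 = 0%N.
    rewrite -(modn_small k2q) -nk2 -modnMmr nk kk0 mod0n muln0 mod0n //.
  have [e0 k30] : e = 0%N /\ k3 = k0.
    move: ee; rewrite k20 kk0; case: (e) => [|e']; first by clear; lia.
    by rewrite mulnS; move: (q * e')%N => qe; clear -k3q k0q; lia.
  rewrite kk0 k20 k30 e0 expr0 mulr1 mul0r.
  rewrite padic_gamma0 ?p_odd // => e1.
  have {}e1 : GQ k0 * cubic_mellin p_pr k0 n = GQ k0 + q%:R * GQ k0.
    by apply: oppr_inj; rewrite -mulNr e1; ring.
  rewrite !mulr1 mul1r mulrC e1.
  have -> : (p%:R : Zp) = q%:R + 1 by rewrite natr1 prednK ?prime_gt0.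
  by ring.
rewrite mul0r addr0 => e1.
have ykk : (kk%:R / q%:R : Zp) * q%:R = kk%:R by rewrite divrK.
have := padic_gamma_reflection (p_odd p_pr p_gt4) kkq ykk.
have -> : 1 - kk%:R / q%:R = (q - kk)%:R / q%:R :> Zp.
  by rewrite natrB ?mulrBl ?divrr // ltnW.
rewrite exprS -signr_odd (negbTE okk) expr0 mulr1 => refl.
have {}e1 : GQ k0 * cubic_mellin p_pr k0 n = GQ (q - kk) * GQ k2 * GQ k3 * (- p%:R) ^+ e.
  by apply: oppr_inj; rewrite -mulNr e1; ring.
rewrite [_ * GQ k0]mulrC e1.
transitivity (GQ kk * GQ (q - kk) * (GQ k2 * GQ k3 * (- p%:R) ^+ e)); first by ring.
by rewrite refl; ring.
Qed.

Definition gamma_rat (r : rat) : Zp := Gamma (ratr r).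

Let q_gt0 : (0 < q)%N.
Proof. by clear -p_gt4; lia. Qed.

Let qQ_neq0 : (q%:R : rat) != 0.
Proof. by rewrite pnatr_eq0 -lt0n. Qed.

Lemma floor_frac k (z : int) (y : rat) : (k < q)%N -> y = k%:R / q%:R + z%:~R ->
  Num.floor y = z /\ rat_frac y = k%:R / q%:R.
Proof.
move=> kq ->; have fz : Num.floor (k%:R / q%:R + z%:~R : rat) = z.
  have h0 : 0 <= k%:R / q%:R :> rat by rewrite divr_ge0 ?ler0n.
  have h1 : k%:R / q%:R < 1 :> rat by rewrite ltr_pdivrMr ?ltr0n // mul1r ltr_nat.
  by apply: floor_def; rewrite rmorphD /=; apply/andP; split; lra.
by split=> //; rewrite /rat_frac fz addrK.
Qed.

Lemma prod_gamma_rat m k (z : int) (y : rat) : (0 < m)%N -> ~~ (p %| m)%N ->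
    (k < q)%N -> y = k%:R / q%:R + z%:~R ->
  \prod_(0 <= h < m) gamma_rat (rat_frac ((y + h%:R) / m%:R)) =
  \prod_(0 <= h < m) Gamma (h%:R / m%:R) * om m%:R ^+ k * GQ k.
Proof.
move=> m0 pm kq yE; rewrite (prod_frac_shift gamma_rat) //.
have [_ ->] := floor_frac kq yE.
have yk : (k%:R / q%:R : Zp) * q%:R = k%:R by rewrite divrK.
rewrite -(padic_gamma_multiplication (p_odd p_pr p_gt4) m0 pm kq yk).
apply: eq_bigr => h _; congr (Gamma _).
have mQ : (m%:R : rat) != 0 by rewrite pnatr_eq0 -lt0n.
have mZ : (m%:R : Zp) \is a GRing.unit by rewrite padic_unit_natr.
apply: (@padic_ratrE _ _ _ _ (k + h * q)%N (m * q)).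
- by rewrite Euclid_dvdM // negb_or pm gtnNdvd //; clear -p_gt4; lia.
- by rewrite -pmulrn natrD !natrM mulrA divfK // mulrDl divfK.
- by rewrite -pmulrn natrD !natrM mulrA divrK // mulrDl divrK.
Qed.

Section Term.
Variable j : nat.
Hypothesis jq : (j < q)%N.
Let t : rat := j%:R / q%:R.
Let kk := (2 * j %% q)%N.
Let k2 := (6 * j %% q)%N.
(** A natural number congruent to k0 - 4 j; the excess 4 q reappears as the - 4 in [t4E]. *)
Let l3 := (k0 + 4 * (q - j))%N.
Let k3 := (l3 %% q)%N.

Let natQ l : (l%:R / q%:R : rat) = (l %% q)%:R / q%:R + (l %/ q)%:Z%:~R.
Proof.
by rewrite [in LHS](divn_eq l q) -pmulrn natrD natrM mulrDl mulfK // addrC.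
Qed.

Let t2E : 2%:R * t = kk%:R / q%:R + (2 * j %/ q)%:Z%:~R.
Proof. by rewrite /t mulrA -natrM; exact: natQ. Qed.

Let t6E : 6%:R * t = k2%:R / q%:R + (6 * j %/ q)%:Z%:~R.
Proof. by rewrite /t mulrA -natrM; exact: natQ. Qed.

Let t4E : 1 / 2%:R - 4%:R * t = k3%:R / q%:R + ((l3 %/ q)%:Z - 4)%:~R.
Proof.
have k0Q : (k0%:R : rat) != 0.
  by rewrite pnatr_eq0; apply/eqP => k00; move: q_gt0; rewrite -k0E k00.
have qk : (q%:R : rat) = 2%:R * k0%:R by rewrite -k0E natrD; ring.
rewrite rmorphB /= addrA -natQ /l3 natrD natrM natrB ?(ltnW jq) // /t qk.
by field.
Qed.

Let kkq : (kk < q)%N. Proof. exact: ltn_pmod. Qed.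
Let k2q : (k2 < q)%N. Proof. exact: ltn_pmod. Qed.
Let k3q : (k3 < q)%N. Proof. exact: ltn_pmod. Qed.

(** The two cases of [mellin_gamma] merge, since - (-p)^e = p (-p)^(e-1): in both, the factor is p
    times the power of - p that occurs in 4G4. *)
Lemma mellin_rat : (cubic_mellin p_pr k0 (2 * j))%:F * (GQ k0 * GQ kk)%:F =
  p%:R * (GQ k2 * GQ k3)%:F *
  (- p%:R : K) ^ (- Num.floor (1 / 2%:R - 4%:R * t) - Num.floor (6%:R * t)
     + Num.floor (2%:R * t)).
Proof.
rewrite (floor_frac kkq t2E).1 (floor_frac k2q t6E).1 (floor_frac k3q t4E).1.
set e' : int := - _ - _ + _.
have qe : q%:Z * e' = k2%:Z + k3%:Z - k0%:Z - kk%:Z.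
  have d1 := divn_eq (2 * j) q; have d2 := divn_eq (6 * j) q; have d3 := divn_eq l3 q.
  rewrite -/kk in d1; rewrite -/k2 in d2; rewrite -/k3 in d3.
  rewrite /e'; move: (2 * j %/ q)%N (6 * j %/ q)%N (l3 %/ q)%N d1 d2 d3 => c1 c2 c3 d1 d2 d3.
  transitivity (4 * q%:Z - (c3 * q)%:Z - (c2 * q)%:Z + (c1 * q)%:Z).
    by rewrite !PoszM; ring.
  rewrite /l3 in d3; move: d1 d2 d3; move: (kk) (k2) (k3) (c1 * q)%N (c2 * q)%N (c3 * q)%N.
  by move=> a1 a2 a3 b1 b2 b3; clear -jq k0E; lia.
have okk : ~~ odd kk.
  by rewrite /kk -k0E addnn -mul2n -muln_modr oddM.
have l3e : (2 * (2 * j) + k3 = k0 %[mod q])%N.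
  rewrite modnDmr (_ : _ + l3 = 4 * q + k0)%N ?modnMDl //.
  by rewrite /l3; clear -jq; lia.
(* As k0 + kk < 2 q, the exponent e' is at least -1, and it is nonnegative when kk = 0. *)
have [e ee] : exists e : nat, e' + (if kk == 0%N then 0 else 1) = e%:Z.
  have : 0 <= e' + (if kk == 0%N then 0 else 1).
    move: qe k2q k3q kkq k0E; move: (kk) (k2) (k3) => a1 a2 a3; clear -q_gt0.
    by case: eqP => [->|_]; nia.
  by case: (_ + _) => // e _; exists e.
have ee' : (k2 + k3 + (if kk == 0%N then 0 else q) = k0 + kk + q * e)%N.
  move: qe ee; move: (kk) (k2) (k3) => a1 a2 a3; clear -q_gt0.
  by case: eqP => [->|_]; nia.
have n2 : (2 * j = kk %[mod q])%N by rewrite modn_mod.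
have n3 : (3 * (2 * j) = k2 %[mod q])%N by rewrite modn_mod mulnA.
have := mellin_gamma k2q k3q kkq n2 n3 l3e okk ee'.
move=> /(congr1 (@FracField.tofrac Zp)); rewrite -mulrA rmorphM /= => ->.
rewrite rmorphM /= [p%:R * _]mulrC -[RHS]mulrA; congr (_ * _).
have pN0 : (- p%:R : K) != 0 by rewrite oppr_eq0 frac_p_neq0.
have pe : ((- p%:R) ^+ e : Zp)%:F = (- p%:R : K) ^ e.
  by rewrite rmorphXn rmorphN /= frac_natr.
rewrite rmorphM /= pe -ee expfzDr //; case: ifP => _.
  by rewrite expr0z mulr1 frac_natr.
by rewrite expr1z rmorphN rmorph1; ring.
Qed.

Let upper (s : rat) : Zp := \prod_(i < 4) gamma_rat (rat_frac (tnth at_ i - s)).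
Let lower (s : rat) : Zp := \prod_(i < 4) gamma_rat (rat_frac (- tnth bt_ i + s)).
Let C m : Zp := \prod_(0 <= h < m) Gamma (h%:R / m%:R).

Let C_unit m : C m \is a GRing.unit.
Proof.
apply: (big_ind (fun x : Zp => x \is a GRing.unit)) => // [|x y ux uy].
  exact: unitr1.
by rewrite unitrM ux.
Qed.

Let upperE (s : rat) k z : (k < q)%N -> 1 / 2%:R - 4%:R * s = k%:R / q%:R + z%:~R ->
  upper s = C 4 * om 4%:R ^+ k * GQ k.
Proof.
move=> kq e; rewrite /upper prod_upper; apply: prod_gamma_rat kq e => //.
by rewrite gtnNdvd.
Qed.

Let p6 : ~~ (p %| 6)%N.
Proof.
by rewrite (_ : 6 = 2 * 3)%N // Euclid_dvdM // negb_or !gtnNdvd //; clear -p_gt4; lia.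
Qed.

Let lowerE (s : rat) k z l w : (k < q)%N -> (l < q)%N ->
    6%:R * s = k%:R / q%:R + z%:~R -> 2%:R * s = l%:R / q%:R + w%:~R ->
  lower s * (C 2 * om 2%:R ^+ l * GQ l) = C 6 * om 6%:R ^+ k * GQ k.
Proof.
move=> kq lq e6 e2; rewrite -(prod_gamma_rat (isT : 0 < 6)%N p6 kq e6) -prod_lower.
have p2 : ~~ (p %| 2)%N by rewrite gtnNdvd //; clear -p_gt4; lia.
by congr (_ * _); rewrite -(prod_gamma_rat (isT : 0 < 2)%N p2 lq e2).
Qed.

Let GQ0 : GQ 0 = 1.
Proof. by rewrite mul0r padic_gamma0 // p_odd. Qed.

Let Fp_neq0 n : (0 < n < 5)%N -> (n%:R : 'F_p) != 0.
Proof. by move=> n5; apply: (Fp_natr_neq0 p_pr); clear -n5 p_gt4; lia. Qed.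

(** Modulo p - 1, the exponents k3, k2 and kk are k0 - 4 j, 6 j and 2 j, and 6^6 / (4^4 2^2) = 3^6 /
    2^4. *)
Let omega_powers :
  om 4%:R ^+ k3 * om 6%:R ^+ k2 =
  om (3%:R ^+ 6 / 2%:R ^+ 4) ^+ j * om 2%:R ^+ kk * om 4%:R ^+ k0.
Proof.
have n2 : (2%:R : 'F_p) != 0 by exact: Fp_neq0.
have n3 : (3%:R : 'F_p) != 0 by exact: Fp_neq0.
have n4 : (4%:R : 'F_p) != 0 by exact: Fp_neq0.
have n6 : (6%:R : 'F_p) != 0 by rewrite (natrM _ 2 3) mulf_neq0.
have e2 : om 2%:R ^+ kk = om 2%:R ^+ (2 * j) by apply: omega_mod; rewrite ?modn_mod.
have e6 : om 6%:R ^+ k2 = om 6%:R ^+ (6 * j) by apply: omega_mod; rewrite ?modn_mod.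
have e4 : om 4%:R ^+ k3 * om 4%:R ^+ (4 * j) = om 4%:R ^+ k0.
  rewrite -exprD; apply: omega_mod => //.
  rewrite modnDml (_ : l3 + 4 * j = 4 * q + k0)%N ?modnMDl //.
  by rewrite /l3; clear -jq; lia.
apply: (mulIr (unitrX (4 * j) (omega_unit p_pr n4))).
rewrite mulrAC e4 e6 e2.
transitivity (om 4%:R ^+ k0 *
  (om (3%:R ^+ 6 / 2%:R ^+ 4) ^+ j * om 2%:R ^+ (2 * j) * om 4%:R ^+ (4 * j))).
  congr (_ * _); rewrite !exprM -!exprMn; congr (_ ^+ j).
  rewrite -!omegaXn -!omegaM; congr (om _).
  by field; rewrite (natrM _ 4 4) mulf_neq0.
by ring.
Qed.

(** The constants [C 2], [C 4], [C 6] occur at t and at 0 alike and cancel in the normalised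
    quotients. What remains is the Gamma_p quotient of [mellin_rat] and the power of omega (3^6 /
    2^4) removed by [omega_powers]. *)
Lemma factor_term :
  p%:R * ((om (3%:R ^+ 6 / 2%:R ^+ 4))^-1 ^+ j)%:F *
  \prod_(i < 4) padic_G_factor p_pr (tnth at_ i) (tnth bt_ i) t =
  (cubic_mellin p_pr k0 (2 * j))%:F.
Proof.
have pN0 : (- p%:R : K) != 0 by rewrite oppr_eq0 frac_p_neq0.
pose X : Zp := upper t * lower t; pose X0 : Zp := upper 0 * lower 0.
have GU r : gamma_rat r \is a GRing.unit by exact: G_unit.
have X0u : X0 \is a GRing.unit.
  rewrite unitrM; apply/andP; split;
    by apply: (big_ind (fun x : Zp => x \is a GRing.unit)) => // [|x y ux uy];
       rewrite ?unitr1 ?unitrM ?ux.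
pose W : Zp := om (3%:R ^+ 6 / 2%:R ^+ 4) ^+ j.
have prodE : \prod_(i < 4) padic_G_factor p_pr (tnth at_ i) (tnth bt_ i) t =
    X%:F / X0%:F * (- p%:R : K) ^ (- Num.floor (1 / 2%:R - 4%:R * t)
       - Num.floor (6%:R * t) + Num.floor (2%:R * t)).
  rewrite -sum_floors /X /X0 /upper /lower !rmorphM /= !rmorph_prod /=.
  rewrite -prod_ratio_expz //; apply: eq_bigr => i _.
  by rewrite /padic_G_factor !subr0.
have k0q : (k0 < q)%N by clear -p_gt4 k0E; lia.
have key : X * (GQ kk * GQ k0) = W * X0 * (GQ k3 * GQ k2).
  have e4 := upperE k3q t4E; have e6 := lowerE k2q kkq t6E t2E.
  have z0 (c : rat) : c * 0 = 0%:R / q%:R + 0%:~R by rewrite mulr0 mul0r addr0.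
  have u0 : upper 0 = C 4 * om 4%:R ^+ k0 * GQ k0.
    apply: (@upperE _ _ 0 k0q); rewrite mulr0 subr0 addr0 -k0E natrD.
    have k0Q : (k0%:R : rat) != 0.
      by rewrite pnatr_eq0; apply/eqP => k00; move: q_gt0; rewrite -k0E k00.
    by rewrite -mulr2n -mulr_natl; field.
  have l0 := lowerE q_gt0 q_gt0 (z0 6%:R) (z0 2%:R).
  rewrite !expr0 !mulr1 GQ0 !mulr1 in l0.
  have n2 : (2%:R : 'F_p) != 0 by exact: Fp_neq0.
  have uu : C 2 * om 2%:R ^+ kk \is a GRing.unit.
    by rewrite unitrM C_unit unitrX // omega_unit.
  apply: (mulIr uu).
  transitivity (upper t * (lower t * (C 2 * om 2%:R ^+ kk * GQ kk)) * GQ k0).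
    by rewrite /X; ring.
  rewrite e4 e6.
  transitivity ((om 4%:R ^+ k3 * om 6%:R ^+ k2) * (C 4 * C 6 * GQ k3 * GQ k2 * GQ k0)).
    by ring.
  rewrite omega_powers -/W -l0 /X0 u0; ring.
have WE : (om (3%:R ^+ 6 / 2%:R ^+ 4))^-1 ^+ j * W = 1.
  rewrite /W -exprMn mulVr ?expr1n // omega_unit // mulf_neq0 ?invr_eq0 ?expf_neq0 //;
    exact: Fp_neq0.
have gu : GQ k0 * GQ kk \is a GRing.unit by rewrite unitrM !G_unit.
have F_neq0 (x : Zp) : x \is a GRing.unit -> (x%:F : K) != 0.
  by move=> ux; rewrite tofrac_eq0; apply: contraTneq ux => ->; rewrite unitr0.
apply: (mulIf (F_neq0 _ gu)); rewrite mellin_rat prodE.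
set v : Zp := _ ^-1 ^+ j in WE *; set E := (- p%:R) ^ _.
have -> : p%:R * v%:F * (X%:F / X0%:F * E) * (GQ k0 * GQ kk)%:F =
    p%:R * ((v * (X * (GQ kk * GQ k0)))%:F / X0%:F) * E.
  rewrite [GQ k0 * _]mulrC !(rmorphM _ _ _) /=.
  move: (GQ kk)%:F (GQ k0)%:F (X%:F) (X0%:F^-1) (v%:F) (p%:R : K) E => g1 g2 x x0 w P E.
  by ring.
congr (_ * _ * _); rewrite key; apply/(canLR (mulfK (F_neq0 _ X0u))).
rewrite -rmorphM /=; congr _%:F.
transitivity (v * W * (X0 * (GQ k3 * GQ k2))); first by ring.
by rewrite WE mul1r; ring.
Qed.

End Term.

End Assembly.

Lemma sw_j_value_b0 (F : fieldType) (a c : F) : (2%:R : F) != 0 -> a != 0 ->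
  - c * (4%:R * a) ^+ 3 / (- 16%:R * (4%:R * a ^+ 3)) = c.
Proof.
move=> n2 a0; have -> : (4%:R : F) = 2%:R * 2%:R by ring.
have -> : (16%:R : F) = 2%:R * 2%:R * (2%:R * 2%:R) by ring.
by move: (2%:R : F) n2 => u u0; field; rewrite a0 u0 oppr_eq0 !mulf_neq0.
Qed.

Lemma lambda_mu (F : fieldType) (a b u v : F) : v != 0 -> a != 0 ->
  u ^+ 6 * b ^+ 4 / (v ^+ 4 * a ^+ 6) = u ^+ 6 / v ^+ 4 * (b ^+ 2 / a ^+ 3) ^+ 2.
Proof. by move=> v0 a0; field; rewrite a0 v0. Qed.

Theorem corollary5p11 (p : nat) (p_pr : prime p) (p_gt3 : (3 < p)%N)
    (a b : 'F_p)
    (ell_pos : sw_elliptic a b) (ell_neg : sw_elliptic (- a) b)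
    (j_pos_0 : sw_j a b != 0) (j_pos_1728 : sw_j a b != 1728%:R)
    (j_neg_0 : sw_j (- a) b != 0) (j_neg_1728 : sw_j (- a) b != 1728%:R) :
  padic_G p_pr
    [tuple 1 / 8%:R; 5%:R / 8%:R; 3%:R / 8%:R; 7%:R / 8%:R]
    [tuple 1 / 6%:R; 2%:R / 3%:R; 1 / 3%:R; 5%:R / 6%:R]
    (3%:R ^+ 6 * b ^+ 4 / (2%:R ^+ 4 * a ^+ 6))
  = (quad_char b)%:~R / p%:R
    * (frobenius_trace a b + frobenius_trace (- a) b)%:~R.
Proof.
have p_gt4 : (4 < p)%N.
  by move: p_gt3; rewrite leq_eqVlt => /orP[/eqP p4|//]; move: (p_pr); rewrite -p4.
have n2 : (2%:R : 'F_p) != 0 by apply: (Fp_natr_neq0 p_pr); clear -p_gt4; lia.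
have n3 : (3%:R : 'F_p) != 0 by apply: (Fp_natr_neq0 p_pr); clear -p_gt4; lia.
(* The j-invariant is 0 when a = 0 and 1728 when b = 0; the substitution x -> (b / a) x needs both
   to be nonzero. *)
have a0 : a != 0.
  apply: contraNneq j_pos_0 => ->.
  by rewrite /sw_j mulr0 expr0n mulr0 mul0r.
have b0 : b != 0.
  apply: contraNneq j_pos_1728 => ->; rewrite /sw_j /sw_disc expr0n mulr0 addr0.
  by apply/eqP; exact: sw_j_value_b0.
have oddp := p_odd p_pr p_gt4.
pose k0 := (p.-1)./2.
have k0E : (k0 + k0 = p.-1)%N.
  rewrite addnn -[RHS]odd_double_half -/k0 (_ : odd p.-1 = false) //.
  by apply/negbTE; rewrite -oddS prednK ?prime_gt0.
pose mu := b ^+ 2 / a ^+ 3.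
have mu0 : mu != 0 by rewrite mulf_neq0 ?invr_eq0 ?expf_neq0.
pose c : 'F_p := 3%:R ^+ 6 / 2%:R ^+ 4.
have c0 : c != 0 by rewrite mulf_neq0 ?invr_eq0 ?expf_neq0.
have lamE : 3%:R ^+ 6 * b ^+ 4 / (2%:R ^+ 4 * a ^+ 6) = c * mu ^+ 2.
  exact: lambda_mu.
pose K := {fraction padic_int p_pr}.
have pK : (p%:R : K) != 0 by exact: frac_p_neq0.
have qK : (p.-1%:R : K) != 0 by rewrite frac_natr_eq0; clear -p_gt4; lia.
(* After multiplication by p both sides are images of elements of Z_p, where the Mellin identities
   live. *)
apply: (mulfI pK).
pose Z : padic_int p_pr := (quad_char b)%:~R *
  (frobenius_trace a b + frobenius_trace (- a) b)%:~R.
have ZE : Z = - (cubic_sum p_pr k0 mu + cubic_sum p_pr k0 (- mu)).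
  rewrite /Z rmorphD mulrDr /= !(trace_cubic_sum _ p_gt4 k0E) ?oppr_eq0 // opprD.
  by rewrite [in X in _ + X]exprNn -signr_odd expr1 mulN1r invrN mulrN.
transitivity (FracField.tofrac Z : K); last first.
  rewrite rmorphM !rmorph_int /= [RHS]mulrA; congr (_ * _).
  by rewrite mulrCA divff // mulr1.
rewrite {}ZE /padic_G lamE.
have termE j : (j < p.-1)%N -> (p%:R : K) * ((-1) ^+ (j * 4) *
    padic_of_int (teichmuller_inv_pow p_pr j (c * mu ^+ 2)) *
    \prod_(i < 4) padic_G_factor p_pr
      (tnth [tuple 1 / 8%:R; 5%:R / 8%:R; 3%:R / 8%:R; 7%:R / 8%:R] i)
      (tnth [tuple 1 / 6%:R; 2%:R / 3%:R; 1 / 3%:R; 5%:R / 6%:R] i)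
      (j%:R / p.-1%:R)) =
    FracField.tofrac (omega p_pr (mu ^+ 2)^-1 ^+ j * cubic_mellin p_pr k0 (2 * j)).
  move=> jq; rewrite rmorphM /= -(factor_term p_pr p_gt4 k0E jq) /=.
  rewrite -signr_odd oddM andbF expr0 mul1r /teichmuller_inv_pow ifN; last first.
    by rewrite mulf_neq0 ?expf_neq0.
  rewrite /padic_of_int.
  have -> : (teichmuller p_pr (c * mu ^+ 2))^-1 ^+ j =
      omega p_pr (mu ^+ 2)^-1 ^+ j * (omega p_pr c)^-1 ^+ j.
    have cm : c * mu ^+ 2 != 0 by rewrite mulf_neq0 ?expf_neq0.
    have <- : omega p_pr (c * mu ^+ 2) = teichmuller p_pr (c * mu ^+ 2).
      by rewrite /omega (negbTE cm).
    rewrite omegaM invrM ?omega_unit ?expf_neq0 // -omegaV ?expf_neq0 //.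
    by rewrite exprMn.
  rewrite (rmorphM _ (omega p_pr (mu ^+ 2)^-1 ^+ j)) /=.
  move: (\prod_(i < 4) _) => P.
  by rewrite -/c -!mulrA mulrCA.
rewrite mulrCA big_distrr /= (eq_big_nat _ _ (F2 := fun j => FracField.tofrac
  (omega p_pr (mu ^+ 2)^-1 ^+ j * cubic_mellin p_pr k0 (2 * j)))); last first.
  by move=> j /andP[_ jq]; exact: termE.
rewrite -rmorph_sum /= /cubic_mellin.
rewrite (mellin_even p_gt4 k0E (cubic_sum p_pr k0) mu0).
rewrite (rmorphM _ p.-1%:R) rmorphN /= frac_natr.
move: (FracField.tofrac _) => x.
by rewrite mulrA mulN1r mulNr mulVf // mulN1r.
Qed.
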